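(* Let $\mathbf c$ be a cost function such that $\mathbf c\to\mathbf c_\Omega$. Then there is a computably enumerable set $A$ that is smart for $\mathbf c$.
   Context: Cost functions: computable $\mathbf c:\mathbb N\times\mathbb N\to[0,\infty)$, monotonic ($\mathbf c(x,s)\le\mathbf c(x,s+1)$, $\mathbf c(x+1,s)\le\mathbf c(x,s)$), with the limit condition ($\underline{\mathbf c}(x)=\lim_s\mathbf c(x,s)$ exists and $\lim_x\underline{\mathbf c}(x)=0$), and $\mathbf c(x,s)=0$ for $x\ge s$. For a computable approximation $\langle A_s\rangle$ of a $\Delta^0_2$ set $A$, its total $\mathbf c$-cost is $\sum_s\mathbf c(x_s,s)$, summed over stages $s$ where $A_{s-1}\ne A_s$, with $x_s$ least such that $A_{s-1}(x_s)\ne A_s(x_s)$; $A$ obeys $\mathbf c$ ($A\models\mathbf c$) if some computable approximation of $A$ has finite total $\mathbf c$-cost. $\mathbf c\to\mathbf d$ means every $\Delta^0_2$ set obeying $\mathbf c$ obeys $\mathbf d$ (equivalently $\underline{\mathbf d}\le C\,\underline{\mathbf c}$ for some constant $C$). $\Omega$ is a fixed left-c.e. ML-random real with a computable increasing sequence of rationals $\Omega_s\to\Omega$, and $\mathbf c_\Omega(x,s)=\Omega_s-\Omega_x$; a set obeys $\mathbf c_\Omega$ iff it is $K$-trivial. A $\mathbf c$-bounded test is a nested sequence $\langle V_n\rangle$ of uniformly c.e. open sets with $\mu(V_n)\le C\,\underline{\mathbf c}(n)$ for a constant $C$; it captures the elements of $\bigcap_nV_n$. A $K$-trivial set $A$ is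 smart for $\mathbf c$ if $A\models\mathbf c$ and for every ML-random $Y$: $Y$ is captured by some $\mathbf c$-bounded test iff $A\le_{\mathrm T}Y$. *)

(* Defs.v *)
From Stdlib Require Import Reals List Arith Bool.
Import ListNotations.
Open Scope R_scope.

(* Cantor pairing and its inverse (they enumerate the same diagonal order). *)
Definition cpair (a b : nat) : nat := ((a + b) * (a + b + 1) / 2 + b)%nat.

Fixpoint unpair (n : nat) : nat * nat :=
  match n with
  | O => (O, O)
  | S n' => let (x, y) := unpair n' in
            match x with O => (S y, O) | S x' => (x', S y) end
  end.

Inductive code : Type :=
| cZero | cSucc | cId | cFst | cSnd | cOracle
| cPair (f g : code) | cComp (f g : code) | cRec (f g : code) | cMu (f : code).

Inductive eval (O : nat -> bool) : code -> nat -> nat -> Prop :=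
| eZero x : eval O cZero x 0
| eSucc x : eval O cSucc x (S x)
| eId x : eval O cId x x
| eFst x : eval O cFst x (fst (unpair x))
| eSnd x : eval O cSnd x (snd (unpair x))
| eOracle x : eval O cOracle x (if O x then 1%nat else 0%nat)
| ePair f g x a b : eval O f x a -> eval O g x b -> eval O (cPair f g) x (cpair a b)
| eComp f g x y z : eval O g x y -> eval O f y z -> eval O (cComp f g) x z
| eRec0 f g x y : eval O f x y -> eval O (cRec f g) (cpair x 0) y
| eRecS f g x n z y :
    eval O (cRec f g) (cpair x n) z -> eval O g (cpair x (cpair n z)) y ->
    eval O (cRec f g) (cpair x (S n)) y
| eMu f x n :
    eval O f (cpair x n) 0 ->
    (forall m, (m < n)%nat -> exists k, eval O f (cpair x m) (S k)) ->
    eval O (cMu f) x n.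

Definition eval0 := eval (fun _ => false).
Definition halts0 (e : code) (x : nat) : Prop := exists y, eval0 e x y.

Definition computable_real2 (c : nat -> nat -> R) : Prop :=
  exists e1 e2 e3 : code, forall x s k : nat, exists n m d : nat,
    eval0 e1 (cpair (cpair x s) k) n /\ eval0 e2 (cpair (cpair x s) k) m /\
    eval0 e3 (cpair (cpair x s) k) d /\
    Rabs (c x s - (INR n - INR m) / INR (S d)) <= / 2 ^ k.

Definition computable_Q_seq (q : nat -> R) : Prop :=
  exists e1 e2 e3 : code, forall s : nat, exists n m d : nat,
    eval0 e1 s n /\ eval0 e2 s m /\ eval0 e3 s d /\
    q s = (INR n - INR m) / INR (S d).

Definition climit (c : nat -> nat -> R) (x : nat) (l : R) : Prop :=
  Un_cv (fun s => c x s) l.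

Definition cost_function (c : nat -> nat -> R) : Prop :=
  computable_real2 c /\
  (forall x s, 0 <= c x s) /\
  (forall x s, c x s <= c x (S s)) /\
  (forall x s, c (S x) s <= c x s) /\
  (forall x, exists l, climit c x l) /\
  (forall eps, eps > 0 -> exists N, forall x l, (N <= x)%nat -> climit c x l -> l < eps) /\
  (forall x s, (s <= x)%nat -> c x s = 0).

Definition comp_approx (A : nat -> bool) (As : nat -> nat -> bool) : Prop :=
  (exists e, forall s x, eval0 e (cpair s x) (if As s x then 1%nat else 0%nat)) /\
  (forall x, exists s0, forall s, (s0 <= s)%nat -> As s x = A x).

Definition Delta02 (A : nat -> bool) : Prop := exists As, comp_approx A As.

Definition stage_cost_is (c : nat -> nat -> R) (As : nat -> nat -> bool) (t : nat) (r : R) : Prop :=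
  (exists x, As t x <> As (S t) x /\ (forall y, (y < x)%nat -> As t y = As (S t) y) /\
             r = c x (S t)) \/
  ((forall x, As t x = As (S t) x) /\ r = 0).

Definition finite_cost (c : nat -> nat -> R) (As : nat -> nat -> bool) : Prop :=
  exists (f : nat -> R) (B : R),
    (forall t, stage_cost_is c As t (f t)) /\ (forall N, sum_f_R0 f N <= B).

Definition obeys (A : nat -> bool) (c : nat -> nat -> R) : Prop :=
  exists As, comp_approx A As /\ finite_cost c As.

Definition cost_implies (c d : nat -> nat -> R) : Prop :=
  forall A, Delta02 A -> obeys A c -> obeys A d.

(* c_Omega from the rational approximations q s = Omega_s *)
Definition cOmega (q : nat -> R) (x s : nat) : R :=
  if Nat.ltb x s then q s - q x else 0.

Fixpoint scode (s : list bool) : nat :=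
  match s with
  | [] => 0%nat
  | b :: l => (2 * scode l + (if b then 2 else 1))%nat
  end.

Definition is_prefix (s : list bool) (Y : nat -> bool) : Prop :=
  forall i, (i < length s)%nat -> nth i s false = Y i.

Fixpoint prefb (s t : list bool) : bool :=
  match s, t with
  | [], _ => true
  | a :: s', b :: t' => Bool.eqb a b && prefb s' t'
  | _, _ => false
  end.

Fixpoint all_strings (n : nat) : list (list bool) :=
  match n with
  | O => [[]]
  | S n' => flat_map (fun s => [false :: s; true :: s]) (all_strings n')
  end.

(* measure of the union of the cylinders [sigma], sigma in l *)
Definition lmeasure (l : list (list bool)) : R :=
  let L := fold_right (fun s m => Nat.max (length s) m) 0%nat l in
  INR (length (filter (fun t => existsb (fun s => prefb s t) l) (all_strings L))) / 2 ^ L.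

(* A code e describes the uniformly c.e. sequence of open sets
   V_n = union of [sigma] with <n, sigma> in W_e *)
Definition in_open (e : code) (n : nat) (Y : nat -> bool) : Prop :=
  exists s, halts0 e (cpair n (scode s)) /\ is_prefix s Y.

Definition measure_le (e : code) (n : nat) (r : R) : Prop :=
  forall l : list (list bool),
    (forall s, In s l -> halts0 e (cpair n (scode s))) -> lmeasure l <= r.

Definition captures (e : code) (Y : nat -> bool) : Prop := forall n, in_open e n Y.

Definition ML_test (e : code) : Prop := forall n, measure_le e n (/ 2 ^ n).

Definition ML_random (Y : nat -> bool) : Prop := forall e, ML_test e -> ~ captures e Y.

Definition bounded_test (c : nat -> nat -> R) (e : code) : Prop :=
  (forall n Y, in_open e (S n) Y -> in_open e n Y) /\
  exists C : R, forall n l, climit c n l -> measure_le e n (C * l).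

Definition turing_le (A Y : nat -> bool) : Prop :=
  exists e, forall x, eval Y e x (if A x then 1%nat else 0%nat).

Definition ce_set (A : nat -> bool) : Prop :=
  exists e, forall x, A x = true <-> halts0 e x.

(* K-trivial, via the characterization given in the context: obeys c_Omega *)
Definition K_trivial (q : nat -> R) (A : nat -> bool) : Prop := obeys A (cOmega q).

Definition smart (q : nat -> R) (c : nat -> nat -> R) (A : nat -> bool) : Prop :=
  K_trivial q A /\ obeys A c /\
  forall Y, ML_random Y ->
    ((exists e, bounded_test c e /\ captures e Y) <-> turing_le A Y).

Definition binary_value (Z : nat -> bool) (r : R) : Prop :=
  infinite_sum (fun i => if Z i then / 2 ^ (S i) else 0) r.

(* Main.v *)
Require Import Defs.
From Stdlib Require Import Reals List Arith Bool Lia Lra Psatz Classical ClassicalEpsilon.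
Import ListNotations.

(** For a program [j] and a level [k] keep a follower [x >= k] outside [A].  Let [E_j] be the set
    of oracles for which program [j] answers 0 on some element of [A].  Whenever the oracles
    outside [E_j] for which program [j] answers 0 on [x] have measure above [2^j c(k, s)], put [x]
    into [A]: these oracles move to [E_j], so the cost of the change is at most [2^-j] times the
    growth of the measure of [E_j], and the total cost is at most 2.  The oracles from which
    program [j] computes [A] lie in a test whose level [k] is contained in [E_j], minus the part of
    [E_j] present at stage [k], up to measure [2^j c(k)].  By Kucera and Slaman the measure of that
    difference is [O(Omega - Omega_k)], which is [O(c(k))] because [c] implies [c_Omega].

    For the last step, suppose [d(k) = Omega - Omega_k] is not [O(c(k))].  A set obeying [c] but not
    [c_Omega] is built by flipping bits: each approximation has to follow every flip at [p], paying
    about [d(p)], while the flip costs [c(p)].  Requirement [e] only uses positions [cpair e i].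
    Since [Omega] converges slowly, [d(i) <= D d(cpair e i)] for some [D], so such positions with
    [d(p) > 4^e c(p)] exist and the requirements do not interact.

    Conversely, let a random [Y] be captured by a [c]-bounded test.  Taking the [x]-th component of
    the test whenever [x] enters [A] gives a Solovay test; it catches [Y] only finitely often, so
    once [Y] is seen in the [x]-th component at a late stage, [x] can no longer enter [A]. *)

(** * Computable functions *)

Open Scope nat_scope.

(** Inside the constructions every measure is a count of strings of one length and every real a
    numerator over a power of two, so the stages are total computable functions of numbers; the
    rounding at stage [s] is at most a constant times [2^-s] and vanishes in the limit. The
    Kucera-Slaman bound serves for three sequences: the measures of the sets [E_j], the
    approximation of [Omega] itself compared with a subsequence of it, and [1 - 2^-s]. The last
    gives [Omega_x < Omega], so the limit cost of every [x] is positive, which bounds how often a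
    follower is replaced. The implication between the cost functions speaks only about sets that
    obey them, which is why the inequality between the limits needs a set of its own. That set flips
    bits instead of enumerating numbers because a requirement may know a single useful position and
    has to charge its opponent there many times. Of the factor [4^e], one [2^e] absorbs the amount
    [m <= e <= 2^e] that requirement [e] wants to charge; the other makes the sum over all
    requirements converge. *)

Lemma unpair_tri n k : k <= n -> unpair (n * (n + 1) / 2 + k) = (n - k, k).
Proof.
  assert (T : forall m, S m * (S m + 1) / 2 = m * (m + 1) / 2 + S m).
  { intro m. replace (S m * (S m + 1)) with (m * (m + 1) + S m * 2) by lia.
    now rewrite Nat.div_add by lia. }
  revert k; induction n as [|n IH]; intros k Hk.
  - now replace k with 0 by lia.
  - induction k as [|k IHk].
    + rewrite T. replace (n * (n + 1) / 2 + S n + 0) with (S (n * (n + 1) / 2 + n)) by lia.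
      cbn [unpair]. rewrite IH, Nat.sub_diag by lia. reflexivity.
    + rewrite <- plus_n_Sm. cbn [unpair]. rewrite IHk by lia.
      replace (S n - k) with (S (S n - S k)) by lia. reflexivity.
Qed.

Lemma unpair_cpair a b : unpair (cpair a b) = (a, b).
Proof.
  unfold cpair. rewrite (unpair_tri (a + b) b) by lia. f_equal; lia.
Qed.

Lemma cpair_unpair n : cpair (fst (unpair n)) (snd (unpair n)) = n.
Proof.
  assert (T : forall m, S m * (S m + 1) / 2 = m * (m + 1) / 2 + S m).
  { intro m. replace (S m * (S m + 1)) with (m * (m + 1) + S m * 2) by lia.
    now rewrite Nat.div_add by lia. }
  induction n as [|n IH]; [reflexivity|].
  cbn [unpair]. destruct (unpair n) as [[|x] y]; cbn [fst snd] in *; unfold cpair in *.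
  - rewrite !Nat.add_0_r, T. cbn [Nat.add] in IH. lia.
  - replace (x + S y) with (S x + y) by lia. lia.
Qed.

Lemma cpair_le_add a b : a + b <= cpair a b.
Proof.
  unfold cpair.
  assert (a + b <= (a + b) * (a + b + 1) / 2); [|lia].
  apply Nat.div_le_lower_bound; nia.
Qed.

Lemma cpair_inj a b a' b' : cpair a b = cpair a' b' -> a = a' /\ b = b'.
Proof.
  intro H. apply (f_equal unpair) in H. rewrite !unpair_cpair in H. now inversion H.
Qed.

Lemma cpair_lt_r a b b' : b < b' -> cpair a b < cpair a b'.
Proof.
  intro H. unfold cpair.
  assert ((a + b) * (a + b + 1) / 2 <= (a + b') * (a + b' + 1) / 2); [|lia].
  apply Nat.Div0.div_le_mono; nia.
Qed.

(** Induction hypotheses are also needed for the evaluations under the existential quantifier in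
    [eMu]; the nested fixpoint supplies them. *)
Definition eval_nested_ind (O : nat -> bool) (P : code -> nat -> nat -> Prop)
  (HZ : forall x, P cZero x 0) (HS : forall x, P cSucc x (S x)) (HI : forall x, P cId x x)
  (HF : forall x, P cFst x (fst (unpair x))) (HN : forall x, P cSnd x (snd (unpair x)))
  (HO : forall x, P cOracle x (if O x then 1 else 0))
  (HP : forall f g x a b, P f x a -> P g x b -> P (cPair f g) x (cpair a b))
  (HC : forall f g x y z, P g x y -> P f y z -> P (cComp f g) x z)
  (HR0 : forall f g x y, P f x y -> P (cRec f g) (cpair x 0) y)
  (HRS : forall f g x n z y, P (cRec f g) (cpair x n) z -> P g (cpair x (cpair n z)) y ->
     P (cRec f g) (cpair x (S n)) y)
  (HM : forall f x n, P f (cpair x n) 0 ->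
     (forall m, m < n -> exists k, P f (cpair x m) (S k)) -> P (cMu f) x n) :
  forall e x y, eval O e x y -> P e x y.
Proof.
  fix IH 4. intros e x y H.
  destruct H as [x|x|x|x|x|x|f g x a b H1 H2|f g x y z H1 H2|f g x y H1|f g x n z y H1 H2|f x n H1 H2].
  - apply HZ.
  - apply HS.
  - apply HI.
  - apply HF.
  - apply HN.
  - apply HO.
  - exact (HP _ _ _ _ _ (IH _ _ _ H1) (IH _ _ _ H2)).
  - exact (HC _ _ _ _ _ (IH _ _ _ H1) (IH _ _ _ H2)).
  - exact (HR0 _ _ _ _ (IH _ _ _ H1)).
  - exact (HRS _ _ _ _ _ _ (IH _ _ _ H1) (IH _ _ _ H2)).
  - apply HM; [exact (IH _ _ _ H1)|].
    intros m Hm. destruct (H2 m Hm) as [k Hk]. exists k. exact (IH _ _ _ Hk).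
Qed.

Lemma eval_fun O e x y : eval O e x y -> forall y', eval O e x y' -> y = y'.
Proof.
  revert e x y.
  apply (eval_nested_ind O (fun e x y => forall y', eval O e x y' -> y = y'));
    try (intros; match goal with H : eval _ _ _ _ |- _ => inversion H; subst; reflexivity end).
  - intros f g x a b IHf IHg y' H. inversion H; subst. f_equal; auto.
  - intros f g x y z IHg IHf y' H. inversion H; subst. apply IHf.
    now rewrite (IHg _ H2).
  - intros f g x y IHf y' H. inversion H; subst;
      match goal with E : cpair _ _ = cpair _ _ |- _ => apply cpair_inj in E as [-> E] end.
    + auto.
    + discriminate.
  - intros f g x n z y IHr IHg y' H. inversion H; subst;
      match goal with E : cpair _ _ = cpair _ _ |- _ => apply cpair_inj in E as [-> E] end.
    + discriminate.
    + match goal with E : S _ = S _ |- _ => injection E as -> end. apply IHg.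
      match goal with E : eval _ (cRec _ _) _ _ |- _ => now rewrite (IHr _ E) end.
  - intros f x n IH0 IHS y' H. inversion H; subst.
    match goal with
    | E0 : eval _ f (cpair x y') 0, ES : forall m, m < y' -> _ |- _ =>
      (* If the two minima differed, the program would return both 0 and a successor at the smaller
         one. *)
      destruct (lt_eq_lt_dec n y') as [[L | ->] | L]; [| reflexivity |];
      [destruct (ES n L) as [k Hk]; now apply IH0 in Hk
      |destruct (IHS y' L) as [k Hk]; now apply Hk in E0]
    end.
Qed.

Lemma eval_fst O a b : eval O cFst (cpair a b) a.
Proof. rewrite <- (f_equal fst (unpair_cpair a b) : _ = a) at 2. constructor. Qed.

Lemma eval_snd O a b : eval O cSnd (cpair a b) b.
Proof. rewrite <- (f_equal snd (unpair_cpair a b) : _ = b) at 2. constructor. Qed.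

(** * Computability on encoded data types *)

Class Enc (A : Type) := { enc : A -> nat; dflt : A }.

#[export] Instance Enc_nat : Enc nat := {| enc := fun n : nat => n; dflt := 0 |}.
#[export] Instance Enc_bool : Enc bool :=
  {| enc := fun b : bool => if b then 1 else 0; dflt := false |}.
#[export] Instance Enc_prod {A B} `{Enc A} `{Enc B} : Enc (A * B) :=
  {| enc := fun p : A * B => cpair (enc (fst p)) (enc (snd p)); dflt := (dflt, dflt) |}.

Fixpoint enc_list {A} `{Enc A} (l : list A) : nat :=
  match l with [] => 0 | a :: l' => S (cpair (enc a) (enc_list l')) end.

#[export] Instance Enc_list {A} `{Enc A} : Enc (list A) :=
  {| enc := enc_list; dflt := [] |}.

(* [Q] is the class of oracles for which one code has to work: all oracles for a plain
   computable function, [eq Y] for a function computable in [Y]. *)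
Definition Comp (Q : (nat -> bool) -> Prop) {A B} `{Enc A} `{Enc B} (f : A -> B) : Prop :=
  exists e, forall O, Q O -> forall a, eval O e (enc a) (enc (f a)).

Lemma comp_id {Q A} `{Enc A} : Comp Q (fun x : A => x).
Proof. exists cId. intros. constructor. Qed.

Fixpoint const_code (n : nat) : code :=
  match n with 0 => cZero | S m => cComp cSucc (const_code m) end.

Lemma comp_const {Q A B} `{Enc A} `{Enc B} (b : B) : Comp Q (fun _ : A => b).
Proof.
  exists (const_code (enc b)). intros O _ a. generalize (enc b). intro n.
  induction n; cbn; econstructor; eauto using eval.
Qed.

Lemma comp_pair {Q A B C} `{Enc A} `{Enc B} `{Enc C} (f : A -> B) (g : A -> C) :
  Comp Q f -> Comp Q g -> Comp Q (fun x => (f x, g x)).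
Proof.
  intros [e He] [e' He']. exists (cPair e e'). intros O HO a. cbn. constructor; auto.
Qed.

Lemma comp_comp {Q A B C} `{Enc A} `{Enc B} `{Enc C} (g : B -> C) (f : A -> B) :
  Comp Q g -> Comp Q f -> Comp Q (fun x => g (f x)).
Proof.
  intros [e He] [e' He']. exists (cComp e e'). intros O HO a. econstructor; eauto.
Qed.

Lemma comp_comp2 {Q A B C D} `{Enc A} `{Enc B} `{Enc C} `{Enc D} (g : B -> C -> D)
  (f : A -> B) (h : A -> C) :
  Comp Q (fun p : B * C => g (fst p) (snd p)) -> Comp Q f -> Comp Q h ->
  Comp Q (fun x => g (f x) (h x)).
Proof.
  intros Hg Hf Hh. exact (comp_comp _ _ Hg (comp_pair _ _ Hf Hh)).
Qed.

Lemma comp_comp3 {Q A B C D E} `{Enc A} `{Enc B} `{Enc C} `{Enc D} `{Enc E}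
  (g : B -> C -> D -> E) (f : A -> B) (h : A -> C) (k : A -> D) :
  Comp Q (fun p : B * C * D => g (fst (fst p)) (snd (fst p)) (snd p)) ->
  Comp Q f -> Comp Q h -> Comp Q k -> Comp Q (fun x => g (f x) (h x) (k x)).
Proof.
  intros Hg Hf Hh Hk. exact (comp_comp _ _ Hg (comp_pair _ _ (comp_pair _ _ Hf Hh) Hk)).
Qed.

Lemma comp_fst {Q A B C} `{Enc A} `{Enc B} `{Enc C} (f : A -> B * C) :
  Comp Q f -> Comp Q (fun x => fst (f x)).
Proof.
  intros [e He]. exists (cComp cFst e). intros O HO a. econstructor; [auto|].
  apply eval_fst.
Qed.

Lemma comp_snd {Q A B C} `{Enc A} `{Enc B} `{Enc C} (f : A -> B * C) :
  Comp Q f -> Comp Q (fun x => snd (f x)).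
Proof.
  intros [e He]. exists (cComp cSnd e). intros O HO a. econstructor; [auto|].
  apply eval_snd.
Qed.

Lemma comp_ext {Q A B} `{Enc A} `{Enc B} (f g : A -> B) :
  (forall x, f x = g x) -> Comp Q f -> Comp Q g.
Proof.
  intros E [e He]. exists e. intros. rewrite <- E. auto.
Qed.

(** Only codes enter [Comp], so a value may be exchanged for one of another type with the same code:
    a pair for its Cantor number, a list for its numeral. *)
Lemma comp_enc {Q A B C} `{Enc A} `{Enc B} `{Enc C} (f : A -> B) (g : A -> C) :
  (forall x, enc (f x) = enc (g x)) -> Comp Q f -> Comp Q g.
Proof.
  intros E [e He]. exists e. intros. rewrite <- E. auto.
Qed.

Lemma comp_S {Q A} `{Enc A} (f : A -> nat) : Comp Q f -> Comp Q (fun x => S (f x)).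
Proof. apply (comp_comp S). exists cSucc. intros. constructor. Qed.

Lemma comp_cpair {Q A} `{Enc A} (f g : A -> nat) :
  Comp Q f -> Comp Q g -> Comp Q (fun x => cpair (f x) (g x)).
Proof.
  intros Hf Hg. apply (comp_enc (fun x => (f x, g x))); [reflexivity|].
  now apply comp_pair.
Qed.

Lemma comp_unpair {Q A} `{Enc A} (f : A -> nat) :
  Comp Q f -> Comp Q (fun x => unpair (f x)).
Proof. apply comp_enc. intro x. cbn. symmetry. apply cpair_unpair. Qed.

Lemma comp_rec {Q A B} `{Enc A} `{Enc B} (n : A -> nat) (b : A -> B) (g : A -> nat -> B -> B) :
  Comp Q n -> Comp Q b ->
  Comp Q (fun p : A * nat * B => g (fst (fst p)) (snd (fst p)) (snd p)) ->
  Comp Q (fun x => nat_rect (fun _ => B) (b x) (g x) (n x)).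
Proof.
  intros [en Hn] [eb Hb] [eg Hg].
  (* [cRec] hands its step the triple as [(a, (k, r))], while [eg] expects [((a, k), r)]; the
     projections reassociate it. The outer [cPair cId en] keeps [a] as the parameter of the
     recursion. *)
  exists (cComp (cRec eb (cComp eg
    (cPair (cPair cFst (cComp cFst cSnd)) (cComp cSnd cSnd)))) (cPair cId en)).
  intros O HO a. econstructor; [constructor; [constructor | auto]|].
  change (enc (n a)) with (n a). generalize (n a). intro k.
  induction k as [|k IH]; [constructor; auto|].
  econstructor; [exact IH|].
  cbn [nat_rect]. remember (nat_rect _ _ _ k) as r.
  econstructor; [|exact (Hg O HO (a, k, r))]. cbn.
  constructor; [constructor; [apply eval_fst|]|];
    (econstructor; [apply eval_snd|]); [apply eval_fst | apply eval_snd].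
Qed.

Lemma comp_if {Q A B} `{Enc A} `{Enc B} (t : A -> bool) (f g : A -> B) :
  Comp Q t -> Comp Q f -> Comp Q g -> Comp Q (fun x => if t x then f x else g x).
Proof.
  intros Ht Hf Hg.
  apply (comp_ext (fun x => nat_rect (fun _ => B) (g x) (fun _ _ => f x) (enc (t x)))).
  - intro x. now destruct (t x).
  - apply comp_rec; [|assumption|].
    + revert Ht. now apply comp_enc.
    + apply (comp_comp f); [assumption|]. apply comp_fst, comp_fst, comp_id.
Qed.

Create HintDb comp.
#[export] Hint Resolve comp_id comp_const comp_pair comp_S comp_cpair
  comp_unpair comp_rec comp_if : comp.
#[export] Hint Extern 2 (Comp _ fst) => exact (comp_fst _ comp_id) : comp.
#[export] Hint Extern 2 (Comp _ snd) => exact (comp_snd _ comp_id) : comp.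
#[export] Hint Extern 2 (Comp _ (fun _ => fst _)) => apply comp_fst : comp.
#[export] Hint Extern 2 (Comp _ (fun _ => snd _)) => apply comp_snd : comp.

#[export] Hint Extern 4 (Comp ?Q _) =>
  match goal with
  | H : Comp Q (fun x => ?g x) |- Comp Q (fun x => ?g _) => apply (comp_comp g _ H)
  | H : Comp Q ?g |- Comp Q (fun x => ?g _) => apply (comp_comp g _ H)
  end : comp.

Ltac comp := solve [intros; auto 100 with comp nocore].

Lemma comp_iter {Q A B} `{Enc A} `{Enc B} (n : A -> nat) (b : A -> B) (g : A -> B -> B) :
  Comp Q n -> Comp Q b -> Comp Q (fun p : A * B => g (fst p) (snd p)) ->
  Comp Q (fun x => Nat.iter (n x) (g x) (b x)).
Proof.
  intros Hn Hb Hg. unfold Nat.iter.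
  apply (comp_rec n b (fun x _ => g x)); auto.
  apply (comp_comp2 g); comp.
Qed.

Lemma comp_pred {Q A} `{Enc A} (f : A -> nat) : Comp Q f -> Comp Q (fun x => pred (f x)).
Proof.
  intro Hf. apply (comp_ext (fun x => nat_rect (fun _ => nat) 0 (fun k _ => k) (f x))).
  - intro x. now destruct (f x).
  - comp.
Qed.
#[export] Hint Resolve comp_iter comp_pred : comp.

Lemma comp_add {Q A} `{Enc A} (f g : A -> nat) :
  Comp Q f -> Comp Q g -> Comp Q (fun x => f x + g x).
Proof.
  intros Hf Hg. apply (comp_ext (fun x => Nat.iter (f x) S (g x))).
  - intro x. induction (f x) as [|k IH]; [reflexivity|]. now rewrite Nat.iter_succ, IH.
  - comp.
Qed.
#[export] Hint Resolve comp_add : comp.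

Lemma comp_sub {Q A} `{Enc A} (f g : A -> nat) :
  Comp Q f -> Comp Q g -> Comp Q (fun x => f x - g x).
Proof.
  intros Hf Hg. apply (comp_ext (fun x => Nat.iter (g x) pred (f x))).
  - intro x. induction (g x) as [|k IH]; [cbn; lia|]. rewrite Nat.iter_succ, IH. lia.
  - comp.
Qed.

Lemma comp_mul {Q A} `{Enc A} (f g : A -> nat) :
  Comp Q f -> Comp Q g -> Comp Q (fun x => f x * g x).
Proof.
  intros Hf Hg. apply (comp_ext (fun x => Nat.iter (f x) (fun r => g x + r) 0)).
  - intro x. induction (f x) as [|k IH]; [reflexivity|]. now rewrite Nat.iter_succ, IH.
  - comp.
Qed.
#[export] Hint Resolve comp_sub comp_mul : comp.

Lemma comp_leb {Q A} `{Enc A} (f g : A -> nat) :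
  Comp Q f -> Comp Q g -> Comp Q (fun x => f x <=? g x).
Proof.
  intros Hf Hg.
  apply (comp_ext (fun x => nat_rect (fun _ => bool) true (fun _ _ => false) (f x - g x))); [|comp].
  intro x. destruct (f x - g x) as [|k] eqn:E; cbn; symmetry;
    [apply Nat.leb_le | apply Nat.leb_gt]; lia.
Qed.
#[export] Hint Resolve comp_leb : comp.

Lemma comp_ltb {Q A} `{Enc A} (f g : A -> nat) :
  Comp Q f -> Comp Q g -> Comp Q (fun x => f x <? g x).
Proof. intros Hf Hg. unfold Nat.ltb. comp. Qed.

Lemma comp_andb {Q A} `{Enc A} (f g : A -> bool) :
  Comp Q f -> Comp Q g -> Comp Q (fun x => f x && g x).
Proof. intros Hf Hg. unfold andb. comp. Qed.

Lemma comp_orb {Q A} `{Enc A} (f g : A -> bool) :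
  Comp Q f -> Comp Q g -> Comp Q (fun x => f x || g x).
Proof. intros Hf Hg. unfold orb. comp. Qed.

Lemma comp_negb {Q A} `{Enc A} (f : A -> bool) : Comp Q f -> Comp Q (fun x => negb (f x)).
Proof. intros Hf. unfold negb. comp. Qed.

Lemma comp_xorb {Q A} `{Enc A} (f g : A -> bool) :
  Comp Q f -> Comp Q g -> Comp Q (fun x => xorb (f x) (g x)).
Proof.
  intros Hf Hg. apply (comp_ext (fun x => if f x then (if g x then false else true) else g x)).
  - intro x. now destruct (f x), (g x).
  - comp.
Qed.
#[export] Hint Resolve comp_ltb comp_andb comp_orb comp_negb comp_xorb : comp.

Lemma comp_eqb {Q A} `{Enc A} (f g : A -> nat) :
  Comp Q f -> Comp Q g -> Comp Q (fun x => f x =? g x).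
Proof.
  intros Hf Hg. apply (comp_ext (fun x => (f x <=? g x) && (g x <=? f x))); [|comp].
  intro x. apply eq_true_iff_eq. rewrite andb_true_iff, !Nat.leb_le, Nat.eqb_eq. lia.
Qed.

Lemma comp_pow {Q A} `{Enc A} (f g : A -> nat) :
  Comp Q f -> Comp Q g -> Comp Q (fun x => f x ^ g x).
Proof.
  intros Hf Hg. apply (comp_ext (fun x => Nat.iter (g x) (fun r => f x * r) 1)); [|comp].
  intro x. induction (g x) as [|k IH]; [reflexivity|]. rewrite Nat.iter_succ, IH. reflexivity.
Qed.

Lemma comp_max {Q A} `{Enc A} (f g : A -> nat) :
  Comp Q f -> Comp Q g -> Comp Q (fun x => Nat.max (f x) (g x)).
Proof.
  intros Hf Hg. apply (comp_ext (fun x => f x + (g x - f x))); [|comp].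
  intro x. lia.
Qed.
#[export] Hint Resolve comp_eqb comp_pow comp_max : comp.

(** Division by bounded search: after [k] rounds the counter is the minimum of [k] and the quotient,
    and [f x] rounds reach the quotient. *)
Lemma comp_div_S {Q A} `{Enc A} (f g : A -> nat) :
  Comp Q f -> Comp Q g -> Comp Q (fun x => f x / S (g x)).
Proof.
  intros Hf Hg.
  apply (comp_ext (fun x => Nat.iter (f x)
    (fun r => if (S r) * S (g x) <=? f x then S r else r) 0)); [|comp].
  intro x. generalize (g x) as d. generalize (f x) as n. intros n d.
  assert (L : forall k, Nat.iter k (fun r => if (S r) * S d <=? n then S r else r) 0
    = Nat.min k (n / S d)).
  { pose proof (Nat.div_mod_eq n (S d)). pose proof (Nat.mod_upper_bound n (S d)).
    set (q := n / S d) in *. set (r := n mod S d) in *.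
    induction k as [|k IH]; [reflexivity|].
    rewrite Nat.iter_succ, IH.
    destruct (Nat.leb_spec (S (Nat.min k q) * S d) n); nia. }
  rewrite L. apply Nat.min_r. apply Nat.Div0.div_le_upper_bound. nia.
Qed.

(** * Computable operations on lists and strings *)

Lemma comp_cons {Q A B} `{Enc A} `{Enc B} (f : A -> B) (l : A -> list B) :
  Comp Q f -> Comp Q l -> Comp Q (fun x => f x :: l x).
Proof.
  intros Hf Hl. apply (comp_enc (fun x => S (enc (f x, l x)))); [reflexivity|].
  apply comp_S, (comp_enc (fun x => (f x, l x))); [reflexivity|]. comp.
Qed.

Lemma comp_isnil {Q A B} `{Enc A} `{Enc B} (l : A -> list B) :
  Comp Q l -> Comp Q (fun x => match l x with [] => true | _ :: _ => false end).
Proof.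
  intros Hl. apply (comp_ext (fun x => enc (l x) =? 0)).
  - intro x. now destruct (l x).
  - apply comp_eqb; [|comp]. revert Hl. now apply comp_enc.
Qed.
#[export] Hint Resolve comp_div_S comp_cons : comp.
#[export] Hint Extern 2 (Comp _ (fun _ => match _ with [] => true | _ :: _ => false end)) =>
  apply comp_isnil : comp.

Lemma comp_tl {Q A B} `{Enc A} `{Enc B} (l : A -> list B) :
  Comp Q l -> Comp Q (fun x => tl (l x)).
Proof.
  intros Hl. apply (comp_enc (fun x => snd (unpair (pred (enc (l x)))))).
  - intro x. destruct (l x) as [|b l']; [reflexivity|]. cbn [enc Enc_list enc_list pred].
    now rewrite unpair_cpair.
  - apply comp_snd, comp_unpair, comp_pred. revert Hl. now apply comp_enc.
Qed.

Lemma comp_hd {Q A B} `{Enc A} `{Enc B} (d : B) (l : A -> list B) :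
  Comp Q l -> Comp Q (fun x => hd d (l x)).
Proof.
  intros Hl. apply (comp_enc (fun x => if match l x with [] => true | _ :: _ => false end
    then enc d else fst (unpair (pred (enc (l x)))))).
  - intro x. destruct (l x) as [|b l']; [reflexivity|]. cbn [enc Enc_list enc_list pred].
    now rewrite unpair_cpair.
  - assert (Comp Q (fun x => enc (l x))) by (revert Hl; now apply comp_enc).
    comp.
Qed.
#[export] Hint Extern 2 (Comp _ (fun _ => tl _)) => apply comp_tl : comp.
#[export] Hint Extern 2 (Comp _ (fun _ => hd _ _)) => apply comp_hd : comp.

Lemma length_le_enc {A} `{Enc A} (l : list A) : length l <= enc l.
Proof.
  induction l as [|a l IH]; [reflexivity|]. cbn in *.
  pose proof (cpair_le_add (enc a) (enc_list l)). lia.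
Qed.

(** The code of a list bounds its length, so the fold is an iteration of that many rounds on the
    pair of remaining list and accumulator; once the list is empty the rounds change nothing. *)
Lemma comp_fold_left {Q A B C} `{Enc A} `{Enc B} `{Enc C} (g : A -> C -> B -> C)
  (l : A -> list B) (c : A -> C) :
  Comp Q (fun p : A * C * B => g (fst (fst p)) (snd (fst p)) (snd p)) ->
  Comp Q l -> Comp Q c -> Comp Q (fun x => fold_left (g x) (l x) (c x)).
Proof.
  intros Hg Hl Hc.
  apply (comp_ext (fun x => snd (Nat.iter (enc (l x)) (fun s : list B * C =>
    (tl (fst s), if match fst s with [] => true | _ :: _ => false end
     then snd s else g x (snd s) (hd dflt (fst s)))) (l x, c x)))).
  - intro x.
    assert (L : forall n l c, length l <= n ->
      Nat.iter n (fun s : list B * C =>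
        (tl (fst s), if match fst s with [] => true | _ :: _ => false end
         then snd s else g x (snd s) (hd dflt (fst s)))) (l, c) = ([], fold_left (g x) l c)).
    { clear. induction n as [|n IH]; intros l c Hn.
      - destruct l; [reflexivity | cbn in Hn; lia].
      - rewrite Nat.iter_succ_r. destruct l as [|b l]; cbn -[Nat.iter].
        + now rewrite IH by (cbn; lia).
        + rewrite IH; [reflexivity | cbn in Hn; lia]. }
    rewrite L; [reflexivity | apply length_le_enc].
  - assert (Comp Q (fun x => enc (l x))) by (revert Hl; now apply comp_enc).
    apply comp_snd, comp_iter; [assumption | comp |].
    apply comp_pair; [comp|]. apply comp_if; [comp | comp |].
    apply (comp_comp3 g); comp.
Qed.
#[export] Hint Extern 2 (Comp _ (fun _ => fold_left _ _ _)) => apply comp_fold_left : comp.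

Lemma comp_rev {Q A B} `{Enc A} `{Enc B} (l : A -> list B) :
  Comp Q l -> Comp Q (fun x => rev (l x)).
Proof.
  intros Hl. apply (comp_ext (fun x => fold_left (fun r b => b :: r) (l x) [])); [|comp].
  intro x. rewrite <- (fold_left_rev_right (fun b r => b :: r)).
  induction (rev (l x)); cbn; congruence.
Qed.
#[export] Hint Extern 2 (Comp _ (fun _ => rev _)) => apply comp_rev : comp.

Lemma comp_fold_right {Q A B C} `{Enc A} `{Enc B} `{Enc C} (g : A -> B -> C -> C)
  (l : A -> list B) (c : A -> C) :
  Comp Q (fun p : A * B * C => g (fst (fst p)) (snd (fst p)) (snd p)) ->
  Comp Q l -> Comp Q c -> Comp Q (fun x => fold_right (g x) (c x) (l x)).
Proof.
  intros Hg Hl Hc.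
  apply (comp_ext (fun x => fold_left (fun r b => g x b r) (rev (l x)) (c x))).
  - intro x. rewrite <- (fold_left_rev_right (g x)), rev_involutive. reflexivity.
  - apply comp_fold_left; [|comp|comp]. apply (comp_comp3 g); comp.
Qed.
#[export] Hint Extern 2 (Comp _ (fun _ => fold_right _ _ _)) => apply comp_fold_right : comp.

Section ListCombinators.
Context {Q : (nat -> bool) -> Prop} {A B C : Type} `{Enc A} `{Enc B} `{Enc C}.

Lemma comp_length (l : A -> list B) : Comp Q l -> Comp Q (fun x => length (l x)).
Proof.
  intros Hl. apply (comp_ext (fun x => fold_right (fun _ r => S r) 0 (l x))); [|comp].
  intro x. induction (l x); cbn; congruence.
Qed.

Lemma comp_app (l m : A -> list B) : Comp Q l -> Comp Q m -> Comp Q (fun x => l x ++ m x).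
Proof.
  intros Hl Hm. apply (comp_ext (fun x => fold_right (fun b r => b :: r) (m x) (l x))); [|comp].
  intro x. induction (l x); cbn; congruence.
Qed.

Lemma comp_map (g : A -> B -> C) (l : A -> list B) :
  Comp Q (fun p : A * B => g (fst p) (snd p)) -> Comp Q l ->
  Comp Q (fun x => map (g x) (l x)).
Proof.
  intros Hg Hl. apply (comp_ext (fun x => fold_right (fun b r => g x b :: r) [] (l x))).
  - intro x. induction (l x); cbn; congruence.
  - apply comp_fold_right; [|comp|comp]. apply comp_cons; [|comp]. apply (comp_comp2 g); comp.
Qed.

Lemma comp_filter (g : A -> B -> bool) (l : A -> list B) :
  Comp Q (fun p : A * B => g (fst p) (snd p)) -> Comp Q l ->
  Comp Q (fun x => filter (g x) (l x)).
Proof.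
  intros Hg Hl.
  apply (comp_ext (fun x => fold_right (fun b r => if g x b then b :: r else r) [] (l x))).
  - intro x. induction (l x) as [|b l' IH]; cbn; [|rewrite IH]; reflexivity.
  - apply comp_fold_right; [|comp|comp]. apply comp_if; [|comp|comp]. apply (comp_comp2 g); comp.
Qed.

Lemma comp_existsb (g : A -> B -> bool) (l : A -> list B) :
  Comp Q (fun p : A * B => g (fst p) (snd p)) -> Comp Q l ->
  Comp Q (fun x => existsb (g x) (l x)).
Proof.
  intros Hg Hl. apply (comp_ext (fun x => fold_right (fun b r => g x b || r) false (l x))).
  - intro x. induction (l x); cbn; congruence.
  - apply comp_fold_right; [|comp|comp]. apply comp_orb; [|comp]. apply (comp_comp2 g); comp.
Qed.

Lemma comp_forallb (g : A -> B -> bool) (l : A -> list B) :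
  Comp Q (fun p : A * B => g (fst p) (snd p)) -> Comp Q l ->
  Comp Q (fun x => forallb (g x) (l x)).
Proof.
  intros Hg Hl. apply (comp_ext (fun x => fold_right (fun b r => g x b && r) true (l x))).
  - intro x. induction (l x); cbn; congruence.
  - apply comp_fold_right; [|comp|comp]. apply comp_andb; [|comp]. apply (comp_comp2 g); comp.
Qed.

Lemma comp_seq (n m : A -> nat) : Comp Q n -> Comp Q m -> Comp Q (fun x => seq (n x) (m x)).
Proof.
  intros Hn Hm. apply (comp_ext (fun x => nat_rect (fun _ => list nat) []
    (fun k r => (n x + (m x - S k)) :: r) (m x))).
  - intro x. assert (L : forall k, k <= m x -> nat_rect (fun _ => list nat) []
      (fun k r => (n x + (m x - S k)) :: r) k = seq (n x + (m x - k)) k).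
    { induction k as [|k IH]; [reflexivity|]. intro Hk. cbn. rewrite IH by lia.
      f_equal. f_equal. lia. }
    rewrite L by lia. f_equal. lia.
  - comp.
Qed.
End ListCombinators.
#[export] Hint Resolve comp_app comp_filter comp_seq : comp.
#[export] Hint Extern 2 (Comp _ (fun _ => length _)) => apply comp_length : comp.
#[export] Hint Extern 2 (Comp _ (fun _ => map _ _)) => apply comp_map : comp.
#[export] Hint Extern 2 (Comp _ (fun _ => existsb _ _)) => apply comp_existsb : comp.
#[export] Hint Extern 2 (Comp _ (fun _ => forallb _ _)) => apply comp_forallb : comp.

Section Strings.
Context {Q : (nat -> bool) -> Prop} {A : Type} `{Enc A}.

Lemma comp_skipn {B} `{Enc B} (n : A -> nat) (l : A -> list B) :
  Comp Q n -> Comp Q l -> Comp Q (fun x => skipn (n x) (l x)).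
Proof.
  intros Hn Hl. apply (comp_ext (fun x => Nat.iter (n x) (@tl B) (l x))).
  - intro x. generalize (l x). induction (n x) as [|k IH]; intro l'; [reflexivity|].
    rewrite Nat.iter_succ_r, IH. destruct l'; [apply skipn_nil | reflexivity].
  - comp.
Qed.

Lemma comp_nth {B} `{Enc B} (n : A -> nat) (l : A -> list B) (d : B) :
  Comp Q n -> Comp Q l -> Comp Q (fun x => nth (n x) (l x) d).
Proof.
  intros Hn Hl. apply (comp_ext (fun x => hd d (skipn (n x) (l x)))).
  - intro x. generalize (l x). induction (n x); intros []; cbn; auto.
  - apply comp_hd, comp_skipn; assumption.
Qed.

Lemma comp_firstn {B} `{Enc B} (n : A -> nat) (l : A -> list B) :
  Comp Q n -> Comp Q l -> Comp Q (fun x => firstn (n x) (l x)).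
Proof.
  intros Hn Hl.
  apply (comp_ext (fun x => rev (skipn (length (l x) - n x) (rev (l x))))).
  - intro x. rewrite skipn_rev, rev_involutive.
    destruct (le_dec (n x) (length (l x))).
    + f_equal. lia.
    + rewrite !firstn_all2 by lia. reflexivity.
  - apply comp_rev, comp_skipn; comp.
Qed.

Lemma comp_all_strings (n : A -> nat) : Comp Q n -> Comp Q (fun x => all_strings (n x)).
Proof.
  intro Hn. apply (comp_ext (fun x => Nat.iter (n x)
    (fun l => fold_right (fun s r => (false :: s) :: (true :: s) :: r) [] l) [[]])).
  - intro x. induction (n x) as [|k IH]; [reflexivity|].
    rewrite Nat.iter_succ, IH. cbn [all_strings]. generalize (all_strings k).
    intro l. clear. induction l as [|s l IH]; cbn in *; [|rewrite IH]; reflexivity.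
  - comp.
Qed.

Lemma comp_scode (l : A -> list bool) : Comp Q l -> Comp Q (fun x => scode (l x)).
Proof.
  intros Hl. apply (comp_ext (fun x =>
    fold_right (fun (b : bool) r => 2 * r + (if b then 2 else 1)) 0 (l x))); [|comp].
  intro x. induction (l x) as [|b l' IH]; [reflexivity|]. cbn [fold_right scode]. now rewrite IH.
Qed.
End Strings.
#[export] Hint Resolve comp_firstn comp_nth comp_all_strings : comp.
#[export] Hint Extern 2 (Comp _ (fun _ => scode _)) => apply comp_scode : comp.

(** * Search, c.e. sets and removal of the oracle *)

Lemma comp_mu {Q A} `{Enc A} (P : A * nat -> bool) (f : A -> nat) :
  Comp Q P -> (forall a, P (a, f a) = true /\ forall k, k < f a -> P (a, k) = false) ->
  Comp Q f.
Proof.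
  intros HP Hf.
  destruct (comp_if P (fun _ => 0) (fun _ => 1) HP (comp_const 0) (comp_const 1)) as [e He].
  exists (cMu e). intros O HO a. destruct (Hf a) as [H1 H2].
  apply (eMu O e (enc a) (f a)).
  - specialize (He O HO (a, f a)). now rewrite H1 in He.
  - intros m Hm. exists 0. specialize (He O HO (a, m)). now rewrite H2 in He.
Qed.

Lemma ce_of_comp (P : nat * nat -> bool) :
  Comp (fun _ => True) P ->
  exists e, forall x, halts0 e x <-> exists k, P (x, k) = true.
Proof.
  intro HP.
  destruct (comp_if P (fun _ => 0) (fun _ => 1) HP (comp_const 0) (comp_const 1)) as [e He].
  assert (He' : forall x k, eval0 e (cpair x k) (if P (x, k) then 0 else 1))
    by (intros x k; exact (He _ I (x, k))).
  exists (cMu e). intro x. split.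
  - intros [k Hk]. exists k. inversion Hk; subst.
    match goal with E : eval _ e _ 0 |- _ => pose proof (eval_fun _ _ _ _ (He' x k) _ E) end.
    now destruct (P (x, k)).
  - intros [k Hk].
    destruct (dec_inh_nat_subset_has_unique_least_element (fun k => P (x, k) = true))
      as [m [[Hm Hl] _]].
    + intro n. destruct (P (x, n)); auto.
    + eauto.
    + exists m. constructor.
      * specialize (He' x m). now rewrite Hm in He'.
      * intros i Hi. exists 0. specialize (He' x i).
        destruct (P (x, i)) eqn:E; [apply Hl in E; lia | assumption].
Qed.

(** The codes in the hypotheses are known to work with the empty oracle only; answering every query
    with 0 turns them into codes that work with any oracle. *)
Fixpoint deoracle (e : code) : code :=
  match e with
  | cOracle => cZero
  | cPair f g => cPair (deoracle f) (deoracle g)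
  | cComp f g => cComp (deoracle f) (deoracle g)
  | cRec f g => cRec (deoracle f) (deoracle g)
  | cMu f => cMu (deoracle f)
  | _ => e
  end.

Lemma eval_deoracle O e x y : eval0 e x y -> eval O (deoracle e) x y.
Proof.
  revert e x y. apply eval_nested_ind; intros; cbn [deoracle]; try (econstructor; eassumption).
Qed.

Lemma comp_of_total (e : code) :
  (forall x, exists y, eval0 e x y) ->
  exists f : nat -> nat, (forall Q, Comp Q f) /\ forall x, eval0 e x (f x).
Proof.
  intro H. exists (fun x => proj1_sig (constructive_indefinite_description _ (H x))).
  assert (E : forall x, eval0 e x (proj1_sig (constructive_indefinite_description _ (H x))))
    by (intro x; apply proj2_sig).
  split; [|exact E].
  intro Q. exists (deoracle e). intros O _ a. apply eval_deoracle, E.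
Qed.

(** * A universal oracle machine *)

Open Scope nat_scope.

(** Requirements are indexed by numbers, so programs must themselves be inputs of a computable
    function. The machine reads every tag above 8 as a search, hence each number runs as some
    program. *)
Fixpoint gcode (e : code) : nat :=
  match e with
  | cZero => cpair 0 0
  | cSucc => cpair 1 0
  | cId => cpair 2 0
  | cFst => cpair 3 0
  | cSnd => cpair 4 0
  | cOracle => cpair 5 0
  | cPair f g => cpair 6 (cpair (gcode f) (gcode g))
  | cComp f g => cpair 7 (cpair (gcode f) (gcode g))
  | cRec f g => cpair 8 (cpair (gcode f) (gcode g))
  | cMu f => cpair 9 (cpair (gcode f) 0)
  end.

(** A tag with two data. Tag 0: the second half of a pair is still to be run; 4: its first component
    is stored; 1: the outer program of a composition; 2: a recursion step; 3: a search at its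
    current candidate. *)
Definition frame : Type := nat * (nat * nat).
(* ((evaluating?, program), value), stack); the program is ignored when returning *)
Definition config : Type := bool * nat * nat * list frame.
Definition Run (e x : nat) (k : list frame) : config := (true, e, x, k).
Definition Ret (y : nat) (k : list frame) : config := (false, 0, y, k).

(* [s] is the known part of the oracle; a query beyond it blocks the machine. *)
Definition step_run (s : list bool) (e x : nat) (k : list frame) : config :=
  let tag := fst (unpair e) in
  let f := fst (unpair (snd (unpair e))) in
  let g := snd (unpair (snd (unpair e))) in
  if tag =? 0 then Ret 0 k
  else if tag =? 1 then Ret (S x) k
  else if tag =? 2 then Ret x k
  else if tag =? 3 then Ret (fst (unpair x)) k
  else if tag =? 4 then Ret (snd (unpair x)) k
  else if tag =? 5 then
    if x <? length s then Ret (if nth x s false then 1 else 0) k else Run e x k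
  else if tag =? 6 then Run f x ((0, (g, x)) :: k)
  else if tag =? 7 then Run g x ((1, (f, 0)) :: k)
  else if tag =? 8 then
    if snd (unpair x) =? 0 then Run f (fst (unpair x)) k
    else let x' := cpair (fst (unpair x)) (pred (snd (unpair x))) in
         Run e x' ((2, (g, x')) :: k)
  else Run f (cpair x 0) ((3, (f, cpair x 0)) :: k).

Definition step_ret (y : nat) (k : list frame) : config :=
  let tag := fst (hd dflt k) in
  let a := fst (snd (hd dflt k)) in
  let b := snd (snd (hd dflt k)) in
  if match k with [] => true | _ :: _ => false end then Ret y k
  else if tag =? 0 then Run a b ((4, (y, 0)) :: tl k)
  else if tag =? 1 then Run a y (tl k)
  else if tag =? 2 then
    Run a (cpair (fst (unpair b)) (cpair (snd (unpair b)) y)) (tl k)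
  else if tag =? 3 then
    if y =? 0 then Ret (snd (unpair b)) (tl k)
    else let b' := cpair (fst (unpair b)) (S (snd (unpair b))) in
         Run a b' ((3, (a, b')) :: tl k)
  else Ret (cpair a y) (tl k).

Definition step (s : list bool) (c : config) : config :=
  if fst (fst (fst c)) then step_run s (snd (fst (fst c))) (snd (fst c)) (snd c)
  else step_ret (snd (fst c)) (snd c).

(* Running program [e] on [x] for [|s|] steps with oracle [s]:
   [0] means no answer yet, [S y] means output [y]. *)
Definition run (s : list bool) (e x : nat) : nat :=
  let c := Nat.iter (length s) (step s) (Run e x []) in
  if negb (fst (fst (fst c))) && match snd c with [] => true | _ :: _ => false end
  then S (snd (fst c)) else 0.

Lemma comp_step {Q A} `{Enc A} (s : A -> list bool) (c : A -> config) :
  Comp Q s -> Comp Q c -> Comp Q (fun x => step (s x) (c x)).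
Proof.
  intros Hs Hc. unfold config in c, Hc.
  unfold step, step_run, step_ret, Run, Ret, config, frame. cbn zeta.
  repeat first [comp | apply comp_if | apply comp_pair | apply comp_cons].
Qed.

Lemma comp_run {Q A} `{Enc A} (s : A -> list bool) (e x : A -> nat) :
  Comp Q s -> Comp Q e -> Comp Q x -> Comp Q (fun a => run (s a) (e a) (x a)).
Proof.
  intros Hs He Hx. unfold run. cbn zeta.
  assert (Hi : Comp Q (fun a => Nat.iter (length (s a)) (step (s a)) (Run (e a) (x a) []))).
  { apply comp_iter; [comp | unfold Run, config; comp | apply comp_step; comp]. }
  unfold config in Hi. apply comp_if; [|comp|comp].
  apply comp_andb; [comp|]. apply comp_isnil. comp.
Qed.
#[export] Hint Resolve comp_run : comp.

Opaque cpair unpair.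

Ltac machine := unfold step, step_run, step_ret, Run, Ret, config, frame in *;
  cbn [fst snd hd tl gcode Nat.eqb dflt Enc_prod Enc_nat] in *; rewrite ?unpair_cpair in *;
  cbn [fst snd hd tl gcode Nat.eqb] in *; rewrite ?unpair_cpair in *;
  cbn [fst snd hd tl gcode Nat.eqb pred] in *.

Lemma iter_steps (A : Type) (f : A -> A) n m a b c :
  Nat.iter n f a = b -> Nat.iter m f b = c -> Nat.iter (n + m) f a = c.
Proof. intros <- <-. rewrite Nat.add_comm. apply Nat.iter_add. Qed.

Lemma iter_halted s y n : Nat.iter n (step s) (Ret y []) = Ret y [].
Proof. induction n as [|n IH]; [reflexivity|]. rewrite Nat.iter_succ, IH. reflexivity. Qed.

Definition reaches (N : nat) (s : list bool) (c c' : config) : Prop :=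
  exists m, m <= N /\ Nat.iter m (step s) c = c'.

Lemma reaches_trans N N' s c c' c'' :
  reaches N s c c' -> reaches N' s c' c'' -> reaches (N + N') s c c''.
Proof.
  intros [m [Hm E]] [m' [Hm' E']]. exists (m + m'). split; [lia|].
  eapply iter_steps; eauto.
Qed.

Lemma reaches_step s c : reaches 1 s c (step s c).
Proof. now exists 1. Qed.

(** One bound [N] serves for the steps and for the oracle bits read, because [run s] takes
    [length s] as its clock and [s] as the known part of the oracle. *)
Lemma eval_reaches Y e x y : eval Y e x y ->
  exists N, forall s k, N <= length s -> is_prefix s Y ->
    reaches N s (Run (gcode e) x k) (Ret y k).
Proof.
  revert e x y. apply eval_nested_ind.
  - intro x. exists 1. intros s k _ _. exists 1. split; [lia|]. cbn [Nat.iter nat_rect]. now machine.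
  - intro x. exists 1. intros s k _ _. exists 1. split; [lia|]. cbn [Nat.iter nat_rect]. now machine.
  - intro x. exists 1. intros s k _ _. exists 1. split; [lia|]. cbn [Nat.iter nat_rect]. now machine.
  - intro x. exists 1. intros s k _ _. exists 1. split; [lia|]. cbn [Nat.iter nat_rect]. now machine.
  - intro x. exists 1. intros s k _ _. exists 1. split; [lia|]. cbn [Nat.iter nat_rect]. now machine.
  - intro x. exists (S x). intros s k L P. exists 1. split; [lia|]. cbn [Nat.iter nat_rect]. machine.
    rewrite (proj2 (Nat.ltb_lt x (length s))) by lia. now rewrite P by lia.
  - intros f g x a b [Nf Hf] [Ng Hg]. exists (1 + (Nf + (1 + (Ng + 1)))). intros s k L P.
    eapply reaches_trans; [apply reaches_step|].
    eapply reaches_trans; [|eapply reaches_trans; [apply reaches_step|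
      eapply reaches_trans; [|exists 1; split; [lia | cbn [Nat.iter nat_rect]]]]].
    + machine. apply Hf; auto; lia.
    + machine. apply Hg; auto; lia.
    + now machine.
  - intros f g x y z [Ng Hg] [Nf Hf]. exists (1 + (Ng + (1 + Nf))). intros s k L P.
    eapply reaches_trans; [apply reaches_step|].
    eapply reaches_trans; [|eapply reaches_trans; [apply reaches_step|]].
    + machine. apply Hg; auto; lia.
    + machine. apply Hf; auto; lia.
  - intros f g x y [N H]. exists (1 + N). intros s k L P.
    eapply reaches_trans; [apply reaches_step|]. machine. apply H; auto; lia.
  - intros f g x n z y [Nr Hr] [Ng Hg]. exists (1 + (Nr + (1 + Ng))). intros s k L P.
    eapply reaches_trans; [apply reaches_step|].
    eapply reaches_trans; [|eapply reaches_trans; [apply reaches_step|]].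
    + specialize (Hr s ((2, (gcode g, cpair x n)) :: k)). machine. apply Hr; auto; lia.
    + machine. apply Hg; auto; lia.
  - intros f x n [N0 H0] HS.
    assert (loop : forall m, m <= n -> exists N, forall s k, N <= length s -> is_prefix s Y ->
      reaches N s (Run (gcode (cMu f)) x k)
        (Run (gcode f) (cpair x m) ((3, (gcode f, cpair x m)) :: k))).
    { induction m as [|m IH]; intro Hm.
      - exists 1. intros s k L P. exists 1. split; [lia|]. cbn [Nat.iter nat_rect]. now machine.
      - destruct IH as [N HN]; [lia|]. destruct (HS m Hm) as [v [Nv Hv]].
        exists (N + (Nv + 1)). intros s k L P.
        eapply reaches_trans; [apply HN; auto; lia|].
        eapply reaches_trans; [apply Hv; auto; lia|].
        exists 1. split; [lia|]. cbn [Nat.iter nat_rect]. now machine. }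
    destruct (loop n (le_n n)) as [N HN].
    exists (N + (N0 + 1)). intros s k L P.
    eapply reaches_trans; [apply HN; auto; lia|].
    eapply reaches_trans; [apply H0; auto; lia|].
    exists 1. split; [lia|]. cbn [Nat.iter nat_rect]. now machine.
Qed.

Lemma run_spec s e x y :
  run s e x = S y <-> exists c, Nat.iter (length s) (step s) (Run e x []) = c /\
    fst (fst (fst c)) = false /\ snd (fst c) = y /\ snd c = [].
Proof.
  unfold run. destruct (Nat.iter _ _ _) as [[[[] a] b] [|fr k]] eqn:E; cbn; split;
    try discriminate; try (intros (c & <- & H1 & H2 & H3); cbn in *; congruence).
  intros [= <-]. eauto.
Qed.

Lemma run_complete Y e x y : eval Y e x y ->
  exists N, forall s, N <= length s -> is_prefix s Y -> run s (gcode e) x = S y.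
Proof.
  intro H. destruct (eval_reaches _ _ _ _ H) as [N HN]. exists N. intros s L P.
  destruct (HN s [] L P) as (m & Hm & E). apply run_spec. exists (Ret y []).
  split; [|auto]. replace (length s) with (m + (length s - m)) by lia.
  eapply iter_steps; [exact E | apply iter_halted].
Qed.

(** A longer oracle alters a step only at a blocked query, where the configuration repeats itself
    while still evaluating. *)
Lemma step_app s t c :
  step (s ++ t) c = step s c \/ (step s c = c /\ fst (fst (fst c)) = true).
Proof.
  destruct c as [[[b e] x] k]. unfold step; cbn [fst snd].
  destruct b; [|now left]. unfold step_run. cbn zeta.
  destruct (Nat.ltb_spec x (length s)) as [L|L].
  - left. rewrite (proj2 (Nat.ltb_lt x (length (s ++ t)))) by (rewrite length_app; lia).
    now rewrite app_nth1 by assumption.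
  - destruct (fst (unpair e)) as [|[|[|[|[|[|n]]]]]]; cbn [Nat.eqb]; auto.
Qed.

(** A run that is blocked once is still evaluating at the end, so a returning configuration
    certifies that no query was blocked. *)
Lemma iter_app s t n c : fst (fst (fst (Nat.iter n (step s) c))) = false ->
  Nat.iter n (step (s ++ t)) c = Nat.iter n (step s) c.
Proof.
  revert c. induction n as [|n IH]; intros c Hc; [reflexivity|].
  rewrite Nat.iter_succ_r in *. rewrite Nat.iter_succ_r.
  destruct (step_app s t c) as [-> | [E M]]; [now apply IH|].
  exfalso. rewrite E in Hc.
  assert (F : Nat.iter n (step s) c = c).
  { clear - E. induction n; [reflexivity|]. rewrite Nat.iter_succ. congruence. }
  rewrite F in Hc. congruence.
Qed.

Lemma run_app s t e x y : run s e x = S y -> run (s ++ t) e x = S y.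
Proof.
  rewrite !run_spec. intros ([[[b a] v] k] & E & Hb & Hv & Hk). cbn in Hb, Hv, Hk. subst b v k.
  rewrite length_app, Nat.add_comm. rewrite Nat.iter_add.
  rewrite (iter_app s t (length s)) by now rewrite E.
  rewrite E. clear E. eexists; split; [reflexivity|].
  induction (length t) as [|n (Hb & Hv & Hk)]; [auto|].
  rewrite Nat.iter_succ. destruct (Nat.iter n _ _) as [[[b e'] v] k].
  cbn in *. subst. auto.
Qed.

Ltac mstep c' :=
  match goal with
  | E : Nat.iter _ _ (step ?s ?c0) = _ |- _ =>
    replace (step s c0) with c' in E by (clear; machine; reflexivity)
  end.

(** Ending with the empty stack forces all frames of [k] to be popped, so the evaluation in front of
    them has returned on the way. The induction is on the number of steps, since recursion and
    search run the same program again. *)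
Lemma reaches_eval Y s : is_prefix s Y -> forall n e x k c,
  Nat.iter n (step s) (Run (gcode e) x k) = c ->
  fst (fst (fst c)) = false -> snd c = [] ->
  exists m y, m < n /\ eval Y e x y /\ Nat.iter m (step s) (Ret y k) = c.
Proof.
  intros P n. induction n as [n IHn] using lt_wf_ind. intros e x k c E Hc Hk.
  destruct n as [|n]; [cbn in E; subst c; discriminate|].
  rewrite Nat.iter_succ_r in E.
  assert (sub : forall m e x k, m <= n -> Nat.iter m (step s) (Run (gcode e) x k) = c ->
    exists m' y, m' < m /\ eval Y e x y /\ Nat.iter m' (step s) (Ret y k) = c)
    by (intros; eapply IHn; eauto; lia).
  assert (ret : forall m y fr k, Nat.iter m (step s) (Ret y (fr :: k)) = c ->
    exists m', m = S m' /\ Nat.iter m' (step s) (step s (Ret y (fr :: k))) = c).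
  { intros m y fr k' E'. destruct m as [|m]; [rewrite <- E' in Hk; discriminate Hk|].
    exists m. split; [reflexivity|]. now rewrite Nat.iter_succ_r in E'. }
  destruct e as [| | | | | |e1 e2|e1 e2|e1 e2|e].
  - mstep (Ret 0 k). exists n, 0. split; [lia|]. split; [constructor | assumption].
  - mstep (Ret (S x) k). exists n, (S x). split; [lia|]. split; [constructor | assumption].
  - mstep (Ret x k). exists n, x. split; [lia|]. split; [constructor | assumption].
  - mstep (Ret (fst (unpair x)) k). exists n, (fst (unpair x)). split; [lia|]. split; [constructor | assumption].
  - mstep (Ret (snd (unpair x)) k). exists n, (snd (unpair x)). split; [lia|]. split; [constructor | assumption].
  - assert (S1 : step s (Run (gcode cOracle) x k) =
      if x <? length s then Ret (if nth x s false then 1 else 0) k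
      else Run (gcode cOracle) x k) by now machine.
    rewrite S1 in E. destruct (Nat.ltb_spec x (length s)) as [L|L].
    + exists n, (if Y x then 1 else 0). split; [lia|]. split; [constructor|].
      now rewrite <- (P x L).
    + destruct (sub n cOracle x k (le_n _) E) as (m & y & Hm & He & Hr).
      exists m, y. split; [lia | auto].
  - mstep (Run (gcode e1) x ((0, (gcode e2, x)) :: k)).
    apply sub in E as (m & a & Hm & Ha & E); [|lia].
    apply ret in E as (m' & -> & E).
    mstep (Run (gcode e2) x ((4, (a, 0)) :: k)).
    apply sub in E as (m & b & Hm' & Hb & E); [|lia].
    apply ret in E as (m'' & -> & E).
    exists m'', (cpair a b). split; [lia|]. split; [now constructor | exact E].
  - mstep (Run (gcode e2) x ((1, (gcode e1, 0)) :: k)).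
    apply sub in E as (m & a & Hm & Ha & E); [|lia].
    apply ret in E as (m' & -> & E).
    mstep (Run (gcode e1) a k).
    apply sub in E as (m & b & Hm' & Hb & E); [|lia].
    exists m, b. split; [lia|]. split; [econstructor; eassumption | exact E].
  - rewrite <- (cpair_unpair x) in E |- *. destruct (unpair x) as [u [|i]]; cbn [fst snd] in *.
    + mstep (Run (gcode e1) u k).
      apply sub in E as (m & y & Hm & Hy & E); [|lia].
      exists m, y. split; [lia|]. split; [now constructor | exact E].
    + mstep (Run (gcode (cRec e1 e2)) (cpair u i)
        ((2, (gcode e2, cpair u i)) :: k)).
      apply sub in E as (m & z & Hm & Hz & E); [|lia].
      apply ret in E as (m' & -> & E).
      mstep (Run (gcode e2) (cpair u (cpair i z)) k).
      apply sub in E as (m & y & Hm' & Hy & E); [|lia].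
      exists m, y. split; [lia|]. split; [econstructor; eassumption | exact E].
  - mstep (Run (gcode e) (cpair x 0) ((3, (gcode e, cpair x 0)) :: k)).
    (* The search reruns [e] at the next candidate with fewer steps left; the nonzero values found
       so far are carried along for [eMu]. *)
    assert (loop : forall j i,
      j <= n -> (forall i', i' < i -> exists v, eval Y e (cpair x i') (S v)) ->
      Nat.iter j (step s) (Run (gcode e) (cpair x i) ((3, (gcode e, cpair x i)) :: k)) = c ->
      exists m y, m < j /\ eval Y (cMu e) x y /\ Nat.iter m (step s) (Ret y k) = c).
    { induction j as [j IHj] using lt_wf_ind. intros i Hj Hi Ej.
      apply sub in Ej as (m & v & Hm & Hv & Ej); [|lia].
      apply ret in Ej as (m' & -> & Ej).
      destruct v as [|v].
      - exists m', i. split; [lia|]. split; [now constructor|].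
        now mstep (Ret i k).
      - mstep (Run (gcode e) (cpair x (S i)) ((3, (gcode e, cpair x (S i))) :: k)).
        apply IHj in Ej as (m & y & Hm' & Hy & Er); [| lia | lia |].
        + exists m, y. split; [lia | auto].
        + intros i' Hi'. destruct (Nat.eq_dec i' i) as [->|]; [eauto | apply Hi; lia]. }
    apply loop in E as (m & y & Hm & Hy & E); [| lia | lia].
    exists m, y. split; [lia | auto].
Qed.

Lemma run_sound Y s e x y : is_prefix s Y -> run s (gcode e) x = S y -> eval Y e x y.
Proof.
  intros P H. apply run_spec in H as (c & E & Hb & Hv & Hk).
  destruct (reaches_eval Y s P _ _ _ _ _ E Hb Hk) as (m & v & _ & He & Hr).
  rewrite iter_halted in Hr. rewrite <- Hr in Hv. cbn in Hv. now subst v.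
Qed.

(** * Counting strings *)

Open Scope nat_scope.

(** Divided by [2^n] this is the measure of a clopen set; at a fixed length it is a number that the
    constructions can compute. *)
Definition cnt (P : list bool -> bool) (n : nat) : nat := length (filter P (all_strings n)).

Lemma cnt_S P n : cnt P (S n) = cnt (fun s => P (false :: s)) n + cnt (fun s => P (true :: s)) n.
Proof.
  unfold cnt. cbn [all_strings]. induction (all_strings n) as [|s l IH]; [reflexivity|].
  cbn [flat_map app filter]. destruct (P (false :: s)), (P (true :: s)); cbn [length]; lia.
Qed.

Lemma cnt_mono P P' n :
  (forall s, length s = n -> P s = true -> P' s = true) -> cnt P n <= cnt P' n.
Proof.
  revert P P'. induction n as [|n IH]; intros P P' H.
  - unfold cnt; cbn. specialize (H [] eq_refl). destruct (P []), (P' []); cbn; auto.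
    now specialize (H eq_refl).
  - rewrite !cnt_S. apply Nat.add_le_mono; apply IH; intros s Hs; apply H; cbn; congruence.
Qed.

Lemma cnt_union P P1 P2 n :
  (forall s, length s = n -> P s = true -> P1 s = true \/ P2 s = true) ->
  cnt P n <= cnt P1 n + cnt P2 n.
Proof.
  revert P P1 P2. induction n as [|n IH]; intros P P1 P2 H.
  - unfold cnt; cbn. specialize (H [] eq_refl). destruct (P []), (P1 []), (P2 []); cbn; auto.
    now destruct (H eq_refl).
  - rewrite !cnt_S.
    pose proof (IH (fun s => P (false :: s)) (fun s => P1 (false :: s)) (fun s => P2 (false :: s))).
    pose proof (IH (fun s => P (true :: s)) (fun s => P1 (true :: s)) (fun s => P2 (true :: s))).
    lapply H0; [lapply H1; [lia|]|]; intros s Hs; apply H; cbn; congruence.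
Qed.

Lemma cnt_disjoint P P1 P2 n :
  (forall s, length s = n -> P1 s = true -> P s = true) ->
  (forall s, length s = n -> P2 s = true -> P s = true /\ P1 s = false) ->
  cnt P1 n + cnt P2 n <= cnt P n.
Proof.
  revert P P1 P2. induction n as [|n IH]; intros P P1 P2 HA HB.
  - unfold cnt; cbn. specialize (HA [] eq_refl). specialize (HB [] eq_refl).
    destruct (P []), (P1 []), (P2 []); cbn; auto; intuition congruence.
  - rewrite !cnt_S.
    pose proof (IH (fun s => P (false :: s)) (fun s => P1 (false :: s)) (fun s => P2 (false :: s))).
    pose proof (IH (fun s => P (true :: s)) (fun s => P1 (true :: s)) (fun s => P2 (true :: s))).
    lapply H; [intro H'; lapply H'; [lapply H0; [intro H1; lapply H1; [lia|]|]|]|];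
      intros s Hs; solve [apply HA; cbn; congruence | apply HB; cbn; congruence].
Qed.

Lemma cnt_true n : cnt (fun _ => true) n = 2 ^ n.
Proof. induction n as [|n IH]; [reflexivity|]. rewrite cnt_S, IH. cbn. lia. Qed.

Lemma cnt_false n : cnt (fun _ => false) n = 0.
Proof. induction n as [|n IH]; [reflexivity|]. now rewrite cnt_S, IH. Qed.

Lemma cnt_le P n : cnt P n <= 2 ^ n.
Proof. rewrite <- cnt_true. now apply cnt_mono. Qed.

Lemma cnt_firstn P n k : cnt (fun s => P (firstn n s)) (n + k) = cnt P n * 2 ^ k.
Proof.
  revert P. induction n as [|n IH]; intro P.
  - cbn [firstn Nat.add]. unfold cnt at 2; cbn. destruct (P []); cbn [length].
    + rewrite cnt_true. lia.
    + now rewrite cnt_false.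
  - cbn [Nat.add]. rewrite !cnt_S. cbn [firstn].
    rewrite (IH (fun s => P (false :: s))), (IH (fun s => P (true :: s))). lia.
Qed.

Lemma cnt_firstn_le P n m : n <= m ->
  cnt (fun s => P (firstn n s)) m = cnt P n * 2 ^ (m - n).
Proof. intro H. rewrite <- cnt_firstn. f_equal. lia. Qed.

(** Markov's inequality for the number of events [E t] that hold at [s]; it turns a Solovay test
    into an ML test. *)
Lemma cnt_markov (T : Type) (E : T -> list bool -> bool) (ts : list T) K n :
  K * cnt (fun s => K <=? length (filter (fun t => E t s) ts)) n
    <= list_sum (map (fun t => cnt (E t) n) ts).
Proof.
  revert E. induction n as [|n IH]; intro E.
  - transitivity (length (filter (fun t => E t []) ts)).
    + unfold cnt; cbn -[Nat.mul Nat.leb].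
      destruct (Nat.leb_spec K (length (filter (fun t => E t []) ts))); cbn [length]; lia.
    + induction ts as [|t ts IH]; [reflexivity|].
      cbn [filter map list_sum fold_right]. unfold list_sum in IH.
      assert (E0 : cnt (E t) 0 = if E t [] then 1 else 0) by (unfold cnt; cbn; now destruct (E t [])).
      rewrite E0. destruct (E t []); cbn [length]; lia.
  - rewrite cnt_S.
    specialize (IH (fun t s => E t (false :: s))) as H0.
    specialize (IH (fun t s => E t (true :: s))) as H1.
    transitivity (list_sum (map (fun t => cnt (fun s => E t (false :: s)) n) ts)
      + list_sum (map (fun t => cnt (fun s => E t (true :: s)) n) ts)); [lia|].
    clear. induction ts as [|t ts IH]; [reflexivity|].
    cbn [map list_sum fold_right]. rewrite cnt_S. unfold list_sum in IH. lia.
Qed.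

(** * Strings as binary numerals *)

Definition value (s : list bool) : nat :=
  fold_left (fun r (b : bool) => 2 * r + (if b then 1 else 0)) s 0.

Lemma value_cons b s : value (b :: s) = (if b then 2 ^ length s else 0) + value s.
Proof.
  unfold value. cbn [fold_left].
  assert (L : forall s c, fold_left (fun r (b : bool) => 2 * r + (if b then 1 else 0)) s c
    = c * 2 ^ length s + fold_left (fun r (b : bool) => 2 * r + (if b then 1 else 0)) s 0).
  { clear. induction s as [|b s IH]; intro c; [cbn; lia|].
    cbn [fold_left length]. rewrite IH. rewrite (IH (2 * 0 + _)). cbn [Nat.pow]. destruct b; lia. }
  rewrite L. destruct b; lia.
Qed.

Lemma value_app s b : value (s ++ [b]) = 2 * value s + (if b then 1 else 0).
Proof. unfold value. now rewrite fold_left_app. Qed.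

(** The cylinder of a string of length [n] is the dyadic interval of length [2^-n] from
    [value s / 2^n], so this bounds the measure of the cylinders that begin in a given interval; the
    minima truncate at the right end of the unit interval. *)
Lemma cnt_value a b n :
  cnt (fun s => (a <=? value s) && (value s <? b)) n <= Nat.min b (2 ^ n) - Nat.min a (2 ^ n).
Proof.
  revert a b. induction n as [|n IH]; intros a b.
  - unfold cnt, value; cbn -[Nat.min Nat.sub Nat.leb Nat.ltb].
    destruct (Nat.leb_spec a 0), (Nat.ltb_spec 0 b); cbn -[Nat.min Nat.sub]; lia.
  - rewrite cnt_S.
    assert (H0 : cnt (fun s => (a <=? value (false :: s)) && (value (false :: s) <? b)) n
      <= Nat.min b (2 ^ n) - Nat.min a (2 ^ n)).
    { rewrite <- IH. apply cnt_mono. intros s _. now rewrite value_cons. }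
    assert (H1 : cnt (fun s => (a <=? value (true :: s)) && (value (true :: s) <? b)) n
      <= Nat.min (b - 2 ^ n) (2 ^ n) - Nat.min (a - 2 ^ n) (2 ^ n)).
    { rewrite <- IH. apply cnt_mono. intros s Hs. rewrite value_cons, Hs.
      rewrite !andb_true_iff, !Nat.leb_le, !Nat.ltb_lt. lia. }
    cbn [Nat.pow]. lia.
Qed.

Lemma comp_value {Q A} `{Enc A} (s : A -> list bool) :
  Comp Q s -> Comp Q (fun x => value (s x)).
Proof. intro Hs. unfold value. comp. Qed.

Lemma comp_cnt {Q A} `{Enc A} (P : A -> list bool -> bool) (n : A -> nat) :
  Comp Q (fun p : A * list bool => P (fst p) (snd p)) -> Comp Q n ->
  Comp Q (fun x => cnt (P x) (n x)).
Proof. intros HP Hn. unfold cnt. comp. Qed.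
#[export] Hint Resolve comp_value : comp.
#[export] Hint Extern 2 (Comp _ (fun _ => cnt _ _)) => apply comp_cnt : comp.

Lemma prefb_spec s t : prefb s t = true <-> length s <= length t /\ firstn (length s) t = s.
Proof.
  revert t. induction s as [|a s IH]; intros [|b t]; cbn; try (intuition (lia || congruence)).
  rewrite andb_true_iff, eqb_true_iff, IH. split.
  - intros [-> [H ->]]. split; [lia | reflexivity].
  - intros [H E]. injection E as Eb Es. repeat split; [congruence | lia | exact Es].
Qed.

Definition covers (l : list (list bool)) (t : list bool) : bool :=
  existsb (fun s => prefb s t) l.

Lemma covers_spec l t : covers l t = true <->
  exists s, In s l /\ length s <= length t /\ firstn (length s) t = s.
Proof.
  unfold covers. rewrite existsb_exists. split; intros [s [Hs H]]; exists s;
    rewrite prefb_spec in *; auto.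
Qed.

Lemma max_length_le (l : list (list bool)) L :
  (forall s, In s l -> length s <= L) <->
  fold_right (fun s m => Nat.max (length s) m) 0 l <= L.
Proof.
  induction l as [|s l IH]; cbn; [split; [lia | tauto]|].
  rewrite Nat.max_lub_iff, <- IH. split.
  - intro H. split; auto.
  - intros [H1 H2] s' [<-|Hs']; auto.
Qed.

Open Scope R_scope.

Lemma pow2_INR n : INR (2 ^ n) = 2 ^ n.
Proof. rewrite pow_INR. reflexivity. Qed.

Lemma pow2_pos n : 0 < 2 ^ n.
Proof. apply pow_lt; lra. Qed.

Lemma div_le_iff a b c : 0 < c -> (a / c <= b <-> a <= b * c).
Proof.
  intro Hc. assert (E : a / c * c = a) by (field; lra).
  split; intro H.
  - rewrite <- E. apply Rmult_le_compat_r; lra.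
  - apply Rmult_le_reg_r with c; [assumption | now rewrite E].
Qed.

(** [lmeasure] counts at the longest length in the list. Any common bound gives the same quotient,
    since whether [t] is covered depends only on its first [M] bits; so several sets can be compared
    at one length. *)
Lemma lmeasure_eq l L : (forall s, In s l -> (length s <= L)%nat) ->
  lmeasure l = INR (cnt (covers l) L) / 2 ^ L.
Proof.
  intro H. apply max_length_le in H as H'. unfold lmeasure.
  set (M := fold_right _ _ _) in *. fold (covers l). fold (cnt (covers l) M).
  assert (E : cnt (covers l) L = (cnt (covers l) M * 2 ^ (L - M))%nat).
  { rewrite <- cnt_firstn_le by assumption.
    assert (HM : forall s, In s l -> (length s <= M)%nat) by (apply max_length_le; apply le_n).
    assert (X : forall t, length t = L -> covers l t = covers l (firstn M t)).
    { intros t Ht. apply eq_true_iff_eq. rewrite !covers_spec.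
      split; intros [s (Hs & H1 & H2)]; exists s; specialize (HM s Hs);
        rewrite ?length_firstn, ?firstn_firstn in *;
        (split; [assumption|]); (split; [lia|]);
        [replace (Nat.min (length s) M) with (length s) by lia
        |replace (Nat.min (length s) M) with (length s) in H2 by lia]; assumption. }
    apply Nat.le_antisymm; apply cnt_mono; intros t Ht; now rewrite (X t Ht). }
  rewrite E, mult_INR, pow2_INR.
  replace (2 ^ L) with (2 ^ M * 2 ^ (L - M)) by (rewrite <- pow_add; f_equal; lia).
  pose proof (pow2_pos M). pose proof (pow2_pos (L - M)). field. lra.
Qed.

Lemma measure_le_intro e n r :
  (forall l, (forall s, In s l -> halts0 e (cpair n (scode s))) ->
    exists L, (forall s, In s l -> (length s <= L)%nat) /\ INR (cnt (covers l) L) <= r * 2 ^ L) ->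
  measure_le e n r.
Proof.
  intros H l Hl. destruct (H l Hl) as (L & HL & HC). rewrite (lmeasure_eq l L HL).
  apply div_le_iff; [apply pow2_pos | assumption].
Qed.

Lemma measure_le_elim e n r l L : measure_le e n r ->
  (forall s, In s l -> halts0 e (cpair n (scode s))) ->
  (forall s, In s l -> (length s <= L)%nat) -> INR (cnt (covers l) L) <= r * 2 ^ L.
Proof.
  intros H Hl HL. specialize (H l Hl). rewrite (lmeasure_eq l L HL) in H.
  apply div_le_iff in H; [assumption | apply pow2_pos].
Qed.

(** * Initial segments of oracles and binary expansions *)

Definition restr (Y : nat -> bool) (n : nat) : list bool := map Y (seq 0 n).

Lemma restr_length Y n : length (restr Y n) = n.
Proof. unfold restr. now rewrite length_map, length_seq. Qed.

Lemma restr_prefix Y n : is_prefix (restr Y n) Y.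
Proof.
  intros i Hi. rewrite restr_length in Hi. unfold restr.
  rewrite (nth_indep _ _ (Y 0%nat)) by now rewrite length_map, length_seq.
  now rewrite map_nth, seq_nth.
Qed.

Lemma prefix_restr Y s : is_prefix s Y -> s = restr Y (length s).
Proof.
  intro H. apply (nth_ext _ _ false false); [now rewrite restr_length|].
  intros i Hi. rewrite (H i Hi). symmetry. apply restr_prefix. now rewrite restr_length.
Qed.

Lemma restr_app Y n m : (n <= m)%nat -> exists t, restr Y m = restr Y n ++ t.
Proof.
  intro H. exists (map Y (seq n (m - n))). unfold restr. rewrite <- map_app, <- seq_app.
  f_equal. f_equal. lia.
Qed.

Lemma restr_firstn Y n m : (n <= m)%nat -> firstn n (restr Y m) = restr Y n.
Proof.
  intro H. destruct (restr_app Y n m H) as [t ->].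
  rewrite firstn_app, restr_length, Nat.sub_diag, firstn_all2 by (rewrite restr_length; lia).
  apply app_nil_r.
Qed.

Lemma restr_S Y n : restr Y (S n) = restr Y n ++ [Y n].
Proof. unfold restr. now rewrite seq_S, map_app. Qed.

Lemma lim_le u l b N : Un_cv u l -> (forall n, (N <= n)%nat -> u n <= b) -> l <= b.
Proof.
  intros H Hb. apply Rnot_lt_le. intro L. destruct (H (l - b)) as [M HM]; [lra|].
  specialize (HM (Nat.max N M) ltac:(lia)). specialize (Hb (Nat.max N M) ltac:(lia)).
  unfold Rdist in HM. apply Rabs_def2 in HM. lra.
Qed.

Lemma lim_ge u l b N : Un_cv u l -> (forall n, (N <= n)%nat -> b <= u n) -> b <= l.
Proof.
  intros H Hb. apply Rnot_lt_le. intro L. destruct (H (b - l)) as [M HM]; [lra|].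
  specialize (HM (Nat.max N M) ltac:(lia)). specialize (Hb (Nat.max N M) ltac:(lia)).
  unfold Rdist in HM. apply Rabs_def2 in HM. lra.
Qed.

Lemma seq_mono (u : nat -> R) : (forall n, u n <= u (S n)) ->
  forall n m, (n <= m)%nat -> u n <= u m.
Proof. intros H n m Hm. induction Hm; [lra|]. eapply Rle_trans; eauto. Qed.

(** The partial sums [w n] increase and [w n + 2^-n] decreases, so they enclose [Om]. The upper
    bound is not strict because [Z] may end in ones. *)
Lemma binary_value_bounds Z Om L : binary_value Z Om ->
  INR (value (restr Z L)) <= Om * 2 ^ L <= INR (value (restr Z L)) + 1.
Proof.
  intro H. set (f := fun i => if Z i then / 2 ^ S i else 0).
  assert (E : forall n, sum_f_R0 f n = INR (value (restr Z (S n))) / 2 ^ S n).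
  { induction n as [|n IH].
    - cbn. unfold f. destruct (Z 0%nat); cbn; lra.
    - rewrite tech5, IH, (restr_S Z (S n)), value_app, plus_INR, mult_INR.
      unfold f. pose proof (pow2_pos n). cbn [pow].
      destruct (Z (S n)); cbn [INR]; field; lra. }
  assert (lo : forall n, INR (value (restr Z n)) / 2 ^ n <= INR (value (restr Z (S n))) / 2 ^ S n
    <= INR (value (restr Z n)) / 2 ^ n + (/ 2 ^ n - / 2 ^ S n)).
  { intro n. rewrite (restr_S Z n), value_app, plus_INR, mult_INR. pose proof (pow2_pos n).
    replace (/ 2 ^ n - / 2 ^ S n) with (/ 2 ^ S n) by (cbn [pow]; field; lra).
    assert (0 < / 2 ^ S n) by (apply Rinv_0_lt_compat, pow2_pos).
    replace ((INR 2 * INR (value (restr Z n)) + INR (if Z n then 1 else 0)) / 2 ^ S n)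
      with (INR (value (restr Z n)) / 2 ^ n + INR (if Z n then 1 else 0) * / 2 ^ S n)
      by (cbn [pow INR]; field; lra).
    destruct (Z n); cbn [INR]; lra. }
  set (w := fun n => INR (value (restr Z n)) / 2 ^ n) in *.
  assert (HL : w L <= Om <= w L + / 2 ^ L).
  { split.
    - apply (lim_ge _ _ _ L H). intros n Hn. fold f. rewrite E. fold (w (S n)).
      apply (seq_mono w); [intro; apply lo | lia].
    - apply (lim_le _ _ _ L H). intros n Hn. fold f. rewrite E. fold (w (S n)).
      pose proof (seq_mono (fun n => - (w n + / 2 ^ n))) as M. cbn beta in M.
      specialize (M ltac:(intro k; specialize (lo k); unfold w in *; lra) L (S n) ltac:(lia)).
      assert (0 < / 2 ^ S n) by (apply Rinv_0_lt_compat, pow2_pos). lra. }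
  unfold w in HL. pose proof (pow2_pos L).
  assert (X : INR (value (restr Z L)) = INR (value (restr Z L)) / 2 ^ L * 2 ^ L) by (field; lra).
  assert (X' : / 2 ^ L * 2 ^ L = 1) by (field; lra). nra.
Qed.

(** * Slow convergence of random left-c.e. reals *)

Open Scope nat_scope.

Notation Computable := (Comp (fun _ => True)).

Lemma comp_any {Q A B} `{Enc A} `{Enc B} (f : A -> B) : Computable f -> Comp Q f.
Proof. intros [e He]. exists e. intros O _. exact (He O I). Qed.

Lemma scode_inj s t : scode s = scode t -> s = t.
Proof.
  revert t. induction s as [|a s IH]; intros [|b t]; cbn [scode]; intro H;
    [reflexivity | destruct b; lia | destruct a; lia |].
  destruct a, b; try (exfalso; lia); f_equal; apply IH; lia.
Qed.

Lemma in_all_strings s n : In s (all_strings n) <-> length s = n.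
Proof.
  revert s. induction n as [|n IH]; intro s; cbn.
  - destruct s; cbn; split; intros H; auto; [destruct H as [H|[]]; discriminate | discriminate].
  - rewrite in_flat_map. split.
    + intros [t [Ht [<-|[<-|[]]]]]; cbn; f_equal; now apply IH.
    + destruct s as [|b s]; [discriminate|]. intros [= H]. exists s.
      split; [now apply IH | destruct b; cbn; auto].
Qed.

Lemma ce_open_of_comp (P : nat * list bool -> bool) : Computable P ->
  exists e, forall n s, halts0 e (cpair n (scode s)) <-> P (n, s) = true.
Proof.
  intro HP.
  destruct (ce_of_comp (fun p => existsb (fun s => (scode s =? snd (unpair (fst p)))
    && P (fst (unpair (fst p)), s)) (all_strings (snd p)))) as [e He]; [comp|].
  exists e. intros n s. rewrite He. cbn [fst snd]. rewrite unpair_cpair. cbn [fst snd]. split.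
  - intros [k Hk]. apply existsb_exists in Hk as [t [_ Ht]].
    apply andb_true_iff in Ht as [E Ht]. apply Nat.eqb_eq, scode_inj in E. now subst t.
  - intro H. exists (length s). apply existsb_exists. exists s.
    split; [now apply in_all_strings|]. now rewrite Nat.eqb_refl.
Qed.

Lemma cnt_existsb (T : Type) (E : T -> list bool -> bool) (ts : list T) n :
  cnt (fun s => existsb (fun t => E t s) ts) n <= list_sum (map (fun t => cnt (E t) n) ts).
Proof.
  induction ts as [|t ts IH]; cbn [existsb map list_sum fold_right].
  - now rewrite cnt_false.
  - unfold list_sum in IH. etransitivity; [apply (cnt_union _ (E t) (fun s => existsb (fun t => E t s) ts))|].
    + intros s _ H. now apply orb_true_iff.
    + lia.
Qed.

Open Scope R_scope.

Section KuceraSlaman.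
Context (Qf : nat -> nat -> nat) (a : nat -> nat).

(** [r] is the previous right end as a numerator over [2^(s + n)]; doubling rewrites it over
    [2^(S s + n)], the scale of stage [s]. *)
Definition ks_start (n s r : nat) : nat := Nat.max (2 * r) (Qf s (S s + n)).
(** At the scale of stage [s] the term [a (S s) - 2 * a s] is the increment of [a s / 2^s] shrunk by
    [2^-n]; the added 1 makes up for rounding [q s] down. *)
Definition ks_end (n : nat) : nat -> nat :=
  nat_rect (fun _ => nat) 0%nat (fun s r => ks_start n s r + (a (S s) - 2 * a s) + 1)%nat.
(* At scale [2^-(S s + n)] the cylinder of [t] is [[value t, value t + 1]]; the test collects the
   cylinders meeting the interval from [ks_start] to [ks_end]. *)
Definition ks_stage (n s : nat) (t : list bool) : bool :=
  ((pred (ks_start n s (ks_end n s)) <=? value t) && (value t <? ks_end n (S s)))%nat.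
(** The length of a string determines its stage: stage [s] of component [n] consists of strings of
    length [S s + n]. *)
Definition ks_test (p : nat * list bool) : bool :=
  let n := fst p in let t := snd p in
  ((n <? length t) && ks_stage n (length t - S n) t)%nat.

Lemma comp_ks_test : Computable (fun p => Qf (fst p) (snd p)) -> Computable a ->
  Computable ks_test.
Proof.
  intros HQ Ha. unfold ks_test, ks_stage.
  assert (Hs : forall A `{Enc A} (n s r : A -> nat), Computable n -> Computable s ->
    Computable r -> Computable (fun x => ks_start (n x) (s x) (r x))).
  { intros. unfold ks_start. apply comp_max; [comp|]. apply (comp_comp2 Qf); comp. }
  assert (He : forall A `{Enc A} (n s : A -> nat), Computable n -> Computable s ->
    Computable (fun x => ks_end (n x) (s x))).
  { intros. unfold ks_end.
    apply comp_rec; [assumption | comp |].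
    apply comp_add; [apply comp_add; [apply Hs; comp | comp] | comp]. }
  cbn zeta. apply comp_andb; [comp|].
  apply comp_andb; [apply comp_leb; [apply comp_pred, Hs; [comp|comp|apply He; comp] | comp]
    | apply comp_ltb; [comp | apply He; comp]].
Qed.

Context (q : nat -> R) (B : R)
  (HQf : forall s k, INR (Qf s k) <= q s * 2 ^ k < INR (Qf s k) + 1)
  (Ha : forall s, (2 * a s <= a (S s))%nat) (HB : forall s, INR (a s) <= B * 2 ^ s).

(** The interval has [a (S s) - 2 * a s + 1] units, and [pred] in [ks_stage] admits one more
    cylinder on the left. *)
Lemma ks_stage_cnt n s L : (S s + n <= L)%nat ->
  INR (cnt (fun t => ks_stage n s (firstn (S s + n) t)) L)
    <= (INR (a (S s)) / 2 ^ S s - INR (a s) / 2 ^ s + 2 / 2 ^ S s) * (2 ^ L / 2 ^ n).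
Proof.
  intro HL. rewrite cnt_firstn_le by assumption.
  assert (H : (cnt (ks_stage n s) (S s + n) <= a (S s) - 2 * a s + 2)%nat).
  { unfold ks_stage. etransitivity; [apply cnt_value|]. cbn [ks_end nat_rect].
    fold (ks_end n s). set (m := ks_start n s (ks_end n s)). lia. }
  apply le_INR in H. rewrite plus_INR, minus_INR, mult_INR in H by apply Ha.
  rewrite mult_INR, pow2_INR.
  assert (E : 2 ^ L = 2 ^ s * 2 * 2 ^ n * 2 ^ (L - (S s + n))).
  { replace L with (S s + n + (L - (S s + n)))%nat at 1 by lia. rewrite !pow_add. cbn [pow]. lra. }
  rewrite E. pose proof (pow2_pos s). pose proof (pow2_pos n).
  pose proof (pow2_pos (L - (S s + n))). cbn [pow]. cbn [INR] in H.
  replace ((INR (a (S s)) / (2 * 2 ^ s) - INR (a s) / 2 ^ s + 2 / (2 * 2 ^ s)) *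
    (2 ^ s * 2 * 2 ^ n * 2 ^ (L - (S s + n)) / 2 ^ n))
    with ((INR (a (S s)) - 2 * INR (a s) + 2) * 2 ^ (L - (S s + n))) by (field; lra).
  apply Rmult_le_compat_r; lra.
Qed.

(** The increments telescope to at most [B] and the two extra units per stage add up to at most 2,
    all of it scaled by [2^-n]. *)
Lemma ks_test_measure e : (forall n s, halts0 e (cpair n (scode s)) <-> ks_test (n, s) = true) ->
  forall n, measure_le e n ((B + 2) / 2 ^ n).
Proof.
  intros He n. apply measure_le_intro. intros l Hl.
  set (L := (fold_right (fun s m => Nat.max (length s) m) 0 l + n)%nat). exists L.
  assert (HL : forall s, In s l -> (length s <= L)%nat) by (apply max_length_le; lia).
  split; [exact HL|].
  eapply Rle_trans; [apply le_INR; etransitivity; [|apply (cnt_existsb _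
    (fun s t => ks_stage n s (firstn (S s + n) t)) (seq 0 (L - n)) L)]|].
  { apply cnt_mono. intros t Ht H. apply covers_spec in H as (s & Hs & H1 & H2).
    apply Hl, He in Hs as Hs'. unfold ks_test in Hs'. cbn [fst snd] in Hs'.
    apply andb_true_iff in Hs' as [H3 H4]. apply Nat.ltb_lt in H3.
    apply existsb_exists. exists (length s - S n)%nat. split.
    - apply in_seq. lia.
    - replace (S (length s - S n) + n)%nat with (length s) by lia. now rewrite H2. }
  assert (main : forall M, (M <= L - n)%nat ->
    INR (list_sum (map (fun s => cnt (fun t => ks_stage n s (firstn (S s + n) t)) L) (seq 0 M)))
      <= (INR (a M) / 2 ^ M + 2 - 2 / 2 ^ M) * (2 ^ L / 2 ^ n)).
  { assert (P : 0 <= 2 ^ L / 2 ^ n).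
    { pose proof (pow2_pos L). pose proof (Rinv_0_lt_compat _ (pow2_pos n)). unfold Rdiv. nra. }
    induction M as [|M IH]; intro HM.
    - cbn [seq map list_sum fold_right INR pow]. pose proof (pos_INR (a 0)).
      apply Rmult_le_pos; [|assumption]. lra.
    - rewrite seq_S, map_app, list_sum_app, plus_INR. cbn [map list_sum fold_right Nat.add].
      rewrite Nat.add_0_r.
      specialize (IH ltac:(lia)). pose proof (ks_stage_cnt n M L ltac:(lia)).
      assert (2 / 2 ^ M = 2 * (2 / 2 ^ S M)) by (pose proof (pow2_pos M); cbn [pow]; field; lra).
      rewrite H0 in IH. eapply Rle_trans; [apply Rplus_le_compat; [exact IH | exact H]|].
      apply Req_le. ring. }
  eapply Rle_trans; [apply main; lia|]. set (M := (L - n)%nat).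
  pose proof (pow2_pos L). pose proof (pow2_pos n). pose proof (pow2_pos M).
  assert (INR (a M) / 2 ^ M <= B) by (apply div_le_iff; auto).
  assert (0 <= 2 / 2 ^ M) by (apply Rlt_le, Rdiv_lt_0_compat; lra).
  replace ((B + 2) / 2 ^ n * 2 ^ L) with ((B + 2) * (2 ^ L / 2 ^ n)) by (field; lra).
  apply Rmult_le_compat_r; [apply Rlt_le, Rdiv_lt_0_compat; lra | lra].
Qed.

(** From stage [s] on each interval begins no earlier than the previous one ends, so their lengths
    add up to the right of [q s]; the extra unit of the first one cancels the rounding in [Qf]. *)
Lemma ks_end_lower n s d :
  q s * 2 ^ (S s + d + n) + INR (a (S s + d)) - INR (a s) * 2 ^ (S d)
    <= INR (ks_end n (S s + d)).
Proof.
  induction d as [|d IH].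
  - rewrite Nat.add_0_r. cbn [ks_end nat_rect]. fold (ks_end n s).
    rewrite !plus_INR, minus_INR, mult_INR by apply Ha.
    assert (INR (Qf s (S s + n)) <= INR (ks_start n s (ks_end n s)))
      by (apply le_INR; unfold ks_start; lia).
    pose proof (HQf s (S s + n)). cbn [pow INR Nat.add] in *. lra.
  - replace (S s + S d)%nat with (S (S s + d)) by lia. set (t := (S s + d)%nat) in *.
    cbn [ks_end nat_rect]. fold (ks_end n t).
    rewrite !plus_INR, minus_INR, mult_INR by apply Ha.
    assert (INR (2 * ks_end n t) <= INR (ks_start n t (ks_end n t)))
      by (apply le_INR; unfold ks_start; lia).
    rewrite mult_INR in H. cbn [pow INR Nat.add] in *. lra.
Qed.
End KuceraSlaman.

Lemma pow2_unbounded (x : R) : exists n, x <= 2 ^ n.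
Proof.
  destruct (Pow_x_infinity 2 ltac:(rewrite Rabs_right; lra) x) as [N HN].
  exists N. specialize (HN N (le_n N)). rewrite Rabs_right in HN; [lra|].
  apply Rle_ge, Rlt_le, pow2_pos.
Qed.

(* Kucera--Slaman: approximations of a random left-c.e. real converge slowest.  Interval number
   [s] of the [n]-th component starts at [max (b_s, q_s)], where [b_s] is the right end of the
   previous one, and has length about [2^-n (alpha_(s+1) - alpha_s)], where
   [alpha_s = a s / 2^s]; if all intervals miss [Omega] then every [b_s] is at most [Omega]. *)
Lemma kucera_slaman Z Om q Qf a B :
  ML_random Z -> binary_value Z Om -> (forall s, q s <= Om) ->
  (forall s k, INR (Qf s k) <= q s * 2 ^ k < INR (Qf s k) + 1) ->
  Computable (fun p => Qf (fst p) (snd p)) -> Computable a ->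
  (forall s, (2 * a s <= a (S s))%nat) -> (forall s, INR (a s) <= B * 2 ^ s) ->
  exists D, 0 < D /\ forall s t, (s <= t)%nat ->
    INR (a t) / 2 ^ t - INR (a s) / 2 ^ s <= D * (Om - q s).
Proof.
  intros HZ HOm Hq HQf CQ Ca Ha HB.
  (* Shifting the components by [K] brings the bound [(B + 2) / 2^(n + K)] below [2^-n]. *)
  destruct (pow2_unbounded (B + 2)) as [K HK].
  destruct (ce_open_of_comp (fun p => ks_test Qf a (fst p + K, snd p)%nat)) as [e He].
  { pose proof (comp_ks_test Qf a CQ Ca). comp. }
  destruct (ce_open_of_comp (ks_test Qf a) (comp_ks_test Qf a CQ Ca)) as [e' He'].
  assert (Te : ML_test e).
  { intros n l Hl.
    assert (Hl' : forall s, In s l -> halts0 e' (cpair (n + K) (scode s))).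
    { intros s Hs. apply He', (proj1 (He n s)), Hl, Hs. }
    pose proof (ks_test_measure Qf a B Ha HB e' He' (n + K) l Hl') as M.
    eapply Rle_trans; [exact M|]. apply div_le_iff; [apply pow2_pos|].
    rewrite pow_add. replace (/ 2 ^ n * (2 ^ n * 2 ^ K)) with (2 ^ K); [assumption|].
    pose proof (pow2_pos n). field. lra. }
  assert (NC : exists n, ~ in_open e n Z).
  { apply not_all_ex_not. exact (HZ e Te). }
  destruct NC as [n0 Hn0]. set (n := (n0 + K)%nat).
  assert (Hn : forall s, ks_stage Qf a n s (restr Z (S s + n)) = false).
  { intro s. apply not_true_iff_false. intro H. apply Hn0. exists (restr Z (S s + n)).
    split; [|apply restr_prefix]. apply He. unfold ks_test. cbn [fst snd].
    rewrite restr_length. fold n. apply andb_true_iff. split; [apply Nat.ltb_lt; lia|].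
    now replace (S s + n - S n)%nat with s by lia. }
  assert (upper : forall t, INR (ks_end Qf a n t) <= Om * 2 ^ (t + n)).
  { induction t as [|t IH].
    - pose proof (binary_value_bounds Z Om (0 + n) HOm). pose proof (pos_INR (value (restr Z (0 + n)))).
      cbn [ks_end nat_rect INR]. lra.
    - set (m := ks_start Qf n t (ks_end Qf a n t)).
      assert (Hm : INR m <= Om * 2 ^ (S t + n)).
      { unfold m, ks_start. apply Nat.max_case.
        - rewrite mult_INR. cbn [pow INR Nat.add]. lra.
        - destruct (HQf t (S t + n)%nat). specialize (Hq t). pose proof (pow2_pos (S t + n)). nra. }
      destruct (binary_value_bounds Z Om (S t + n) HOm) as [H1 H2].
      (* The prefix of [Z] lies before or after the interval. Before is impossible: the right end of
         its cylinder would be strictly below [m], which is at most [Om] at this scale; the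
         strictness comes from [pred] in [ks_stage]. *)
      specialize (Hn t). unfold ks_stage in Hn. apply andb_false_iff in Hn as [Hn|Hn].
      + apply Nat.leb_gt in Hn. fold m in Hn.
        assert (X : (S (S (value (restr Z (S t + n)))) <= m)%nat) by lia.
        apply le_INR in X. rewrite !S_INR in X. lra.
      + apply Nat.ltb_ge, le_INR in Hn. lra. }
  (* Divided by [2^(t + n)], the bounds [ks_end_lower] and [upper] place the increment of [a],
     shrunk by [2^-n], between [q s] and [Om]. *)
  exists (2 ^ n). split; [apply pow2_pos|]. intros s t Hst.
  destruct (Nat.eq_dec s t) as [->|Hne].
  { specialize (Hq t). pose proof (pow2_pos n). nra. }
  pose proof (ks_end_lower Qf a q HQf Ha n s (t - S s)) as X.
  replace (S s + (t - S s))%nat with t in X by lia. specialize (upper t).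
  pose proof (pow2_pos s). pose proof (pow2_pos n). pose proof (pow2_pos (S (t - S s))).
  assert (E : 2 ^ t = 2 ^ s * 2 ^ S (t - S s)) by (rewrite <- pow_add; f_equal; lia).
  rewrite pow_add in *. rewrite E in *.
  apply Rmult_le_reg_r with (2 ^ s * 2 ^ S (t - S s)); [nra|].
  replace ((INR (a t) / (2 ^ s * 2 ^ S (t - S s)) - INR (a s) / 2 ^ s) * (2 ^ s * 2 ^ S (t - S s)))
    with (INR (a t) - INR (a s) * 2 ^ S (t - S s)) by (field; lra).
  lra.
Qed.

(** * Rational approximations and cost accounting *)

Open Scope R_scope.

Lemma INR_div_S x d : INR (x / S d) <= INR x / INR (S d) < INR (x / S d) + 1.
Proof.
  pose proof (Nat.div_mod_eq x (S d)) as E. pose proof (Nat.mod_upper_bound x (S d) ltac:(lia)) as M.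
  assert (Hd : 0 < INR (S d)) by (apply lt_0_INR; lia).
  apply lt_INR in M. pose proof (pos_INR (x mod S d)).
  apply (f_equal INR) in E. rewrite plus_INR, mult_INR in E.
  assert (E' : INR x / INR (S d) = INR (x / S d) + INR (x mod S d) / INR (S d))
    by (rewrite E; field; lra).
  assert (0 <= INR (x mod S d) / INR (S d) < 1).
  { split; [apply Rmult_le_pos; [lra | apply Rlt_le, Rinv_0_lt_compat, Hd]|].
    apply Rmult_lt_reg_r with (INR (S d)); [assumption|].
    replace (INR (x mod S d) / INR (S d) * INR (S d)) with (INR (x mod S d)) by (field; lra). lra. }
  lra.
Qed.

(** The numerator is a truncated difference, so a negative rational is replaced by 0; hence [Rmax]
    here and in the bounds on [Qf] below. *)
Lemma floor_dyadic n m d k :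
  INR ((n - m) * 2 ^ k / S d) <= Rmax ((INR n - INR m) / INR (S d)) 0 * 2 ^ k
    < INR ((n - m) * 2 ^ k / S d) + 1.
Proof.
  assert (Hd : 0 < INR (S d)) by (apply lt_0_INR; lia).
  replace (Rmax ((INR n - INR m) / INR (S d)) 0 * 2 ^ k)
    with (INR ((n - m) * 2 ^ k) / INR (S d)); [apply INR_div_S|].
  rewrite mult_INR, pow2_INR. destruct (le_lt_dec m n) as [L|L].
  - rewrite minus_INR by assumption. apply le_INR in L. rewrite Rmax_left; [field; lra|].
    apply Rmult_le_pos; [lra | apply Rlt_le, Rinv_0_lt_compat, Hd].
  - replace (n - m)%nat with 0%nat by lia. apply lt_INR in L. rewrite Rmax_right.
    + cbn [INR]. unfold Rdiv. ring.
    + apply div_le_iff; lra.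
Qed.

Lemma rational_floor q : computable_Q_seq q ->
  exists Qf, Computable (fun p => Qf (fst p) (snd p)) /\
    forall s k, INR (Qf s k) <= Rmax (q s) 0 * 2 ^ k < INR (Qf s k) + 1.
Proof.
  intros (e1 & e2 & e3 & H).
  destruct (comp_of_total e1) as (f1 & C1 & E1); [intro s; destruct (H s) as (n & m & d & Hn & _); eauto|].
  destruct (comp_of_total e2) as (f2 & C2 & E2); [intro s; destruct (H s) as (n & m & d & _ & Hm & _); eauto|].
  destruct (comp_of_total e3) as (f3 & C3 & E3); [intro s; destruct (H s) as (n & m & d & _ & _ & Hd & _); eauto|].
  specialize (C1 (fun _ => True)). specialize (C2 (fun _ => True)). specialize (C3 (fun _ => True)).
  exists (fun s k => (f1 s - f2 s) * 2 ^ k / S (f3 s))%nat. split; [comp|].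
  intros s k. destruct (H s) as (n & m & d & Hn & Hm & Hd & ->).
  rewrite (eval_fun _ _ _ _ Hn _ (E1 s)), (eval_fun _ _ _ _ Hm _ (E2 s)),
    (eval_fun _ _ _ _ Hd _ (E3 s)). apply floor_dyadic.
Qed.

(** An approximation within [2^-s] is off by at most 1 after scaling, and rounding down loses less
    than 1 more; adding 2 yields an upper bound in excess by at most 3 and never 0. The argument
    [S s] is the stage at which a change made after stage [s] is charged. *)
Lemma cost_upper c : computable_real2 c -> (forall x s, 0 <= c x s) ->
  exists u, Computable (fun p => u (fst p) (snd p)) /\
    forall x s, (2 <= u x s)%nat /\
      c x (S s) * 2 ^ s <= INR (u x s) <= c x (S s) * 2 ^ s + 3.
Proof.
  intros (e1 & e2 & e3 & H) c0.
  assert (H' : forall v, exists n m d, eval0 e1 v n /\ eval0 e2 v m /\ eval0 e3 v d).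
  { intro v. rewrite <- (cpair_unpair v), <- (cpair_unpair (fst (unpair v))).
    destruct (H (fst (unpair (fst (unpair v)))) (snd (unpair (fst (unpair v)))) (snd (unpair v)))
      as (n & m & d & ? & ? & ? & _). eauto 10. }
  destruct (comp_of_total e1) as (f1 & C1 & E1); [intro s; destruct (H' s) as (n & m & d & Hn & _); eauto|].
  destruct (comp_of_total e2) as (f2 & C2 & E2); [intro s; destruct (H' s) as (n & m & d & _ & Hm & _); eauto|].
  destruct (comp_of_total e3) as (f3 & C3 & E3); [intro s; destruct (H' s) as (n & m & d & _ & _ & Hd); eauto|].
  specialize (C1 (fun _ => True)). specialize (C2 (fun _ => True)). specialize (C3 (fun _ => True)).
  set (v := fun x s => cpair (cpair x (S s)) s).
  exists (fun x s => (f1 (v x s) - f2 (v x s)) * 2 ^ s / S (f3 (v x s)) + 2)%nat.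
  split; [unfold v; comp|]. intros x s. split; [lia|].
  destruct (H x (S s) s) as (n & m & d & Hn & Hm & Hd & A). fold (v x s) in Hn, Hm, Hd.
  rewrite <- (eval_fun _ _ _ _ Hn _ (E1 _)), <- (eval_fun _ _ _ _ Hm _ (E2 _)),
    <- (eval_fun _ _ _ _ Hd _ (E3 _)).
  pose proof (floor_dyadic n m d s) as F. specialize (c0 x (S s)).
  set (w := (INR n - INR m) / INR (S d)) in *. rewrite plus_INR. cbn [INR].
  pose proof (pow2_pos s) as P2.
  assert (B : c x (S s) - / 2 ^ s <= Rmax w 0 <= c x (S s) + / 2 ^ s).
  { assert (0 < / 2 ^ s) by now apply Rinv_0_lt_compat.
    assert (- / 2 ^ s <= c x (S s) - w <= / 2 ^ s)
      by (unfold Rabs in A; destruct (Rcase_abs (c x (S s) - w)); lra).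
    unfold Rmax. destruct (Rle_dec w 0); lra. }
  assert (E : / 2 ^ s * 2 ^ s = 1) by (field; lra). nra.
Qed.

Lemma unpair_fst_le n : (fst (unpair n) <= n)%nat.
Proof. rewrite <- (cpair_unpair n) at 2. pose proof (cpair_le_add (fst (unpair n)) (snd (unpair n))). lia. Qed.

Lemma unpair_snd_le n : (snd (unpair n) <= n)%nat.
Proof. rewrite <- (cpair_unpair n) at 2. pose proof (cpair_le_add (fst (unpair n)) (snd (unpair n))). lia. Qed.

Lemma sum_increment x y N j :
  (forall i, (i <= N)%nat -> x i <= y i) -> (j <= N)%nat ->
  sum_f_R0 x N + (y j - x j) <= sum_f_R0 y N.
Proof.
  induction N as [|N IH]; intros H Hj.
  - replace j with 0%nat by lia. cbn. lra.
  - cbn [sum_f_R0]. pose proof (H (S N) (le_n _)).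
    destruct (Nat.eq_dec j (S N)) as [->|].
    + assert (sum_f_R0 x N <= sum_f_R0 y N) by (apply sum_Rle; auto). lra.
    + specialize (IH ltac:(auto) ltac:(lia)). lra.
Qed.

(* Stage [s] is paid for by an increase of the account of its owner [j s]. *)
Lemma budget (f : nat -> R) (w : nat -> nat -> R) (j : nat -> nat) (K : R) :
  (forall i s, 0 <= w i s) -> (forall i s, w i s <= w i (S s)) ->
  (forall i s, w i s <= K / 2 ^ i) -> (forall s, (j s <= s)%nat) ->
  (forall s, f s <= w (j s) (S s) - w (j s) s) ->
  forall N, sum_f_R0 f N <= 2 * K.
Proof.
  intros H0 Hm HK Hj Hf N.
  assert (A : sum_f_R0 f N <= sum_f_R0 (fun i => w i (S N)) N).
  { induction N as [|N IH].
    - cbn. specialize (Hf 0%nat). specialize (Hj 0%nat). replace (j 0%nat) with 0%nat in Hf by lia.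
      specialize (H0 0%nat 0%nat). lra.
    - pose proof (sum_increment (fun i => w i (S N)) (fun i => w i (S (S N))) (S N) (j (S N))
        ltac:(intros; apply Hm) (Hj _)) as X. cbn beta in X.
      rewrite (tech5 (fun i => w i (S N))) in X. specialize (H0 (S N) (S N)).
      rewrite (tech5 f). specialize (Hf (S N)). lra. }
  assert (K0 : 0 <= K).
  { specialize (H0 0%nat 0%nat). specialize (HK 0%nat 0%nat). cbn in HK. lra. }
  assert (G : sum_f_R0 (fun i => w i (S N)) N <= K * (2 - / 2 ^ N)).
  { eapply Rle_trans; [apply sum_Rle; intros i _; apply HK|].
    clear - K0. induction N as [|N IH]; cbn [sum_f_R0].
    - cbn. lra.
    - pose proof (pow2_pos N). replace (K / 2 ^ S N) with (K * (/ 2 ^ N - / 2 ^ S N))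
        by (cbn [pow]; field; lra). lra. }
  pose proof (Rinv_0_lt_compat _ (pow2_pos N)). nra.
Qed.

Lemma eventually_list (T : Type) (P : T -> nat -> Prop) (l : list T) :
  (forall x, In x l -> exists N, forall n, (N <= n)%nat -> P x n) ->
  exists N, forall n, (N <= n)%nat -> forall x, In x l -> P x n.
Proof.
  induction l as [|x l IH]; intro H.
  - exists 0%nat. intros n _ x [].
  - destruct (H x (or_introl eq_refl)) as [N1 H1].
    destruct IH as [N2 H2]; [intros; apply H; now right|].
    exists (Nat.max N1 N2). intros n Hn y [<-|Hy]; [apply H1 | apply H2]; auto; lia.
Qed.

Lemma Rmax0_mono q : (forall s, q s <= q (S s)) -> forall s t, (s <= t)%nat ->
  Rmax (q s) 0 <= Rmax (q t) 0.
Proof. intros H s t L. apply Rle_max_compat_r. now apply seq_mono. Qed.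

Lemma pow2_small eps : 0 < eps -> exists N, forall n, (N <= n)%nat -> / 2 ^ n <= eps.
Proof.
  intro He. destruct (pow2_unbounded (/ eps)) as [N HN]. exists N. intros n Hn.
  rewrite <- (Rinv_inv eps). apply Rinv_le_contravar; [now apply Rinv_0_lt_compat|].
  eapply Rle_trans; [exact HN|]. apply Rle_pow; [lra | assumption].
Qed.

(** * Diagonalization against approximations obeying c_Omega *)

Open Scope nat_scope.

(** The empty oracle cut at length [s]; [run (falses s)] is the computation without oracle after [s]
    steps. *)
Definition falses (s : nat) : list bool := map (fun _ => false) (seq 0 s).

Lemma comp_falses {Q A} `{Enc A} (n : A -> nat) : Comp Q n -> Comp Q (fun x => falses (n x)).
Proof. intro Hn. unfold falses. comp. Qed.
#[export] Hint Resolve comp_falses : comp.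

Lemma falses_prefix s : is_prefix (falses s) (fun _ => false).
Proof. exact (restr_prefix (fun _ => false) s). Qed.

Lemma falses_length s : length (falses s) = s.
Proof. exact (restr_length (fun _ => false) s). Qed.

Lemma run_falses_complete e x y : eval0 e x y ->
  exists N, forall s, N <= s -> run (falses s) (gcode e) x = S y.
Proof.
  intro H. destruct (run_complete _ _ _ _ H) as [N HN]. exists N. intros s Hs.
  apply HN; [now rewrite falses_length | apply falses_prefix].
Qed.

(** * The set built by flipping bits *)

Section Diagonal.
Context (Qf u : nat -> nat -> nat).

(* A history is a list of pairs (flipped position, stage of the opponent's approximation at
   which the flip was allowed), newest first.  Position [p] belongs to requirement
   [fst (unpair p)]; requirement [cpair j m] wants the [j]-th approximation to cost [m]. *)
Definition history : Type := list (nat * nat).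

(** A lower bound of [2^t] times [Omega_t - Omega_p]: what an opponent pays at least for following a
    flip at [p] after its stage [t]. *)
Definition gnum (p t : nat) : nat := Qf t t - S (Qf p t).
(** The approximation starts from the empty set, so a bit is the parity of its flips. *)
Definition bit (H : history) (x : nat) : bool :=
  fold_right (fun r b => xorb (fst r =? x) b) false H.
Definition recs (e : nat) (H : history) : history :=
  filter (fun r => fst (unpair (fst r)) =? e) H.
Definition agree (s e t : nat) (H : history) (y : nat) : bool :=
  run (falses s) (fst (unpair e)) (cpair t y) =? S (if bit H y then 1 else 0).
(** The least position of the requirement at which the opponent's loss visibly exceeds [4^e] times
    the cost; the value [s] means that none has been found. *)
Definition target (e s : nat) : nat :=
  hd s (filter (fun i => 2 ^ (2 * e) * u (cpair e i) s <? gnum (cpair e i) s) (seq 0 s)).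
(** A stage [cpair (cpair e t) b] serves the pair [(e, t)]; the padding [b] lets every pair return
    infinitely often. *)
Definition stage_fst (s : nat) : nat := fst (unpair (fst (unpair s))).
Definition stage_snd (s : nat) : nat := snd (unpair (fst (unpair s))).
Definition stage_pos (s : nat) : nat := cpair (stage_fst s) (target (stage_fst s) s).
(** Agreement on all flipped bits of the requirement, at an opponent stage later than theirs, shows
    that the earlier flips have been followed. The gain is taken at the opponent's stage, where it
    is eventually at least half of its final value, whence the factor 2. The last condition stops a
    requirement that has charged its amount. *)
Definition act (s : nat) (H : history) : bool :=
  (target (stage_fst s) s <? s) &&
  forallb (fun r => (snd r <? stage_snd s) && agree s (stage_fst s) (stage_snd s) H (fst r)) (recs (stage_fst s) H) &&
  agree s (stage_fst s) (stage_snd s) H (stage_pos s) &&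
  (2 ^ (2 * stage_fst s) * u (stage_pos s) s * 2 ^ stage_snd s <=? 2 * gnum (stage_pos s) (stage_snd s) * 2 ^ s) &&
  (list_sum (map (fun r => gnum (fst r) (snd r) * 2 ^ (s - snd r)) (recs (stage_fst s) H))
    <? snd (unpair (stage_fst s)) * 2 ^ s).
Definition hist : nat -> history :=
  nat_rect (fun _ => history) [] (fun s H => if act s H then (stage_pos s, stage_snd s) :: H else H).

Lemma hist_S s : hist (S s) = if act s (hist s) then (stage_pos s, stage_snd s) :: hist s else hist s.
Proof. reflexivity. Qed.

Lemma comp_list_sum {Q A} `{Enc A} (l : A -> list nat) :
  Comp Q l -> Comp Q (fun x => list_sum (l x)).
Proof. intro Hl. unfold list_sum. comp. Qed.

Lemma comp_bit {Q A} `{Enc A} (h : A -> history) (x : A -> nat) :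
  Comp Q h -> Comp Q x -> Comp Q (fun a => bit (h a) (x a)).
Proof. intros HH Hx. unfold bit, history in *. comp. Qed.

Lemma comp_hist Q : Comp Q (fun p => Qf (fst p) (snd p)) -> Comp Q (fun p => u (fst p) (snd p)) ->
  Comp Q hist.
Proof.
  intros HQ Hu.
  assert (Hg : forall A `{Enc A} (p t : A -> nat), Comp Q p -> Comp Q t ->
    Comp Q (fun x => gnum (p x) (t x))).
  { intros. unfold gnum. pose proof (comp_comp2 Qf _ _ HQ H1 H1).
    pose proof (comp_comp2 Qf _ _ HQ H0 H1). comp. }
  assert (Ht : forall A `{Enc A} (e s : A -> nat), Comp Q e -> Comp Q s ->
    Comp Q (fun x => target (e x) (s x))).
  { intros. unfold target.
    apply (comp_ext (fun x => hd 0 (filter (fun i => 2 ^ (2 * e x) * u (cpair (e x) i) (s x)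
      <? gnum (cpair (e x) i) (s x)) (seq 0 (s x)) ++ [s x]))).
    { intro x. now destruct (filter _ _). }
    apply comp_hd, comp_app; [|comp]. apply comp_filter; [|comp].
    apply comp_ltb; [apply comp_mul; [comp | apply (comp_comp2 u); comp] | apply Hg; comp]. }
  assert (Ha : forall A `{Enc A} (s e t y : A -> nat) (h : A -> history), Comp Q s -> Comp Q e ->
    Comp Q t -> Comp Q y -> Comp Q h -> Comp Q (fun x => agree (s x) (e x) (t x) (h x) (y x))).
  { intros. unfold agree. pose proof (comp_bit h y H4 H3). comp. }
  unfold hist. apply (comp_rec (fun s => s) (fun _ => [])
    (fun _ s H => if act s H then (stage_pos s, stage_snd s) :: H else H)); [comp | unfold history; comp |].
  set (s := fun p : nat * nat * history => snd (fst p)).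
  set (h := fun p : nat * nat * history => snd p).
  change (Comp Q (fun p => if act (s p) (h p) then (stage_pos (s p), stage_snd (s p)) :: h p else h p)).
  assert (Hs : Comp Q s) by (unfold s, history; comp).
  assert (Hh : Comp Q h) by (unfold h, history; comp).
  clearbody s h.
  assert (Hp : Comp Q (fun p => stage_pos (s p))).
  { unfold stage_pos, stage_fst. apply comp_cpair; [comp | apply Ht; comp]. }
  assert (He : Comp Q (fun p => stage_fst (s p))) by (unfold stage_fst; comp).
  assert (Htt : Comp Q (fun p => stage_snd (s p))) by (unfold stage_snd; comp).
  assert (Hr : Comp Q (fun p => recs (stage_fst (s p)) (h p))).
  { unfold recs, history in *. apply comp_filter; [|comp].
    apply comp_eqb; [comp|]. apply (comp_comp (fun p => stage_fst (s p))); comp. }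
  apply comp_if; [|unfold history in *; comp | assumption].
  unfold act. repeat apply comp_andb.
  - apply comp_ltb; [apply Ht|]; comp.
  - unfold history in *. apply comp_forallb; [|comp]. apply comp_andb; [|apply Ha].
    + apply comp_ltb; [comp | apply (comp_comp (fun p => stage_snd (s p))); comp].
    + apply (comp_comp s); comp.
    + apply (comp_comp (fun p => stage_fst (s p))); comp.
    + apply (comp_comp (fun p => stage_snd (s p))); comp.
    + comp.
    + apply (comp_comp h); comp.
  - apply Ha; comp.
  - apply comp_leb; [apply comp_mul; [apply comp_mul; [comp | apply (comp_comp2 u); comp] | comp]
      | apply comp_mul; [apply comp_mul; [comp | apply Hg; comp] | comp]].
  - unfold history in *. apply comp_ltb; [apply comp_list_sum, comp_map; [|comp] | comp].
    apply comp_mul; [apply Hg; comp|]. apply comp_pow; [comp|].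
    apply comp_sub; [apply (comp_comp s); comp | comp].
Qed.

Record acts (s : nat) (H : history) : Prop := {
  acts_target : target (stage_fst s) s < s;
  acts_recs : forall r, In r (recs (stage_fst s) H) ->
    snd r < stage_snd s /\ agree s (stage_fst s) (stage_snd s) H (fst r) = true;
  acts_agree : agree s (stage_fst s) (stage_snd s) H (stage_pos s) = true;
  acts_gain : 2 ^ (2 * stage_fst s) * u (stage_pos s) s * 2 ^ stage_snd s <= 2 * gnum (stage_pos s) (stage_snd s) * 2 ^ s;
  acts_room : list_sum (map (fun r => gnum (fst r) (snd r) * 2 ^ (s - snd r)) (recs (stage_fst s) H))
    < snd (unpair (stage_fst s)) * 2 ^ s }.

Lemma act_spec s H : act s H = true <-> acts s H.
Proof.
  unfold act. rewrite !andb_true_iff, !Nat.ltb_lt, Nat.leb_le, forallb_forall. split.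
  - intros [[[[H1 H2] H3] H4] H5]. split; auto.
    intros r Hr. apply H2 in Hr. now rewrite andb_true_iff, Nat.ltb_lt in Hr.
  - intros [H1 H2 H3 H4 H5]. repeat split; auto.
    intros r Hr. rewrite andb_true_iff, Nat.ltb_lt. auto.
Qed.

Lemma stage_pos_owner s : fst (unpair (stage_pos s)) = stage_fst s.
Proof. unfold stage_pos. now rewrite unpair_cpair. Qed.

Lemma recs_S e s : recs e (hist (S s)) =
  if act s (hist s) && (stage_fst s =? e) then (stage_pos s, stage_snd s) :: recs e (hist s)
  else recs e (hist s).
Proof.
  rewrite hist_S. destruct (act s (hist s)); [|reflexivity]. cbn [recs filter fst andb].
  now rewrite stage_pos_owner.
Qed.

Lemma bit_S s x : bit (hist (S s)) x =
  xorb (act s (hist s) && (stage_pos s =? x)) (bit (hist s) x).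
Proof. rewrite hist_S. destruct (act s (hist s)); [reflexivity | now rewrite xorb_false_l]. Qed.

Lemma hist_time s r : In r (hist s) -> snd r < s.
Proof.
  induction s as [|s IH]; [intros []|]. rewrite hist_S.
  destruct (act s (hist s)); [intros [<-|H]|intro H]; cbn [snd];
    try (apply IH in H; lia).
  pose proof (unpair_snd_le (fst (unpair s))). pose proof (unpair_fst_le s).
  unfold stage_snd. lia.
Qed.

Lemma recs_in e H r : In r (recs e H) -> In r H /\ fst (unpair (fst r)) = e.
Proof. unfold recs. rewrite filter_In, Nat.eqb_eq. auto. Qed.

(** * Gains of the requirements and cost of the flips *)

Open Scope R_scope.
Context (q : nat -> R) (Om : R) (c : nat -> nat -> R) (cl : nat -> R)
  (qmono : forall s, q s <= q (S s)) (qlim : Un_cv q Om) (Om0 : 0 <= Om)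
  (HQf : forall s k, INR (Qf s k) <= Rmax (q s) 0 * 2 ^ k < INR (Qf s k) + 1)
  (c0 : forall x s, 0 <= c x s) (ccl : forall x s, c x s <= cl x)
  (Hu : forall x s, (2 <= u x s)%nat /\ c x (S s) * 2 ^ s <= INR (u x s) <= c x (S s) * 2 ^ s + 3).
Local Notation qp s := (Rmax (q s%nat) 0).

Definition gain (r : nat * nat) : R := INR (gnum (fst r) (snd r)) / 2 ^ snd r.
Definition gsum (H : history) : R := fold_right (fun r a => gain r + a) 0 H.

Lemma q_le_Om s : q s <= Om.
Proof. apply (lim_ge q Om (q s) s qlim). intros. now apply seq_mono. Qed.

Lemma qp_le_Om s : qp s <= Om.
Proof. apply Rmax_lub; [apply q_le_Om | assumption]. Qed.

Lemma gain_ge0 r : 0 <= gain r.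
Proof.
  unfold gain. apply Rmult_le_pos; [apply pos_INR|]. apply Rlt_le, Rinv_0_lt_compat, pow2_pos.
Qed.

Lemma gain_lower p t : qp t - qp p - 2 * / 2 ^ t <= gain (p, t).
Proof.
  unfold gain; cbn [fst snd]. pose proof (pow2_pos t).
  apply Rmult_le_reg_r with (2 ^ t); [assumption|].
  replace (INR (gnum p t) / 2 ^ t * 2 ^ t) with (INR (gnum p t)) by (field; lra).
  replace ((qp t - qp p - 2 * / 2 ^ t) * 2 ^ t) with (qp t * 2 ^ t - qp p * 2 ^ t - 2)
    by (field; lra).
  pose proof (HQf t t). pose proof (HQf p t).
  assert (X : (Qf t t <= gnum p t + S (Qf p t))%nat) by (unfold gnum; lia).
  apply le_INR in X. rewrite plus_INR, S_INR in X. lra.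
Qed.

Lemma gain_upper p t : (0 < gnum p t)%nat -> (p < t)%nat /\ gain (p, t) <= qp t - qp p.
Proof.
  intro Hg. unfold gnum in Hg. assert (X : (S (S (Qf p t)) <= Qf t t)%nat) by lia.
  apply le_INR in X. rewrite !S_INR in X.
  pose proof (HQf t t). pose proof (HQf p t). pose proof (pow2_pos t). split.
  - apply Nat.nle_gt. intro L. pose proof (Rmax0_mono q qmono t p L). nra.
  - unfold gain; cbn [fst snd]. apply div_le_iff; [assumption|].
    unfold gnum. rewrite minus_INR, S_INR by lia. lra.
Qed.

Lemma gain_le_Om r : gain r <= Om.
Proof.
  destruct r as [p t]. destruct (Nat.eq_dec (gnum p t) 0) as [E|E].
  - unfold gain; cbn [fst snd]. rewrite E. cbn [INR]. unfold Rdiv. lra.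
  - destruct (gain_upper p t ltac:(lia)) as [_ X]. pose proof (qp_le_Om t).
    pose proof (Rmax_r (q p) 0). lra.
Qed.

Lemma gsum_num s H : (forall r, In r H -> (snd r < s)%nat) ->
  INR (list_sum (map (fun r => (gnum (fst r) (snd r) * 2 ^ (s - snd r))%nat) H)) = gsum H * 2 ^ s.
Proof.
  induction H as [|r H IH]; intro Hr; cbn [map list_sum fold_right gsum].
  - cbn. lra.
  - unfold list_sum in IH. rewrite plus_INR, IH by (intros; apply Hr; now right).
    fold (gsum H). rewrite mult_INR, pow2_INR. unfold gain.
    pose proof (Hr r (or_introl eq_refl)).
    replace (2 ^ s) with (2 ^ snd r * 2 ^ (s - snd r)) by (rewrite <- pow_add; f_equal; lia).
    pose proof (pow2_pos (snd r)). field. lra.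
Qed.

Lemma gsum_room s H : acts s H -> (forall r, In r H -> (snd r < s)%nat) ->
  gsum (recs (stage_fst s) H) < INR (snd (unpair (stage_fst s))).
Proof.
  intros Ha Hr. pose proof (acts_room _ _ Ha) as X. apply lt_INR in X.
  rewrite gsum_num in X by (intros r Hin; apply Hr, (recs_in _ _ _ Hin)).
  rewrite mult_INR, pow2_INR in X. apply Rmult_lt_reg_r in X; [assumption | apply pow2_pos].
Qed.

Lemma gsum_ge0 H : 0 <= gsum H.
Proof. induction H as [|r H IH]; cbn; [lra|]. fold (gsum H). pose proof (gain_ge0 r). lra. Qed.

Lemma gsum_step e s : gsum (recs e (hist (S s))) =
  gsum (recs e (hist s)) + (if act s (hist s) && (stage_fst s =? e)%nat then gain (stage_pos s, stage_snd s) else 0).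
Proof. rewrite recs_S. destruct (_ && _); cbn; [fold (gsum (recs e (hist s)))|]; lra. Qed.

Lemma gsum_mono e s t : (s <= t)%nat -> gsum (recs e (hist s)) <= gsum (recs e (hist t)).
Proof.
  apply (seq_mono (fun s => gsum (recs e (hist s)))). intro n. rewrite gsum_step.
  pose proof (gain_ge0 (stage_pos n, stage_snd n)). destruct (_ && _); lra.
Qed.

(** A flip is made only while the sum is below the amount wanted, and a single gain is at most
    [Om]. *)
Lemma gsum_bound e s : gsum (recs e (hist s)) <= INR (snd (unpair e)) + Om.
Proof.
  induction s as [|s IH].
  - cbn. pose proof (pos_INR (snd (unpair e))). lra.
  - rewrite gsum_step. destruct (act s (hist s)) eqn:E; cbn [andb]; [|lra].
    destruct (Nat.eqb_spec (stage_fst s) e) as [<-|]; [|lra].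
    apply act_spec in E. pose proof (gsum_room s _ E (hist_time s)).
    pose proof (gain_le_Om (stage_pos s, stage_snd s)). lra.
Qed.

Definition stage_cost (s : nat) : R := if act s (hist s) then c (stage_pos s) (S s) else 0.

Lemma stage_cost_spec s : stage_cost_is c (fun s => bit (hist s)) s (stage_cost s).
Proof.
  unfold stage_cost, stage_cost_is. destruct (act s (hist s)) eqn:E.
  - left. exists (stage_pos s). split; [|split; [|reflexivity]].
    + rewrite bit_S, E, Nat.eqb_refl. cbn [andb]. now destruct (bit (hist s) (stage_pos s)).
    + intros y Hy. rewrite bit_S, (proj2 (Nat.eqb_neq (stage_pos s) y)), andb_false_r by lia.
      now rewrite xorb_false_l.
  - right. split; [|reflexivity]. intro x. now rewrite bit_S, E, xorb_false_l.
Qed.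

Lemma stage_fst_le s : (stage_fst s <= s)%nat.
Proof. unfold stage_fst. pose proof (unpair_fst_le (fst (unpair s))). pose proof (unpair_fst_le s). lia. Qed.

Lemma stage_cost_le s : stage_cost s <=
  2 / 2 ^ (2 * stage_fst s) * gsum (recs (stage_fst s) (hist (S s)))
  - 2 / 2 ^ (2 * stage_fst s) * gsum (recs (stage_fst s) (hist s)).
Proof.
  rewrite gsum_step. unfold stage_cost. destruct (act s (hist s)) eqn:E; cbn [andb]; [|lra].
  rewrite Nat.eqb_refl. apply act_spec in E. pose proof (acts_gain _ _ E) as X.
  destruct (Hu (stage_pos s) s) as (_ & Y & _). apply le_INR in X. rewrite !mult_INR, !pow2_INR in X.
  unfold gain; cbn [fst snd].
  pose proof (pow2_pos (2 * stage_fst s)). pose proof (pow2_pos s). pose proof (pow2_pos (stage_snd s)).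
  set (F := 2 ^ (2 * stage_fst s)) in *. set (S' := 2 ^ s) in *. set (T := 2 ^ stage_snd s) in *.
  set (g := INR (gnum (stage_pos s) (stage_snd s))) in *. set (U := INR (u (stage_pos s) s)) in *.
  cbn [INR] in X. set (cc := c (stage_pos s) (S s)) in *.
  replace (2 / F * (gsum (recs (stage_fst s) (hist s)) + g / T) - 2 / F * gsum (recs (stage_fst s) (hist s)))
    with (2 * g / (F * T)) by (field; lra).
  apply Rmult_le_reg_r with (F * T * S'); [repeat apply Rmult_lt_0_compat; assumption|].
  replace (2 * g / (F * T) * (F * T * S')) with (2 * g * S') by (field; lra).
  assert (0 < F * T) by now apply Rmult_lt_0_compat. nra.
Qed.

(** Account [e] holds [2 * 4^-e] times the gains of requirement [e], hence at most
    [2 * 4^-e * (e + Om)], and [e + Om <= (1 + Om) * 2^e]. *)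
Lemma total_cost_le N : sum_f_R0 stage_cost N <= 2 * (2 * (1 + Om)).
Proof.
  apply (budget stage_cost (fun e s => 2 / 2 ^ (2 * e) * gsum (recs e (hist s))) stage_fst);
    try (intros e s; assert (0 < 2 / 2 ^ (2 * e)) by (apply Rdiv_lt_0_compat; [lra | apply pow2_pos])).
  - pose proof (gsum_ge0 (recs e (hist s))). nra.
  - pose proof (gsum_mono e s (S s) ltac:(lia)). nra.
  - pose proof (gsum_bound e s) as X. pose proof (unpair_snd_le e) as Y. apply le_INR in Y.
    assert (E2 : INR e <= 2 ^ e).
    { rewrite <- pow2_INR. apply le_INR. pose proof (Nat.pow_gt_lin_r 2 e). lia. }
    assert (E1 : 1 <= 2 ^ e) by (apply pow_R1_Rle; lra).
    replace (2 * (1 + Om) / 2 ^ e) with (2 / 2 ^ (2 * e) * ((1 + Om) * 2 ^ e)).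
    + apply Rmult_le_compat_l; [lra | nra].
    + replace (2 * e)%nat with (e + e)%nat by lia. rewrite pow_add. field. lra.
  - exact stage_fst_le.
  - exact stage_cost_le.
Qed.

(** * Each requirement acts finitely often *)

Lemma target_le e s i : (i < s)%nat ->
  (2 ^ (2 * e) * u (cpair e i) s < gnum (cpair e i) s)%nat ->
  (target e s <= i)%nat /\
  (2 ^ (2 * e) * u (cpair e (target e s)) s < gnum (cpair e (target e s)) s)%nat.
Proof.
  intros Hi Hg. unfold target.
  set (P := fun i => (2 ^ (2 * e) * u (cpair e i) s <? gnum (cpair e i) s)%nat).
  assert (L : forall n m, (m <= i < m + n)%nat ->
    (hd s (filter P (seq m n)) <= i)%nat /\ P (hd s (filter P (seq m n))) = true).
  { induction n as [|n IH]; intros m Hm; [lia|]. cbn [seq filter].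
    destruct (P m) eqn:E; cbn [hd]; [split; [lia | assumption]|].
    apply IH. assert (m <> i); [|lia]. intros ->. unfold P in E. apply Nat.ltb_ge in E. lia. }
  destruct (L s 0%nat ltac:(lia)) as [A B]. split; [exact A|]. now apply Nat.ltb_lt.
Qed.

Lemma qp_lim eps : 0 < eps -> exists N, forall n, (N <= n)%nat -> Om - qp n <= eps.
Proof.
  intro He. destruct (qlim eps He) as [N HN]. exists N. intros n Hn.
  specialize (HN n Hn). unfold Rdist in HN. apply Rabs_def2 in HN.
  pose proof (Rmax_l (q n) 0). lra.
Qed.

(** The strict inequality at [i] leaves a margin [eta]; the distance from [Omega_s] to its limit
    takes at most half of it and the rounding a quarter. That the target stays at or below [i] keeps
    the gains away from 0. *)
Lemma target_eventually e i :
  2 ^ (2 * e) * cl (cpair e i) < Om - qp (cpair e i) ->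
  exists N, forall s, (N <= s)%nat -> (target e s < s)%nat /\ (target e s <= i)%nat /\
    (2 ^ (2 * e) * u (cpair e (target e s)) s < gnum (cpair e (target e s)) s)%nat.
Proof.
  set (p := cpair e i). set (F := 2 ^ (2 * e)). intro Hi.
  set (eta := Om - qp p - F * cl p). assert (He : 0 < eta) by (unfold eta; lra).
  assert (HF : 0 < F) by apply pow2_pos.
  destruct (qp_lim (eta / 2)) as [N1 H1]; [lra|].
  destruct (pow2_small (eta / 4 / (3 * F + 2))) as [N2 H2]; [repeat apply Rdiv_lt_0_compat; lra|].
  exists (Nat.max (S i) (Nat.max N1 N2)). intros s Hs.
  assert (G : (2 ^ (2 * e) * u p s < gnum p s)%nat).
  { apply INR_lt. rewrite mult_INR, pow2_INR. fold F.
    destruct (Hu p s) as (_ & _ & U). pose proof (ccl p (S s)) as C.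
    pose proof (gain_lower p s) as GL. unfold gain in GL; cbn [fst snd] in GL.
    specialize (H1 s ltac:(lia)). specialize (H2 s ltac:(lia)).
    pose proof (pow2_pos s) as P2.
    assert (E : / 2 ^ s * 2 ^ s = 1) by (field; lra).
    assert (E3 : INR (gnum p s) = INR (gnum p s) / 2 ^ s * 2 ^ s) by (field; lra).
    assert (E4 : (3 * F + 2) * / 2 ^ s <= eta / 4).
    { apply Rmult_le_compat_l with (r := 3 * F + 2) in H2; [|lra].
      replace ((3 * F + 2) * (eta / 4 / (3 * F + 2))) with (eta / 4) in H2 by (field; lra). lra. }
    assert (U' : F * INR (u p s) <= (F * cl p + 3 * F * / 2 ^ s) * 2 ^ s).
    { replace ((F * cl p + 3 * F * / 2 ^ s) * 2 ^ s) with (F * (cl p * 2 ^ s + 3)) by (field; lra).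
      apply Rmult_le_compat_l; [lra|]. nra. }
    eapply Rle_lt_trans; [exact U'|]. rewrite E3. apply Rmult_lt_compat_r; [assumption|].
    unfold eta in *. lra. }
  destruct (target_le e s i ltac:(lia) G) as [A B]. repeat split; [lia | lia | exact B].
Qed.

Lemma gain_eventually p0 : 0 < Om - qp p0 ->
  exists N, forall t p, (N <= t)%nat -> (p <= p0)%nat -> Om - qp p <= 2 * gain (p, t).
Proof.
  intro H0. destruct (qp_lim ((Om - qp p0) / 4)) as [N1 H1]; [lra|].
  destruct (pow2_small ((Om - qp p0) / 8)) as [N2 H2]; [lra|].
  exists (Nat.max N1 N2). intros t p Ht Hp.
  specialize (H1 t ltac:(lia)). specialize (H2 t ltac:(lia)).
  pose proof (gain_lower p t). pose proof (Rmax0_mono q qmono p p0 Hp). lra.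
Qed.

Lemma cpair_le_r e i j : (i <= j)%nat -> (cpair e i <= cpair e j)%nat.
Proof.
  intro H. destruct (Nat.eq_dec i j) as [->|]; [reflexivity|].
  apply Nat.lt_le_incl, cpair_lt_r. lia.
Qed.

Definition eligible (e : nat) : Prop :=
  exists i, 2 ^ (2 * e) * cl (cpair e i) < Om - qp (cpair e i).

Lemma eligible_pos e i : 2 ^ (2 * e) * cl (cpair e i) < Om - qp (cpair e i) ->
  0 < Om - qp (cpair e i).
Proof.
  intro H. pose proof (c0 (cpair e i) 0). pose proof (ccl (cpair e i) 0).
  pose proof (pow2_pos (2 * e)). nra.
Qed.

(** The opponent stages used by flips of [e] increase strictly, so from some flip on they are late
    enough for a gain of at least [d / 2] at every position up to [cpair e i]. Infinitely many flips
    would exceed [gsum_bound]. *)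
Lemma finite_acts e : eligible e ->
  exists N, forall s, (N <= s)%nat -> stage_fst s = e -> act s (hist s) = false.
Proof.
  intros [i Hi]. apply NNPP. intro HN.
  assert (inf : forall N, exists s, (N <= s)%nat /\ stage_fst s = e /\ acts s (hist s)).
  { intro N. apply NNPP. intro H. apply HN. exists N. intros s Hs He.
    apply not_true_iff_false. intro Ha. apply H. exists s. rewrite <- act_spec. auto. }
  pose proof (eligible_pos e i Hi) as dpos. set (d := Om - qp (cpair e i)) in *.
  destruct (target_eventually e i Hi) as [N1 H1].
  destruct (gain_eventually (cpair e i) dpos) as [N2 H2].
  assert (step : forall s, stage_fst s = e -> acts s (hist s) ->
    recs e (hist (S s)) = (stage_pos s, stage_snd s) :: recs e (hist s)).
  { intros s He Ha. rewrite recs_S. apply act_spec in Ha. rewrite Ha, He, Nat.eqb_refl. reflexivity. }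
  assert (late : forall k, exists s r, In r (recs e (hist s)) /\ (k <= snd r)%nat).
  { induction k as [|k (s & r & Hr & Hk)].
    - destruct (inf 0%nat) as (s & _ & He & Ha). exists (S s), (stage_pos s, stage_snd s).
      rewrite (step s He Ha). split; [now left | lia].
    - destruct (inf s) as (s' & Hs & He & Ha). exists (S s'), (stage_pos s', stage_snd s').
      rewrite (step s' He Ha). split; [now left|]. cbn [snd].
      assert (Hr' : In r (recs (stage_fst s') (hist s'))).
      { rewrite He. clear - Hr Hs. induction Hs as [|s' Hs IH]; [assumption|].
        rewrite recs_S. destruct (_ && _); [now right | assumption]. }
      destruct (acts_recs _ _ Ha r Hr'). lia. }
  destruct (late N2) as (s0 & r0 & Hr0 & Ht0).
  assert (keep : forall s, (s0 <= s)%nat -> In r0 (recs e (hist s))).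
  { intros s Hs. induction Hs as [|s Hs IH]; [assumption|].
    rewrite recs_S. destruct (_ && _); [now right | assumption]. }
  assert (grow : forall k, exists s, INR k * (d / 2) <= gsum (recs e (hist s))).
  { induction k as [|k [s Hk]].
    - exists 0%nat. cbn. lra.
    - destruct (inf (Nat.max s (Nat.max s0 N1))) as (s' & Hs & He & Ha). exists (S s').
      rewrite (step s' He Ha). cbn [gsum fold_right]. fold (gsum (recs e (hist s'))).
      pose proof (gsum_mono e s s' ltac:(lia)). rewrite S_INR.
      specialize (keep s' ltac:(lia)). rewrite <- He in keep.
      destruct (acts_recs _ _ Ha r0 keep) as [Ht _].
      destruct (H1 s' ltac:(lia)) as (_ & Htar & _).
      assert (Hp : (stage_pos s' <= cpair e i)%nat) by (unfold stage_pos; rewrite He; now apply cpair_le_r).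
      specialize (H2 (stage_snd s') (stage_pos s') ltac:(lia) Hp).
      pose proof (Rmax0_mono q qmono _ _ Hp). unfold d in *. lra. }
  destruct (INR_unbounded ((INR (snd (unpair e)) + Om) / (d / 2))) as [k Hk].
  destruct (grow k) as [s Hs]. pose proof (gsum_bound e s).
  apply Rmult_lt_compat_r with (r := d / 2) in Hk; [|lra].
  replace ((INR (snd (unpair e)) + Om) / (d / 2) * (d / 2)) with (INR (snd (unpair e)) + Om) in Hk
    by (field; lra). lra.
Qed.

Lemma bit_converges x : eligible (fst (unpair x)) ->
  exists N, forall s, (N <= s)%nat -> bit (hist s) x = bit (hist N) x.
Proof.
  intro He. destruct (finite_acts _ He) as [N HN]. exists N. intros s Hs.
  induction Hs as [|s Hs IH]; [reflexivity|]. rewrite bit_S, <- IH.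
  destruct (act s (hist s)) eqn:E; [|apply xorb_false_l].
  destruct (Nat.eqb_spec (stage_pos s) x) as [Ex|]; [|apply xorb_false_l].
  rewrite HN in E; [discriminate | assumption |]. now rewrite <- stage_pos_owner, Ex.
Qed.

(** The rounded cost [u] is never 0, so the gain condition forces a positive gain; [opponent_pays]
    starts from that. *)
Lemma acts_gnum s H : acts s H -> (0 < gnum (stage_pos s) (stage_snd s))%nat.
Proof.
  intro Ha. pose proof (acts_gain _ _ Ha) as X. destruct (Hu (stage_pos s) s) as [Y _].
  assert (0 < 2 ^ (2 * stage_fst s) * u (stage_pos s) s * 2 ^ stage_snd s)%nat.
  { pose proof (Nat.pow_nonzero 2 (2 * stage_fst s)). pose proof (Nat.pow_nonzero 2 (stage_snd s)).
    repeat apply Nat.mul_pos_pos; lia. }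
  destruct (gnum (stage_pos s) (stage_snd s)); lia.
Qed.

(** * The opponent pays for every flip but the last *)

Section Opponent.
Context (code_o : code) (As : nat -> nat -> bool) (f : nat -> R) (B : R)
  (HAs : forall s x, eval0 code_o (cpair s x) (if As s x then 1%nat else 0%nat))
  (Hf : forall t, stage_cost_is (cOmega q) As t (f t)) (HB : forall N, sum_f_R0 f N <= B).

Definition psum (n : nat) : R := nat_rect (fun _ => R) 0 (fun k r => r + f k) n.

Lemma f_ge0 t : 0 <= f t.
Proof.
  destruct (Hf t) as [(x & _ & _ & ->)|[_ ->]]; [|lra].
  unfold cOmega. destruct (Nat.ltb_spec x (S t)); [|lra].
  pose proof (seq_mono q qmono x (S t) ltac:(lia)). lra.
Qed.

Lemma psum_mono s t : (s <= t)%nat -> psum s <= psum t.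
Proof. apply (seq_mono psum). intro n. change (psum (S n)) with (psum n + f n). pose proof (f_ge0 n). lra. Qed.

Lemma psum_le n : psum n <= B.
Proof.
  destruct n as [|n].
  - cbn. specialize (HB 0%nat). cbn in HB. pose proof (f_ge0 0). lra.
  - assert (psum (S n) = sum_f_R0 f n) as ->; [|apply HB].
    induction n as [|n IH]; [cbn; lra|]. cbn [sum_f_R0]. rewrite <- IH. reflexivity.
Qed.

(** Some change in between affects [p]; its least position [x] is at most [p], so it costs at least
    [Omega_t - Omega_p]. A positive gain gives [p < t], so this cost is not set to 0, and excludes
    that [Omega_t] is cut at 0. *)
Lemma opponent_pays p t t' : (t < t')%nat -> As t p <> As t' p -> (0 < gnum p t)%nat ->
  psum t + gain (p, t) <= psum t'.
Proof.
  intros Ht Hne Hg. destruct (gain_upper p t Hg) as [Hpt G].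
  assert (X : exists v, (t <= v < t')%nat /\ As v p <> As (S v) p).
  { apply NNPP. intro N. apply Hne. clear - N Ht.
    assert (E : forall k, (t + k <= t')%nat -> As t p = As (t + k) p).
    { induction k as [|k IH]; intro Hk; [now rewrite Nat.add_0_r|].
      rewrite IH by lia. replace (t + S k)%nat with (S (t + k)) by lia.
      apply NNPP. intro D. apply N. exists (t + k)%nat. split; [lia | assumption]. }
    rewrite (E (t' - t)%nat) by lia. f_equal. lia. }
  destruct X as (v & Hv & Hd).
  assert (FV : gain (p, t) <= f v).
  { destruct (Hf v) as [(x & Hx & Hlt & ->)|[Heq _]]; [|now destruct Hd].
    assert (x <= p)%nat by (apply Nat.nlt_ge; intro L; apply Hd, (Hlt p L)).
    unfold cOmega. rewrite (proj2 (Nat.ltb_lt x (S v))) by lia.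
    pose proof (seq_mono q qmono x p ltac:(lia)). pose proof (seq_mono q qmono t (S v) ltac:(lia)).
    pose proof (Rmax_l (q p) 0). pose proof (Rmax_r (q p) 0).
    assert (0 < gain (p, t)).
    { unfold gain; cbn [fst snd]. apply Rdiv_lt_0_compat; [now apply lt_0_INR | apply pow2_pos]. }
    destruct (Rle_dec (q t) 0); [rewrite (Rmax_right (q t)) in G by assumption
      | rewrite (Rmax_left (q t)) in G by lra]; lra. }
  pose proof (psum_mono t v ltac:(lia)). pose proof (psum_mono (S v) t' ltac:(lia)) as M.
  change (psum (S v)) with (psum v + f v) in M. lra.
Qed.

Lemma agree_sound m s t H y : agree s (cpair (gcode code_o) m) t H y = true -> As t y = bit H y.
Proof.
  unfold agree. rewrite unpair_cpair. cbn [fst]. intro E. apply Nat.eqb_eq in E.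
  apply (run_sound (fun _ => false)) in E; [|apply falses_prefix].
  pose proof (eval_fun _ _ _ _ (HAs t y) _ E) as X. now destruct (As t y), (bit H y).
Qed.

(* Between two consecutive flips the opponent had to follow the earlier one. *)
Lemma opponent_invariant m s :
  let e := cpair (gcode code_o) m in
  match recs e (hist s) with
  | [] => True
  | r :: l => gsum l <= psum (snd r) /\ As (snd r) (fst r) = negb (bit (hist s) (fst r)) /\
      (0 < gnum (fst r) (snd r))%nat /\ fst (unpair (fst r)) = e
  end.
Proof.
  intro e. induction s as [|s IH]; [exact I|]. rewrite recs_S.
  destruct (act s (hist s)) eqn:E; [destruct (Nat.eqb_spec (stage_fst s) e) as [He|He]|]; cbn [andb].
  - apply act_spec in E as Ha. cbn [fst snd].
    split; [|split; [|split; [now apply acts_gnum with (hist s) | now rewrite stage_pos_owner]]].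
    + destruct (recs e (hist s)) as [|r l] eqn:Er; [exact (psum_mono 0 (stage_snd s) (Nat.le_0_l _))|].
      destruct IH as (H1 & H2 & H3 & _). cbn [gsum fold_right]. fold (gsum l).
      (* The opponent had the unflipped bit of [r] at stage [snd r] and has the flipped one at
         [stage_snd s], so the gain of [r] was paid in between. *)
      assert (Hr : In r (recs (stage_fst s) (hist s))) by (rewrite He, Er; now left).
      destruct (acts_recs _ _ Ha r Hr) as [Ht Hag]. rewrite He in Hag.
      apply agree_sound in Hag. destruct r as [p t]; cbn [fst snd] in *.
      pose proof (opponent_pays p t (stage_snd s) Ht) as P.
      rewrite Hag, H2 in P. specialize (P (no_fixpoint_negb _) H3). lra.
    + pose proof (acts_agree _ _ Ha) as Hag. rewrite He in Hag. apply agree_sound in Hag.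
      now rewrite bit_S, E, Nat.eqb_refl, Hag, negb_involutive.
  - destruct (recs e (hist s)) as [|r l]; [exact I|]. destruct IH as (H1 & H2 & H3 & H4).
    repeat split; try assumption. rewrite bit_S, E. cbn [andb].
    rewrite (proj2 (Nat.eqb_neq (stage_pos s) (fst r))); [now rewrite xorb_false_l|].
    intro X. apply He. now rewrite <- stage_pos_owner, X.
  - destruct (recs e (hist s)) as [|r l]; [exact I|]. rewrite bit_S, E. cbn [andb].
    now rewrite xorb_false_l.
Qed.

Lemma opponent_gsum m s : gsum (recs (cpair (gcode code_o) m) (hist s)) <= B + Om.
Proof.
  pose proof (opponent_invariant m s) as X. cbn zeta in X.
  destruct (recs _ _) as [|r l]; [pose proof (psum_le 0 : 0 <= B); cbn; lra|]. destruct X as [X _].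
  pose proof (psum_le (snd r)). pose proof (gain_le_Om r). cbn [gsum fold_right]. fold (gsum l). lra.
Qed.

Lemma opponent_defeated A : (forall e, eligible e) ->
  (forall x, exists s0, forall s, (s0 <= s)%nat -> As s x = A x) ->
  (forall x, exists s0, forall s, (s0 <= s)%nat -> bit (hist s) x = A x) -> False.
Proof.
  intros Hel HA HH.
  (* With [m] above the bound of [opponent_gsum] the requirement never reaches its amount, so its
     last condition always permits a flip. *)
  destruct (INR_unbounded (B + Om)) as [m Hm].
  set (e := cpair (gcode code_o) m). destruct (Hel e) as [i Hi].
  destruct (finite_acts e (Hel e)) as [N0 H0].
  destruct (target_eventually e i Hi) as [N1 H1].
  pose proof (eligible_pos e i Hi) as dpos.
  destruct (gain_eventually (cpair e i) dpos) as [N2 H2].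
  (* All positions where agreement can be demanded: those flipped by [e], which are final after
     [N0], and the possible targets. *)
  set (pos := map fst (recs e (hist N0)) ++ map (cpair e) (seq 0 (S i))).
  destruct (eventually_list _ (fun x n => As n x = A x) pos (fun x _ => HA x)) as [N3 H3].
  destruct (eventually_list _ (fun x n => bit (hist n) x = A x) pos (fun x _ => HH x)) as [N4 H4].
  (* [N0] puts [T] after the opponent stages of all recorded flips, [N2] makes the gain at [T] at
     least half of its limit, and [N3] lets the opponent settle on [pos]. *)
  set (T := Nat.max N0 (Nat.max N2 N3)).
  destruct (eventually_list _ (fun x n => run (falses n) (gcode code_o) (cpair T x) =
    S (if As T x then 1 else 0)) pos) as [N5 H5].
  { intros x _. now apply run_falses_complete. }
  set (s := cpair (cpair e T) (Nat.max N0 (Nat.max N1 (Nat.max N4 N5)))).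
  assert (Hs : (Nat.max N0 (Nat.max N1 (Nat.max N4 N5)) <= s)%nat)
    by (pose proof (cpair_le_add (cpair e T) (Nat.max N0 (Nat.max N1 (Nat.max N4 N5)))); unfold s; lia).
  assert (Ee : stage_fst s = e) by (unfold stage_fst, s; rewrite unpair_cpair; cbn [fst]; now rewrite unpair_cpair).
  assert (Et : stage_snd s = T) by (unfold stage_snd, s; rewrite unpair_cpair; cbn [fst]; now rewrite unpair_cpair).
  assert (Er : recs e (hist s) = recs e (hist N0)).
  { assert (N0 <= s)%nat as L by lia. clear - H0 L. clearbody e s. induction L as [|s L IH]; [reflexivity|].
    rewrite recs_S, <- IH. destruct (Nat.eqb_spec (stage_fst s) e) as [E|]; [|now rewrite andb_false_r].
    now rewrite H0. }
  assert (Hag : forall x, In x pos -> agree s e T (hist s) x = true).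
  { intros x Hx. unfold agree, e. rewrite unpair_cpair. cbn [fst]. apply Nat.eqb_eq.
    rewrite (H5 s ltac:(lia) x Hx), (H3 T ltac:(lia) x Hx), (H4 s ltac:(lia) x Hx). reflexivity. }
  destruct (H1 s ltac:(lia)) as (Ht1 & Ht2 & Ht3).
  assert (Hp : In (stage_pos s) pos).
  { apply in_or_app. right. unfold stage_pos. rewrite Ee. apply in_map, in_seq. lia. }
  assert (Ha : acts s (hist s)).
  { constructor; rewrite ?Ee, ?Et.
    - exact Ht1.
    - intros r Hr. rewrite Er in Hr. split.
      + apply recs_in in Hr as [Hr _]. apply hist_time in Hr. lia.
      + apply Hag, in_or_app. left. now apply in_map.
    - now apply Hag.
    - apply INR_le. rewrite !mult_INR, !pow2_INR. cbn [INR].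
      fold (stage_pos s) in *. replace (cpair e (target e s)) with (stage_pos s) in Ht3
        by (unfold stage_pos; now rewrite Ee).
      assert (G : (0 < gnum (stage_pos s) s)%nat) by lia.
      destruct (gain_upper _ _ G) as [_ GU]. pose proof (qp_le_Om s).
      assert (Hpi : (stage_pos s <= cpair e i)%nat) by (unfold stage_pos; rewrite Ee; now apply cpair_le_r).
      specialize (H2 T (stage_pos s) ltac:(lia) Hpi).
      apply lt_INR in Ht3. rewrite mult_INR, pow2_INR in Ht3.
      unfold gain in GU, H2; cbn [fst snd] in GU, H2.
      pose proof (pow2_pos s). pose proof (pow2_pos T).
      assert (X1 : INR (gnum (stage_pos s) s) = INR (gnum (stage_pos s) s) / 2 ^ s * 2 ^ s) by (field; lra).
      assert (X2 : INR (gnum (stage_pos s) T) = INR (gnum (stage_pos s) T) / 2 ^ T * 2 ^ T) by (field; lra).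
      rewrite X2. rewrite X1 in Ht3.
      set (g1 := INR (gnum (stage_pos s) s) / 2 ^ s) in *. set (g2 := INR (gnum (stage_pos s) T) / 2 ^ T) in *.
      replace ((1 + 1) * (g2 * 2 ^ T) * 2 ^ s) with (2 * g2 * 2 ^ s * 2 ^ T) by ring.
      apply Rmult_le_compat_r; [lra|]. eapply Rle_trans; [apply Rlt_le, Ht3|].
      apply Rmult_le_compat_r; lra.
    - apply INR_lt. rewrite gsum_num by (intros r Hr; apply recs_in in Hr as [Hr _]; now apply hist_time).
      rewrite mult_INR, pow2_INR. apply Rmult_lt_compat_r; [apply pow2_pos|].
      pose proof (opponent_gsum m s) as X. fold e in X. unfold e at 2. rewrite unpair_cpair. cbn [snd]. lra. }
  apply act_spec in Ha. rewrite H0 in Ha; [discriminate | lia | assumption].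
Qed.
End Opponent.
End Diagonal.

Open Scope R_scope.

(** * From the implication of costs to the inequality of their limits *)

Section Domination.
Context (Z : nat -> bool) (Om : R) (q : nat -> R) (Qf : nat -> nat -> nat)
  (c : nat -> nat -> R) (cl : nat -> R)
  (HZ : ML_random Z) (HOm : binary_value Z Om)
  (qmono : forall s, q s <= q (S s)) (qlim : Un_cv q Om)
  (HQf : forall s k, INR (Qf s k) <= Rmax (q s) 0 * 2 ^ k < INR (Qf s k) + 1)
  (CQ : Computable (fun p => Qf (fst p) (snd p)))
  (Hc : cost_function c) (Hcl : forall x, climit c x (cl x)).
Local Notation qp s := (Rmax (q s%nat) 0).

Lemma binary_value_ge0 : 0 <= Om.
Proof.
  pose proof (binary_value_bounds Z Om 0 HOm) as [H _]. cbn in H. lra.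
Qed.

Lemma cost_le_limit x s : c x s <= cl x.
Proof.
  destruct Hc as (_ & _ & cmono & _). apply (lim_ge _ _ _ s (Hcl x)).
  intros n Hn. apply (seq_mono (c x)); auto.
Qed.

Lemma cost_antitone x y s : (x <= y)%nat -> c y s <= c x s.
Proof.
  destruct Hc as (_ & _ & _ & canti & _). intro H. induction H; [lra|].
  eapply Rle_trans; [apply canti | assumption].
Qed.

Lemma limit_antitone x y : (x <= y)%nat -> cl y <= cl x.
Proof.
  intro H. apply (lim_le _ _ _ 0%nat (Hcl y)). intros n _.
  apply Rle_trans with (c x n); [now apply cost_antitone | apply cost_le_limit].
Qed.

Lemma limit_le (x : R) y : (forall eps, 0 < eps -> x <= y + eps) -> x <= y.
Proof. intro H. apply Rnot_lt_le. intro L. specialize (H ((x - y) / 2)). lra. Qed.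

(** Kucera-Slaman with the subsequence at [cpair e s] as approximation of [Om], and with [Omega_s]
    itself, rounded down to a multiple of [2^-s], as the increasing sequence [a s / 2^s]; then [t]
    tends to infinity. *)
Lemma omega_reindex e : exists D, 0 < D /\
  forall x, Om - qp x <= D * (Om - qp (cpair e x)).
Proof.
  pose proof binary_value_ge0 as Om0.
  assert (qpOm : forall s, qp s <= Om) by (intro; now apply qp_le_Om).
  destruct (kucera_slaman Z Om (fun s => qp (cpair e s)) (fun s k => Qf (cpair e s) k)
    (fun s => Qf s s) Om HZ HOm) as (D & HD & H).
  - intro s. apply qpOm.
  - intros s k. apply HQf.
  - apply (comp_comp2 Qf); comp.
  - apply (comp_comp2 Qf); comp.
  - intro s. apply Nat.lt_succ_r, INR_lt. rewrite S_INR, mult_INR. cbn [INR].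
    pose proof (HQf s s). pose proof (HQf (S s) (S s)). pose proof (pow2_pos s).
    pose proof (Rmax0_mono q qmono s (S s) ltac:(lia)). cbn [pow] in *. nra.
  - intro s. pose proof (HQf s s). pose proof (qpOm s). pose proof (pow2_pos s). nra.
  - exists D. split; [assumption|]. intro x. apply limit_le. intros eps He.
    destruct (qp_lim q Om qlim (eps / 2) ltac:(lra)) as [N1 H1].
    destruct (pow2_small (eps / 2) ltac:(lra)) as [N2 H2].
    set (t := Nat.max x (Nat.max N1 N2)).
    specialize (H x t ltac:(lia)). specialize (H1 t ltac:(lia)). specialize (H2 t ltac:(lia)).
    pose proof (HQf t t) as T. pose proof (HQf x x) as X.
    pose proof (pow2_pos t). pose proof (pow2_pos x).
    assert (INR (Qf x x) / 2 ^ x <= qp x) by (apply div_le_iff; lra).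
    assert (qp t - / 2 ^ t <= INR (Qf t t) / 2 ^ t).
    { apply Rmult_le_reg_r with (2 ^ t); [assumption|].
      replace (INR (Qf t t) / 2 ^ t * 2 ^ t) with (INR (Qf t t)) by (field; lra).
      replace ((qp t - / 2 ^ t) * 2 ^ t) with (qp t * 2 ^ t - 1) by (field; lra). lra. }
    lra.
Qed.

(** If requirement [e] had no good position, [4^e * cl] would bound the gap to [Om] on row [e]; by
    [omega_reindex] and [cl (cpair e x) <= cl x] a multiple of [cl] would bound it everywhere. *)
Lemma not_dominated_eligible :
  ~ (exists C, 0 < C /\ forall x, Om - qp x <= C * cl x) -> forall e, eligible q Om cl e.
Proof.
  intros ND e. apply NNPP. intro NE. apply ND.
  destruct (omega_reindex e) as (D & HD & H). exists (D * 2 ^ (2 * e)).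
  pose proof (pow2_pos (2 * e)) as P. split; [now apply Rmult_lt_0_compat|]. intro x.
  eapply Rle_trans; [apply H|]. rewrite Rmult_assoc. apply Rmult_le_compat_l; [lra|].
  apply Rle_trans with (2 ^ (2 * e) * cl (cpair e x)).
  - apply Rnot_lt_le. intro L. apply NE. now exists x.
  - apply Rmult_le_compat_l; [lra|]. apply limit_antitone.
    pose proof (cpair_le_add e x). lia.
Qed.

Lemma cost_implies_dominates : cost_implies c (cOmega q) ->
  exists C, 0 < C /\ forall x, Om - qp x <= C * cl x.
Proof.
  intro CI. apply NNPP. intro ND. pose proof (not_dominated_eligible ND) as Hel.
  pose proof binary_value_ge0 as Om0.
  destruct Hc as (Hcomp & c0 & _).
  destruct (cost_upper c Hcomp c0) as (u & Cu & Hu).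
  assert (conv : forall x, exists N, forall s, (N <= s)%nat ->
    bit (hist Qf u s) x = bit (hist Qf u N) x).
  { intro x. apply (bit_converges Qf u q Om c cl); auto. apply cost_le_limit. }
  set (A := fun x => bit (hist Qf u (proj1_sig (constructive_indefinite_description _ (conv x)))) x).
  assert (HA : forall x, exists N, forall s, (N <= s)%nat -> bit (hist Qf u s) x = A x).
  { intro x. unfold A. destruct (constructive_indefinite_description _ (conv x)) as [N HN].
    exists N. exact HN. }
  assert (Ap : comp_approx A (fun s => bit (hist Qf u s))).
  { split; [|exact HA].
    assert (C : Computable (fun p => bit (hist Qf u (fst p)) (snd p))).
    { pose proof (comp_hist Qf u _ CQ Cu) as Ch. apply comp_bit; comp. }
    destruct C as [e He]. exists e. intros s x. exact (He _ I (s, x)). }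
  destruct (CI A) as (As & [[e He] HAs] & f & B & Hf & HB).
  - now exists (fun s => bit (hist Qf u s)).
  - exists (fun s => bit (hist Qf u s)). split; [exact Ap|].
    exists (stage_cost Qf u c), (2 * (2 * (1 + Om))). split.
    + intro t. apply stage_cost_spec.
    + intro N. apply (total_cost_le Qf u q Om c); auto.
  - apply (opponent_defeated Qf u q Om c cl qmono qlim Om0 HQf c0 cost_le_limit Hu
      e As f B He Hf HB A Hel HAs HA).
Qed.
End Domination.

(** * Captured oracles compute the set *)

Open Scope nat_scope.

Lemma comp_restr {A} `{Enc A} (Y : nat -> bool) (n : A -> nat) :
  Comp (eq Y) n -> Comp (eq Y) (fun x => restr Y (n x)).
Proof.
  intro Hn. unfold restr.
  assert (HY : Comp (eq Y) Y).
  { exists cOracle. intros O <- a. cbn. constructor. }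
  comp.
Qed.

Lemma run_falses_mono s t e x y : s <= t -> run (falses s) e x = S y -> run (falses t) e x = S y.
Proof.
  intros L E. destruct (restr_app (fun _ => false) s t L) as [r Hr].
  unfold falses. unfold restr in Hr. rewrite Hr. now apply run_app.
Qed.

(** * Parts of a bounded test with known measure *)

Section CaptureComputes.
Context (c : nat -> nat -> R) (u : nat -> nat -> nat) (e K M : nat) (en : nat -> nat).

(** The component is cut in time and in string length by the same [r], so each stage is clopen and
    can be counted. *)
Definition open_stage (y r : nat) (s : list bool) : bool :=
  existsb (fun m => negb (run (falses r) e (cpair y (scode (firstn m s))) =? 0)) (seq 0 (S r)).
(** Subtracting 3 turns the upper bound [u] into a lower bound of [2^r' * c y (S r')], so the bound
    certified at [r'] remains valid as the cost grows. *)
Definition affordable (y r r' : nat) : bool :=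
  cnt (open_stage y r) r * 2 ^ r' <=? K * (u y r' - 3) * 2 ^ r.
(* The part of the [y]-th component whose measure is known at stage [t] to be at most
   [K c(y, t + 1)]. *)
Definition open_cut (y t : nat) (s : list bool) : bool :=
  existsb (fun r => existsb (affordable y r) (seq 0 (S t)) && open_stage y r s) (seq 0 (S t)).
Definition solovay (t : nat) (s : list bool) : bool :=
  if en t =? 0 then false else open_cut (pred (en t)) t s.
(** The strings that already lie in [M * 2^n] of the Solovay events; by Markov's inequality their
    measure is at most [2^-n] once [M] exceeds the total measure of the events. *)
Definition solovay_test (p : nat * list bool) : bool :=
  M * 2 ^ fst p <=? length (filter (fun t => solovay t (snd p)) (seq 0 (length (snd p)))).

Lemma comp_open_cut {Q A} `{Enc A} (y t : A -> nat) (s : A -> list bool) :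
  Comp Q (fun p => u (fst p) (snd p)) -> Comp Q y -> Comp Q t -> Comp Q s ->
  Comp Q (fun x => open_cut (y x) (t x) (s x)).
Proof.
  intros Hu Hy Ht Hs.
  assert (Ho : forall B `{Enc B} (y r : B -> nat) (s : B -> list bool), Comp Q y -> Comp Q r ->
    Comp Q s -> Comp Q (fun x => open_stage (y x) (r x) (s x))).
  { intros. unfold open_stage. comp. }
  assert (Ha : forall B `{Enc B} (y r r' : B -> nat), Comp Q y -> Comp Q r -> Comp Q r' ->
    Comp Q (fun x => affordable (y x) (r x) (r' x))).
  { intros. unfold affordable. apply comp_leb.
    - apply comp_mul; [|comp]. apply comp_cnt; [apply Ho; comp | comp].
    - apply comp_mul; [|comp]. apply comp_mul; [comp|]. apply comp_sub; [|comp].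
      apply (comp_comp2 u); comp. }
  unfold open_cut. apply comp_existsb; [|comp]. apply comp_andb; [|apply Ho; comp].
  apply comp_existsb; [apply Ha; comp | comp].
Qed.

Lemma comp_solovay_test : Computable (fun p => u (fst p) (snd p)) -> Computable en ->
  Computable solovay_test.
Proof.
  intros Hu He. unfold solovay_test, solovay.
  apply comp_leb; [comp|]. apply comp_length, comp_filter; [|comp].
  apply comp_if; [comp | comp | apply comp_open_cut; comp].
Qed.

Lemma firstn_firstn_le (s : list bool) m r : m <= r -> firstn m (firstn r s) = firstn m s.
Proof. intro H. rewrite firstn_firstn. f_equal. lia. Qed.

Lemma existsb_ext_in (T : Type) (f g : T -> bool) l :
  (forall x, In x l -> f x = g x) -> existsb f l = existsb g l.
Proof.
  induction l as [|x l IH]; intro H; [reflexivity|]. cbn. rewrite H by now left.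
  f_equal. apply IH. intros; apply H; now right.
Qed.

Lemma open_stage_firstn y r n s : r <= n -> open_stage y r (firstn n s) = open_stage y r s.
Proof.
  intro Hr. apply existsb_ext_in. intros m Hm. apply in_seq in Hm.
  now rewrite firstn_firstn_le by lia.
Qed.

Lemma open_cut_firstn y t n s : t <= n -> open_cut y t (firstn n s) = open_cut y t s.
Proof.
  intro Hr. apply existsb_ext_in. intros m Hm. apply in_seq in Hm.
  now rewrite open_stage_firstn by lia.
Qed.

Lemma open_stage_mono y r r' s : r <= r' -> open_stage y r s = true -> open_stage y r' s = true.
Proof.
  intros L. unfold open_stage. rewrite !existsb_exists. intros (m & Hm & E).
  exists m. rewrite in_seq in *. split; [lia|].
  destruct (run (falses r) e _) as [|v] eqn:Er; [discriminate|].
  now rewrite (run_falses_mono r r' _ _ _ L Er).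
Qed.

Lemma open_cut_mono y t t' s : t <= t' -> open_cut y t s = true -> open_cut y t' s = true.
Proof.
  intro L. unfold open_cut. rewrite !existsb_exists. intros (r & Hr & E). exists r.
  rewrite in_seq in *. split; [lia|]. rewrite andb_true_iff, existsb_exists in *.
  destruct E as [(r' & Hr' & E) E']. split; [|assumption]. exists r'. rewrite in_seq in *.
  split; [lia | assumption].
Qed.

Open Scope R_scope.
Context (cl : nat -> R)
  (Hcost : cost_function c) (Hcl : forall x, climit c x (cl x)) (clpos : forall x, 0 < cl x)
  (Hu : forall x s, (2 <= u x s)%nat /\ c x (S s) * 2 ^ s <= INR (u x s) <= c x (S s) * 2 ^ s + 3).

Lemma u_lower y r : c y (S r) * 2 ^ r - 3 <= INR (u y r - 3) <= c y (S r) * 2 ^ r.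
Proof.
  destruct (Hu y r) as (_ & H1 & H2). destruct Hcost as (_ & c0 & _).
  pose proof (c0 y (S r)). pose proof (pow2_pos r).
  assert (0 <= c y (S r) * 2 ^ r) by (apply Rmult_le_pos; lra).
  destruct (le_lt_dec 3 (u y r)) as [L|L].
  - rewrite minus_INR by assumption. cbn [INR]. lra.
  - replace (u y r - 3)%nat with 0%nat by lia. apply lt_INR in L. cbn [INR] in *. lra.
Qed.

Lemma affordable_le y r r' t : (r <= t)%nat -> (r' <= t)%nat -> affordable y r r' = true ->
  INR (cnt (open_stage y r) t) <= INR K * c y (S t) * 2 ^ t.
Proof.
  intros Hr Hr' Ha. apply Nat.leb_le, le_INR in Ha. rewrite !mult_INR, !pow2_INR in Ha.
  assert (E : cnt (open_stage y r) t = (cnt (open_stage y r) r * 2 ^ (t - r))%nat).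
  { rewrite <- cnt_firstn_le by assumption.
    apply Nat.le_antisymm; apply cnt_mono; intros s _; now rewrite open_stage_firstn. }
  rewrite E, mult_INR, pow2_INR.
  destruct (u_lower y r') as [_ UL]. destruct Hcost as (_ & c0 & cm & _).
  assert (CM : c y (S r') <= c y (S t)) by (apply (seq_mono (c y)); auto; lia).
  pose proof (pow2_pos r). pose proof (pow2_pos r'). pose proof (pow2_pos (t - r)).
  assert (X : INR (cnt (open_stage y r) r) <= INR K * c y (S t) * 2 ^ r).
  { apply Rmult_le_reg_r with (2 ^ r'); [assumption|]. eapply Rle_trans; [exact Ha|].
    replace (INR K * c y (S t) * 2 ^ r * 2 ^ r') with (INR K * (c y (S t) * 2 ^ r') * 2 ^ r) by ring.
    apply Rmult_le_compat_r; [lra|]. apply Rmult_le_compat_l; [apply pos_INR|]. nra. }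
  replace (2 ^ t) with (2 ^ r * 2 ^ (t - r)) by (rewrite <- pow_add; f_equal; lia).
  rewrite <- Rmult_assoc. apply Rmult_le_compat_r; lra.
Qed.

(** The stages of a component are nested, so the union of the affordable ones is the last of
    them. *)
Lemma open_cut_measure y t : INR (cnt (open_cut y t) t) <= INR K * c y (S t) * 2 ^ t.
Proof.
  unfold open_cut.
  set (G := fun r => existsb (affordable y r) (seq 0 (S t))).
  assert (L : forall n, (n <= S t)%nat ->
    INR (cnt (fun s => existsb (fun r => G r && open_stage y r s) (seq 0 n)) t)
      <= INR K * c y (S t) * 2 ^ t).
  { induction n as [|n IH]; intro Hn.
    - cbn [seq existsb]. rewrite cnt_false. cbn [INR]. destruct Hcost as (_ & c0 & _).
      repeat apply Rmult_le_pos; [apply pos_INR | auto | apply Rlt_le, pow2_pos].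
    - destruct (G n) eqn:E.
      + unfold G in E. apply existsb_exists in E as (r' & Hr' & E). apply in_seq in Hr'.
        eapply Rle_trans; [|apply (affordable_le y n r' t); [lia | lia | exact E]].
        apply le_INR, cnt_mono. intros s _ H. apply existsb_exists in H as (r & Hr & H).
        apply in_seq in Hr. apply andb_true_iff in H as [_ H].
        apply open_stage_mono with r; [lia | assumption].
      + eapply Rle_trans; [|apply IH; lia]. apply le_INR, cnt_mono. intros s _ H.
        rewrite seq_S, existsb_app in H. cbn [existsb Nat.add] in H. rewrite E in H.
        cbn [andb] in H. now rewrite !orb_false_r in H. }
  apply L. lia.
Qed.
End CaptureComputes.

Open Scope R_scope.

(** * Reading the set off a captured oracle *)

Section Captured.
Context (c : nat -> nat -> R) (u : nat -> nat -> nat) (cl : nat -> R) (B C : R)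
  (en : nat -> nat) (A Y : nat -> bool) (e : code)
  (Hcost : cost_function c) (Hcl : forall x, climit c x (cl x)) (clpos : forall x, 0 < cl x)
  (Cu : forall Q, Comp Q (fun p => u (fst p) (snd p)))
  (Hu : forall x s, (2 <= u x s)%nat /\ c x (S s) * 2 ^ s <= INR (u x s) <= c x (S s) * 2 ^ s + 3)
  (Cen : forall Q, Comp Q en) (HA : forall x, A x = true <-> exists t, en t = S x)
  (HB : forall N, sum_f_R0 (fun t => if en t =? 0 then 0 else c (pred (en t)) (S t)) N <= B)
  (He : forall n, measure_le e n (C * cl n)).
Local Notation g := (gcode e).

Lemma open_stage_measure y r : INR (cnt (open_stage g y r) r) <= C * cl y * 2 ^ r.
Proof.
  set (l := filter (fun s => negb (run (falses r) g (cpair y (scode s)) =? 0)%nat)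
    (flat_map all_strings (seq 0 (S r)))).
  eapply Rle_trans; [|apply (measure_le_elim e y (C * cl y) l r (He y))].
  - apply le_INR, cnt_mono. intros s Hs H. apply existsb_exists in H as (m & Hm & E).
    apply in_seq in Hm. apply covers_spec. exists (firstn m s).
    rewrite length_firstn. split; [|split; [lia|]].
    + apply filter_In. split; [|assumption]. apply in_flat_map. exists m.
      rewrite in_seq, in_all_strings, length_firstn. lia.
    + replace (Nat.min m (length s)) with m by lia. reflexivity.
  - intros s Hs. apply filter_In in Hs as [_ E].
    destruct (run (falses r) g _) as [|v] eqn:Er; [discriminate|].
    exists v. now apply (run_sound _ _ _ _ _ (falses_prefix r)) in Er.
  - intros s Hs. apply filter_In in Hs as [Hs _]. apply in_flat_map in Hs as (m & Hm & Hs).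
    apply in_seq in Hm. apply in_all_strings in Hs. lia.
Qed.

(** The component has measure at most [C * cl y], so with [K >= C + 1] and [cl y > 0] each of its
    stages becomes affordable once [c y (S r')] is close enough to its limit. *)
Lemma open_cut_complete K y : C + 1 <= INR K -> in_open e y Y ->
  exists N, forall s, (N <= s)%nat -> open_cut u g K y s (restr Y s) = true.
Proof.
  intros HK (s0 & [v Hv] & P0).
  destruct (run_falses_complete _ _ _ Hv) as [N1 H1].
  set (r := Nat.max N1 (length s0)).
  assert (Hst : open_stage g y r s0 = true).
  { apply existsb_exists. exists (length s0). rewrite in_seq, firstn_all, H1 by lia.
    split; [lia | reflexivity]. }
  assert (K0 : 0 < INR K \/ INR K <= 0) by lra.
  assert (Hk : exists r', affordable u g K y r r' = true).
  { pose proof (open_stage_measure y r) as OM. specialize (clpos y) as cp.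
    (* Half of the tolerance [cl y / k] is for the distance to the limit, half for the rounding;
       then [K * (cl y - cl y / K) = (K - 1) * cl y] suffices. The maximum with 1 covers [K = 0],
       possible when [C] is negative. *)
    set (k := Rmax (INR K) 1). assert (k1 : 1 <= k) by apply Rmax_r.
    destruct (Hcl y (cl y / (2 * k))) as [N2 H2]; [apply Rdiv_lt_0_compat; lra|].
    destruct (pow2_small (cl y / (2 * k) / 3)) as [N3 H3]; [repeat apply Rdiv_lt_0_compat; lra|].
    set (r' := Nat.max N2 N3). exists r'. apply Nat.leb_le, INR_le.
    rewrite !mult_INR, !pow2_INR.
    destruct (u_lower c u Hcost Hu y r') as [UL _].
    specialize (H2 (S r') ltac:(lia)). unfold Rdist in H2. apply Rabs_def2 in H2.
    specialize (H3 r' ltac:(lia)). pose proof (pow2_pos r). pose proof (pow2_pos r').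
    assert (X : C * cl y * 2 ^ r' <= INR K * INR (u y r' - 3)).
    { apply Rle_trans with (INR K * ((c y (S r') - 3 * / 2 ^ r') * 2 ^ r')).
      - rewrite <- Rmult_assoc. apply Rmult_le_compat_r; [lra|].
        assert (cl y - cl y / k <= c y (S r') - 3 * / 2 ^ r').
        { replace (cl y / k) with (cl y / (2 * k) + cl y / (2 * k)) by (field; lra). lra. }
        destruct K0 as [K0|K0].
        + assert (INR K >= 1) by (destruct K; [cbn in K0; lra | rewrite S_INR; pose proof (pos_INR K); lra]).
          assert (k = INR K) by (unfold k; apply Rmax_left; lra).
          apply Rle_trans with (INR K * (cl y - cl y / k)); [|apply Rmult_le_compat_l; lra].
          replace (INR K * (cl y - cl y / k)) with ((INR K - 1) * cl y); [nra|].
          rewrite <- H6. field. lra.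
        + assert (INR K = 0) by (pose proof (pos_INR K); lra). rewrite H5. nra.
      - apply Rmult_le_compat_l; [apply pos_INR|].
        replace ((c y (S r') - 3 * / 2 ^ r') * 2 ^ r') with (c y (S r') * 2 ^ r' - 3) by (field; lra).
        exact UL. }
    apply Rle_trans with (C * cl y * 2 ^ r * 2 ^ r'); [apply Rmult_le_compat_r; lra|].
    replace (C * cl y * 2 ^ r * 2 ^ r') with (C * cl y * 2 ^ r' * 2 ^ r) by ring.
    apply Rmult_le_compat_r; lra. }
  destruct Hk as [r' Hr']. exists (Nat.max r r'). intros s Hs.
  apply existsb_exists. exists r. rewrite in_seq. split; [lia|]. apply andb_true_iff. split.
  - apply existsb_exists. exists r'. rewrite in_seq. split; [lia | assumption].
  - rewrite (prefix_restr _ _ P0) in Hst.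
    apply existsb_exists in Hst as (m & Hm & E). apply existsb_exists.
    exists (Nat.min m (length s0)). rewrite in_seq in *. split; [lia|].
    assert (X : firstn (Nat.min m (length s0)) (restr Y s) = firstn m (restr Y (length s0))).
    { rewrite restr_firstn by lia. destruct (le_lt_dec m (length s0)).
      - rewrite restr_firstn by lia. now replace (Nat.min m (length s0)) with m by lia.
      - rewrite firstn_all2 by (rewrite restr_length; lia).
        now replace (Nat.min m (length s0)) with (length s0) by lia. }
    now rewrite X.
Qed.

Lemma solovay_measure K t L : (t <= L)%nat ->
  INR (cnt (fun s => solovay u g K en t s) L)
    <= INR K * (if en t =? 0 then 0 else c (pred (en t)) (S t)) * 2 ^ L.
Proof.
  intro Ht. unfold solovay. destruct (Nat.eqb_spec (en t) 0).
  - rewrite cnt_false. cbn [INR]. lra.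
  - set (x := pred (en t)).
    assert (E : cnt (open_cut u g K x t) L = (cnt (open_cut u g K x t) t * 2 ^ (L - t))%nat).
    { rewrite <- cnt_firstn_le by assumption.
      apply Nat.le_antisymm; apply cnt_mono; intros s _; now rewrite open_cut_firstn. }
    change (fun s => open_cut u g K x t s) with (open_cut u g K x t).
    rewrite E, mult_INR, pow2_INR.
    replace (2 ^ L) with (2 ^ t * 2 ^ (L - t)) by (rewrite <- pow_add; f_equal; lia).
    rewrite <- Rmult_assoc. apply Rmult_le_compat_r; [apply Rlt_le, pow2_pos|].
    now apply open_cut_measure.
Qed.

Lemma solovay_sum K L N : (N <= L)%nat -> 0 <= B ->
  INR (list_sum (map (fun t => cnt (fun s => solovay u g K en t s) L) (seq 0 N)))
    <= INR K * B * 2 ^ L.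
Proof.
  intros HN B0. pose proof (pow2_pos L). destruct N as [|N].
  - cbn [seq map list_sum fold_right INR]. apply Rmult_le_pos; [|lra].
    apply Rmult_le_pos; [apply pos_INR | assumption].
  - apply Rle_trans with (INR K *
      sum_f_R0 (fun t => if en t =? 0 then 0 else c (pred (en t)) (S t)) N * 2 ^ L).
    + induction N as [|N IH].
      * cbn [seq map list_sum fold_right]. rewrite Nat.add_0_r. apply (solovay_measure K 0 L). lia.
      * rewrite seq_S, map_app, list_sum_app, plus_INR. cbn [map list_sum fold_right Nat.add].
        rewrite Nat.add_0_r, tech5. specialize (IH ltac:(lia)).
        pose proof (solovay_measure K (S N) L ltac:(lia)). lra.
    + apply Rmult_le_compat_r; [lra|]. apply Rmult_le_compat_l; [apply pos_INR | apply HB].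
Qed.

Lemma solovay_restr K t L : (t <= L)%nat ->
  solovay u g K en t (restr Y L) = solovay u g K en t (restr Y t).
Proof.
  intro Ht. unfold solovay. destruct (en t =? 0)%nat; [reflexivity|].
  rewrite <- (open_cut_firstn u g K _ t t) by lia. now rewrite restr_firstn.
Qed.

Lemma captured_computes : ML_random Y -> captures e Y -> turing_le A Y.
Proof.
  intros HY Hcap.
  destruct (INR_unbounded (C + 1)) as [K HK]. destruct (INR_unbounded (INR K * B)) as [M HM].
  assert (B0 : 0 <= B).
  { specialize (HB 0%nat). cbn in HB. destruct Hcost as (_ & c0 & _).
    destruct (en 0 =? 0); [|specialize (c0 (pred (en 0%nat)) 1%nat)]; lra. }
  assert (M0 : 0 < INR M) by (pose proof (pos_INR K); assert (0 <= INR K * B) by nra; lra).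
  destruct (ce_open_of_comp (solovay_test u g K M en)) as [d Hd].
  { now apply comp_solovay_test. }
  assert (Td : ML_test d).
  { intro n. apply measure_le_intro. intros l Hl.
    set (L := fold_right (fun s m => Nat.max (length s) m) 0%nat l). exists L.
    assert (HL : forall s, In s l -> (length s <= L)%nat) by (apply max_length_le; lia).
    split; [exact HL|].
    pose proof (cnt_markov nat (fun t s => solovay u g K en t s) (seq 0 L) (M * 2 ^ n) L) as Mk.
    set (Big := fun s => (M * 2 ^ n <=? length (filter (fun t => solovay u g K en t s) (seq 0 L)))%nat) in *.
    assert (Sub : (cnt (covers l) L <= cnt Big L)%nat).
    { apply cnt_mono. intros t Ht H. apply covers_spec in H as (s & Hs & Hls & Hf).
      pose proof (proj1 (Hd _ _) (Hl s Hs)) as Hs'. unfold solovay_test in Hs'. cbn [fst snd] in Hs'.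
      apply Nat.leb_le in Hs'. apply Nat.leb_le. etransitivity; [exact Hs'|].
      replace L with (length s + (L - length s))%nat by (specialize (HL s Hs); lia).
      rewrite seq_app, filter_app, length_app.
      assert (E : filter (fun i => solovay u g K en i s) (seq 0 (length s)) =
        filter (fun i => solovay u g K en i t) (seq 0 (length s))).
      { apply filter_ext_in. intros i Hi. apply in_seq in Hi. rewrite <- Hf at 1.
        unfold solovay. destruct (en i =? 0)%nat; [reflexivity|]. apply open_cut_firstn. lia. }
      rewrite E. lia. }
    apply le_INR in Mk, Sub. rewrite !mult_INR, pow2_INR in Mk.
    pose proof (solovay_sum K L L (le_n _) B0) as SS. pose proof (pow2_pos n). pose proof (pow2_pos L).
    apply Rmult_le_reg_l with (INR M * 2 ^ n); [nra|].
    replace (INR M * 2 ^ n * (/ 2 ^ n * 2 ^ L)) with (INR M * 2 ^ L) by (field; lra).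
    apply Rle_trans with (INR M * 2 ^ n * INR (cnt Big L)); [apply Rmult_le_compat_l; nra|].
    eapply Rle_trans; [exact Mk|]. eapply Rle_trans; [exact SS|]. apply Rmult_le_compat_r; lra. }
  assert (NC : exists n, ~ in_open d n Y) by (apply not_all_ex_not; exact (HY d Td)).
  destruct NC as [n Hn].
  assert (few : forall L, (length (filter (fun t => solovay u g K en t (restr Y t)) (seq 0 L)) < M * 2 ^ n)%nat).
  { intro L. apply Nat.nle_gt. intro X. apply Hn. exists (restr Y L). split; [|apply restr_prefix].
    apply Hd. unfold solovay_test. cbn [fst snd]. rewrite restr_length. apply Nat.leb_le.
    etransitivity; [exact X|]. apply Nat.eq_le_incl. f_equal. apply filter_ext_in.
    intros t Ht. apply in_seq in Ht. symmetry. apply solovay_restr. lia. }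
  assert (fin : exists s1, forall t, (s1 <= t)%nat -> solovay u g K en t (restr Y t) = false).
  { apply NNPP. intro NF.
    assert (many : forall k, exists L,
      (k <= length (filter (fun t => solovay u g K en t (restr Y t)) (seq 0 L)))%nat).
    { induction k as [|k [L HL]]; [exists 0%nat; lia|].
      assert (X : exists t, (L <= t)%nat /\ solovay u g K en t (restr Y t) = true).
      { apply NNPP. intro N. apply NF. exists L. intros t Ht.
        apply not_true_iff_false. intro E. apply N. eauto. }
      destruct X as (t & Ht & Et). exists (S t). rewrite seq_S, filter_app, length_app.
      cbn [filter Nat.add]. rewrite Et. cbn [length].
      replace t with (L + (t - L))%nat by lia. rewrite seq_app, filter_app, length_app. lia. }
    destruct (many (M * 2 ^ n)%nat) as [L HL]. specialize (few L). lia. }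
  destruct fin as [s1 Hs1].
  set (P := fun p : nat * nat => ((s1 <=? snd p) && open_cut u g K (fst p) (snd p) (restr Y (snd p)))%nat).
  assert (ex : forall x, exists s, P (x, s) = true /\ forall k, (k < s)%nat -> P (x, k) = false).
  { intro x. destruct (open_cut_complete K x ltac:(lra) (Hcap x)) as [N HN].
    destruct (dec_inh_nat_subset_has_unique_least_element (fun s => P (x, s) = true))
      as [m [[Hm Hl] _]].
    - intro k. destruct (P (x, k)); auto.
    - exists (Nat.max s1 N). unfold P. cbn [fst snd]. rewrite HN by lia.
      rewrite andb_true_r. apply Nat.leb_le. lia.
    - exists m. split; [assumption|]. intros k Hk. apply not_true_iff_false. intro E.
      apply Hl in E. lia. }
  set (f := fun x => proj1_sig (constructive_indefinite_description _ (ex x))).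
  assert (Hf : forall x, P (x, f x) = true /\ forall k, (k < f x)%nat -> P (x, k) = false)
    by (intro x; unfold f; apply proj2_sig).
  (* The number [s1] is not found effectively; it enters the program as a constant. *)
  assert (Cf : Comp (eq Y) f).
  { apply (comp_mu P); [|exact Hf]. unfold P. apply comp_andb; [comp|].
    apply comp_open_cut; [apply Cu | comp | comp | apply comp_restr; comp]. }
  assert (E : forall x, existsb (fun t => en t =? S x)%nat (seq 0 (f x)) = A x).
  { intro x. apply eq_true_iff_eq. rewrite HA, existsb_exists. split.
    - intros (t & _ & Ht). exists t. now apply Nat.eqb_eq.
    - intros [t Ht]. exists t. rewrite in_seq, Nat.eqb_eq. split; [|assumption].
      split; [lia|]. apply Nat.nle_gt. intro L. destruct (Hf x) as [Hp _].
      unfold P in Hp. cbn [fst snd] in Hp. apply andb_true_iff in Hp as [H1 H2].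
      apply Nat.leb_le in H1. specialize (Hs1 t ltac:(lia)). unfold solovay in Hs1.
      rewrite Ht in Hs1. cbn [Nat.eqb pred] in Hs1.
      rewrite <- (restr_firstn Y (f x) t), open_cut_firstn in H2 by lia.
      apply (open_cut_mono u g K x (f x) t) in H2; [congruence | lia]. }
  assert (CA : Comp (eq Y) A).
  { apply (comp_ext _ _ E). pose proof (Cen (eq Y)). comp. }
  destruct CA as [a Ha]. exists a. intro x. exact (Ha Y eq_refl x).
Qed.
End Captured.

(** * The smart set *)

Open Scope nat_scope.

Lemma run_firstn m s e x y : run (firstn m s) e x = S y -> run s e x = S y.
Proof. intro H. rewrite <- (firstn_skipn m s). now apply run_app. Qed.

Section SmartSet.
Context (u : nat -> nat -> nat).

(* The follower of [(j, k)] is the position currently used to control the measure of the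
   oracles computing [A] by program [j]; once enumerated it is replaced by the next element
   [cpair (cpair j k) i]. *)
Definition follower (j k : nat) (H : list nat) : nat :=
  cpair (cpair j k) (length (filter (fun y => fst (unpair y) =? cpair j k) H)).
(** The part of [E_j] decided by [s]; [run] returns 1 for the output 0. *)
Definition wrong (j : nat) (H : list nat) (s : list bool) : bool :=
  existsb (fun x => run s j x =? 1) H.
Definition fresh (j k : nat) (H : list nat) (s : list bool) : bool :=
  (run s j (follower j k H) =? 1) && negb (wrong j H s).
(** As [u] rounds up, a trigger means that the fresh oracles have measure above [2^j] times
    [c k (S s)]. *)
Definition trigger (s : nat) (H : list nat) : bool :=
  2 ^ stage_fst s * u (stage_snd s) s <? cnt (fresh (stage_fst s) (stage_snd s) H) s.
Definition stages : nat -> list nat :=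
  nat_rect (fun _ => list nat) []
    (fun s H => if trigger s H then follower (stage_fst s) (stage_snd s) H :: H else H).
Definition enum (s : nat) : nat :=
  if trigger s (stages s) then S (follower (stage_fst s) (stage_snd s) (stages s)) else 0.

Lemma stages_S s : stages (S s) = if trigger s (stages s)
  then follower (stage_fst s) (stage_snd s) (stages s) :: stages s else stages s.
Proof. reflexivity. Qed.

Section Computability.
Context {Q : (nat -> bool) -> Prop} (Cu : Comp Q (fun p => u (fst p) (snd p))).

Lemma comp_follower {A} `{Enc A} (j k : A -> nat) (h : A -> list nat) :
  Comp Q j -> Comp Q k -> Comp Q h -> Comp Q (fun x => follower (j x) (k x) (h x)).
Proof. intros. unfold follower. comp. Qed.

Lemma comp_wrong {A} `{Enc A} (j : A -> nat) (h : A -> list nat) (s : A -> list bool) :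
  Comp Q j -> Comp Q h -> Comp Q s -> Comp Q (fun x => wrong (j x) (h x) (s x)).
Proof. intros. unfold wrong. comp. Qed.

Lemma comp_fresh {A} `{Enc A} (j k : A -> nat) (h : A -> list nat) (s : A -> list bool) :
  Comp Q j -> Comp Q k -> Comp Q h -> Comp Q s ->
  Comp Q (fun x => fresh (j x) (k x) (h x) (s x)).
Proof.
  intros. unfold fresh. apply comp_andb; [|apply comp_negb, comp_wrong; comp].
  apply comp_eqb; [|comp]. apply comp_run; [comp | comp | apply comp_follower; comp].
Qed.

Lemma comp_trigger {A} `{Enc A} (s : A -> nat) (h : A -> list nat) :
  Comp Q s -> Comp Q h -> Comp Q (fun x => trigger (s x) (h x)).
Proof.
  intros. unfold trigger, stage_fst, stage_snd. apply comp_ltb.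
  - apply comp_mul; [comp|]. apply (comp_comp2 u); comp.
  - apply comp_cnt; [apply comp_fresh; comp | comp].
Qed.

Lemma comp_stages {A} `{Enc A} (s : A -> nat) : Comp Q s -> Comp Q (fun x => stages (s x)).
Proof.
  intro Hs. unfold stages.
  apply (comp_rec s (fun _ => []) (fun _ s H => if trigger s H then _ :: H else H));
    [assumption | comp |].
  apply comp_if; [apply comp_trigger; comp | | comp].
  apply comp_cons; [|comp]. unfold stage_fst, stage_snd. apply comp_follower; comp.
Qed.

Lemma comp_enum : Comp Q enum.
Proof.
  unfold enum. apply comp_if; [apply comp_trigger; [comp | apply comp_stages; comp] | | comp].
  apply comp_S. unfold stage_fst, stage_snd. apply comp_follower; [comp | comp | apply comp_stages; comp].
Qed.
End Computability.

Lemma stages_incl s t : s <= t -> incl (stages s) (stages t).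
Proof.
  intro H. induction H as [|t H IH]; [apply incl_refl|]. rewrite stages_S.
  destruct (trigger _ _); [now apply incl_tl | assumption].
Qed.

Lemma in_stages x s : In x (stages s) <-> exists t, t < s /\ enum t = S x.
Proof.
  induction s as [|s IH].
  - split; [intros [] | intros (t & Ht & _); lia].
  - rewrite stages_S. unfold enum in *. split.
    + destruct (trigger s (stages s)) eqn:E; [intros [<-|H]|intro H].
      * exists s. rewrite E. split; [lia | reflexivity].
      * apply IH in H as (t & Ht & Et). exists t. split; [lia | assumption].
      * apply IH in H as (t & Ht & Et). exists t. split; [lia | assumption].
    + intros (t & Ht & Et). destruct (Nat.eq_dec t s) as [->|].
      * destruct (trigger s (stages s)); [injection Et as <-; now left | discriminate].
      * assert (In x (stages s)) by (apply IH; exists t; split; [lia | assumption]).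
        destruct (trigger s (stages s)); [now right | assumption].
Qed.

(** A row is enumerated in the order of its indices, so these stay below the number of its elements,
    which is the index of the next follower. *)
Lemma stages_index s y : In y (stages s) ->
  snd (unpair y) < length (filter (fun z => fst (unpair z) =? fst (unpair y)) (stages s)).
Proof.
  induction s as [|s IH]; [intros []|]. rewrite stages_S.
  destruct (trigger s (stages s)); [|assumption]. cbn [filter]. intros [<-|H].
  - rewrite Nat.eqb_refl. unfold follower. rewrite unpair_cpair. cbn [fst snd length]. lia.
  - apply IH in H. destruct (_ =? _); cbn [length]; lia.
Qed.

Lemma follower_notin j k s : ~ In (follower j k (stages s)) (stages s).
Proof.
  intro H. apply stages_index in H. unfold follower in H. rewrite !unpair_cpair in H.
  cbn [fst snd] in H. lia.
Qed.

(** Only the enumeration of the follower itself adds an element to its row. *)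
Lemma follower_stable j k s t : s <= t ->
  follower j k (stages t) = follower j k (stages s) \/ In (follower j k (stages s)) (stages t).
Proof.
  intro H. induction H as [|t H IH]; [now left|].
  destruct IH as [E|I]; [|right; now apply (stages_incl t (S t)); [lia|]].
  rewrite stages_S. destruct (trigger t (stages t)); [|now left].
  destruct (Nat.eq_dec (cpair (stage_fst t) (stage_snd t)) (cpair j k)) as [Ec|Ec].
  - right. left. rewrite <- E. unfold follower. now rewrite Ec.
  - left. rewrite <- E. unfold follower at 1. cbn [filter]. unfold follower at 1.
    rewrite unpair_cpair. cbn [fst]. now rewrite (proj2 (Nat.eqb_neq _ _) Ec).
Qed.

Lemma wrong_mono j s t n m r : s <= t -> n <= m ->
  wrong j (stages s) (firstn n r) = true -> wrong j (stages t) (firstn m r) = true.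
Proof.
  intros Hst Hnm. unfold wrong. rewrite !existsb_exists. intros (x & Hx & E).
  exists x. split; [now apply (stages_incl s t)|]. apply Nat.eqb_eq in E. apply Nat.eqb_eq.
  apply run_firstn with n. now rewrite firstn_firstn_le.
Qed.

(** Numerator over [2^s] of the measure of [E_j] at stage [s], in the form required of the sequence
    [a] in [kucera_slaman]. *)
Definition err (j s : nat) : nat := cnt (wrong j (stages s)) s.

Lemma wrong_extend j s t n r : s <= t ->
  wrong j (stages s) (firstn n r) = true -> wrong j (stages t) r = true.
Proof.
  intros Hst H. rewrite <- (firstn_all r).
  destruct (le_lt_dec n (length r)); [now apply (wrong_mono j s t n)|].
  rewrite firstn_all2 in H by lia. rewrite <- (firstn_all r) in H.
  now apply (wrong_mono j s t (length r) (length r)).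
Qed.

Lemma err_S j s : 2 * err j s <= err j (S s).
Proof.
  unfold err. replace (2 * cnt (wrong j (stages s)) s)
    with (cnt (fun r => wrong j (stages s) (firstn s r)) (S s)).
  - apply cnt_mono. intros r _. apply wrong_extend. lia.
  - rewrite cnt_firstn_le by lia. replace (S s - s) with 1 by lia. cbn [Nat.pow]. lia.
Qed.

(** The fresh strings were outside [E_j] and join it with the follower; the factor 2 passes from
    length [s] to length [S s]. *)
Lemma err_trigger s : trigger s (stages s) = true ->
  2 * err (stage_fst s) s + 2 * cnt (fresh (stage_fst s) (stage_snd s) (stages s)) s <= err (stage_fst s) (S s).
Proof.
  intro Ht. unfold err. set (j := stage_fst s). set (k := stage_snd s).
  assert (E : forall P, cnt (fun r => P (firstn s r)) (S s) = 2 * cnt P s).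
  { intro P. rewrite cnt_firstn_le by lia. replace (S s - s) with 1 by lia. cbn [Nat.pow]. lia. }
  rewrite <- (E (wrong j (stages s))), <- (E (fresh j k (stages s))).
  apply cnt_disjoint.
  - intros r _. apply wrong_extend. lia.
  - intros r _ H. apply andb_true_iff in H as [H1 H2]. apply negb_true_iff in H2.
    split; [|assumption]. rewrite stages_S, Ht. apply existsb_exists.
    exists (follower j k (stages s)). split; [now left|]. apply Nat.eqb_eq in H1.
    apply Nat.eqb_eq, run_firstn with s, H1.
Qed.

(** The stage is read off the length of the string; [k <= length s] keeps out oracles that are in
    [E_j] at stage [k] already. *)
Definition level (j k : nat) (s : list bool) : bool :=
  (k <=? length s) && fresh j k (stages (length s)) s.
(** The levels up to [n] are intersected because a bounded test has to be nested. *)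
Definition smart_test (j : nat) (p : nat * list bool) : bool :=
  forallb (fun i => existsb (fun m => level j i (firstn m (snd p))) (seq 0 (S (length (snd p)))))
    (seq 0 (S (fst p))).

Lemma comp_smart_test j : Computable (fun p => u (fst p) (snd p)) -> Computable (smart_test j).
Proof.
  intro Cu. unfold smart_test, level. apply comp_forallb; [|comp]. apply comp_existsb; [|comp].
  apply comp_andb; [comp|]. apply comp_fresh; [comp | comp | | comp].
  apply comp_stages; [assumption | comp].
Qed.

(** * Cost of the enumeration and measure of the test *)

Open Scope R_scope.
Context (c : nat -> nat -> R) (cl : nat -> R)
  (Hcost : cost_function c) (Hcl : forall x, climit c x (cl x)) (clpos : forall x, 0 < cl x)
  (Hu : forall x s, (2 <= u x s)%nat /\ c x (S s) * 2 ^ s <= INR (u x s) <= c x (S s) * 2 ^ s + 3).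

Definition enum_cost (t : nat) : R := if (enum t =? 0)%nat then 0 else c (pred (enum t)) (S t).

(** The follower is at least [k], so it costs at most [c k (S s)]; the trigger compares this with
    the fresh measure, by which [E_j] grows at least. *)
Lemma enum_cost_le s : enum_cost s <=
  INR (err (stage_fst s) (S s)) / 2 ^ S s / 2 ^ stage_fst s - INR (err (stage_fst s) s) / 2 ^ s / 2 ^ stage_fst s.
Proof.
  pose proof (pow2_pos s). pose proof (pow2_pos (stage_fst s)).
  assert (E : INR (err (stage_fst s) s) / 2 ^ s / 2 ^ stage_fst s
    = INR (2 * err (stage_fst s) s) / 2 ^ S s / 2 ^ stage_fst s).
  { rewrite mult_INR. cbn [pow INR]. field. lra. }
  rewrite E. unfold enum_cost, enum. destruct (trigger s (stages s)) eqn:Ht.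
  - cbn [Nat.eqb pred].
    apply err_trigger in Ht as X. apply Nat.ltb_lt in Ht.
    set (j := stage_fst s) in *. set (k := stage_snd s) in *. set (fr := cnt _ _) in *.
    apply le_INR in X. rewrite plus_INR, (mult_INR 2 fr) in X.
    apply lt_INR in Ht. rewrite mult_INR, pow2_INR in Ht.
    destruct (Hu k s) as (_ & U & _).
    assert (A : c (follower j k (stages s)) (S s) <= c k (S s)).
    { apply cost_antitone; [assumption|]. unfold follower.
      pose proof (cpair_le_add j k).
      pose proof (cpair_le_add (cpair j k) (length (filter (fun y => fst (unpair y) =? cpair j k)%nat (stages s)))).
      lia. }
    eapply Rle_trans; [exact A|]. apply Rmult_le_reg_r with (2 ^ s * 2 ^ j);
      [now apply Rmult_lt_0_compat|].
    replace ((INR (err j (S s)) / 2 ^ S s / 2 ^ j - INR (2 * err j s) / 2 ^ S s / 2 ^ j) * (2 ^ s * 2 ^ j))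
      with ((INR (err j (S s)) - INR (2 * err j s)) / 2) by (cbn [pow]; field; lra).
    cbn [INR] in X. nra.
  - cbn [Nat.eqb]. pose proof (le_INR _ _ (err_S (stage_fst s) s)) as X.
    assert (0 <= (INR (err (stage_fst s) (S s)) - INR (2 * err (stage_fst s) s)) * (/ 2 ^ S s * / 2 ^ stage_fst s)).
    { apply Rmult_le_pos; [lra|]. apply Rlt_le, Rmult_lt_0_compat; apply Rinv_0_lt_compat;
        apply pow2_pos. }
    unfold Rdiv. lra.
Qed.

Lemma err_bounds j s : 0 <= INR (err j s) / 2 ^ s <= 1.
Proof.
  pose proof (pow2_pos s). pose proof (pos_INR (err j s)). split.
  - apply Rmult_le_pos; [assumption | apply Rlt_le, Rinv_0_lt_compat, H].
  - apply div_le_iff; [assumption|]. rewrite Rmult_1_l, <- pow2_INR. apply le_INR, cnt_le.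
Qed.

Lemma err_mono j s t : (s <= t)%nat -> INR (err j s) / 2 ^ s <= INR (err j t) / 2 ^ t.
Proof.
  apply (seq_mono (fun s => INR (err j s) / 2 ^ s)). intro n. pose proof (pow2_pos n).
  pose proof (le_INR _ _ (err_S j n)) as X. rewrite mult_INR in X. cbn [INR] in X.
  apply div_le_iff; [assumption|].
  replace (INR (err j (S n)) / 2 ^ S n * 2 ^ n) with (INR (err j (S n)) / 2) by (cbn [pow]; field; lra).
  lra.
Qed.

Lemma enum_cost_sum N : sum_f_R0 enum_cost N <= 2.
Proof.
  rewrite <- (Rmult_1_r 2).
  apply (budget enum_cost (fun j s => INR (err j s) / 2 ^ s / 2 ^ j) stage_fst).
  - intros j s. destruct (err_bounds j s) as [X _]. pose proof (Rinv_0_lt_compat _ (pow2_pos j)).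
    unfold Rdiv at 1. nra.
  - intros j s. apply Rmult_le_compat_r; [apply Rlt_le, Rinv_0_lt_compat, pow2_pos|].
    apply err_mono. lia.
  - intros j s. apply Rmult_le_compat_r; [apply Rlt_le, Rinv_0_lt_compat, pow2_pos|].
    apply err_bounds.
  - exact stage_fst_le.
  - exact enum_cost_le.
Qed.

Lemma enum_stage_cost t :
  stage_cost_is c (fun s x => existsb (Nat.eqb x) (stages s)) t (enum_cost t).
Proof.
  unfold stage_cost_is, enum_cost, enum. rewrite stages_S.
  destruct (trigger t (stages t)); cbn [Nat.eqb pred existsb].
  - left. exists (follower (stage_fst t) (stage_snd t) (stages t)).
    assert (N : existsb (Nat.eqb (follower (stage_fst t) (stage_snd t) (stages t))) (stages t) = false).
    { apply not_true_iff_false. intro E. apply existsb_exists in E as (x & Hx & E).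
      apply Nat.eqb_eq in E. subst x. now apply follower_notin in Hx. }
    split; [|split; [|reflexivity]].
    + now rewrite N, Nat.eqb_refl.
    + intros y Hy. rewrite (proj2 (Nat.eqb_neq y _)) by lia. reflexivity.
  - right. split; reflexivity.
Qed.

(** Each late trigger for [(j, k)] adds at least [cl k / 2] to the measure of [E_j], which is at
    most 1; here the positive limit is used. *)
Lemma finite_triggers j k : exists N, forall s, (N <= s)%nat -> stage_fst s = j -> stage_snd s = k ->
  trigger s (stages s) = false.
Proof.
  apply NNPP. intro HN.
  assert (inf : forall N, exists s, (N <= s)%nat /\ stage_fst s = j /\ stage_snd s = k /\
    trigger s (stages s) = true).
  { intro N. apply NNPP. intro H. apply HN. exists N. intros s Hs Hj Hk.
    apply not_true_iff_false. intro Ht. apply H. eauto. }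
  destruct (Hcl k (cl k / 2)) as [N0 H0]; [specialize (clpos k); lra|].
  assert (eps0 : 0 < cl k / 2) by (specialize (clpos k); lra).
  assert (grow : forall n, exists s, INR n * (cl k / 2) <= INR (err j s) / 2 ^ s).
  { induction n as [|n [s Hs]].
    - exists 0%nat. destruct (err_bounds j 0). cbn [INR]. lra.
    - destruct (inf (Nat.max s N0)) as (t & Ht & <- & <- & Tr). exists (S t).
      pose proof (err_mono (stage_fst t) s t ltac:(lia)) as M.
      apply err_trigger in Tr as X. apply Nat.ltb_lt, lt_INR in Tr.
      apply le_INR in X. rewrite plus_INR, !mult_INR in X. rewrite mult_INR, pow2_INR in Tr.
      destruct (Hu (stage_snd t) t) as (_ & U & _).
      specialize (H0 (S t) ltac:(lia)). unfold Rdist in H0. apply Rabs_def2 in H0.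
      assert (J : 1 <= 2 ^ stage_fst t) by (apply pow_R1_Rle; lra).
      pose proof (pow2_pos t). pose proof (pos_INR (u (stage_snd t) t)). cbn [INR] in X.
      set (fr := INR (cnt _ _)) in *. set (e1 := INR (err _ (S t))) in *.
      set (e0 := INR (err _ t)) in *.
      assert (F : cl (stage_snd t) / 2 * 2 ^ t <= fr) by nra.
      rewrite S_INR. apply Rle_trans with (e0 / 2 ^ t + fr / 2 ^ t).
      + apply Rmult_le_compat_r with (r := / 2 ^ t) in F; [|apply Rlt_le, Rinv_0_lt_compat; lra].
        replace (cl (stage_snd t) / 2 * 2 ^ t * / 2 ^ t) with (cl (stage_snd t) / 2) in F by (field; lra).
        change (fr / 2 ^ t) with (fr * / 2 ^ t). lra.
      + apply Rmult_le_reg_r with (2 * 2 ^ t); [lra|].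
        replace ((e0 / 2 ^ t + fr / 2 ^ t) * (2 * 2 ^ t)) with (2 * e0 + 2 * fr) by (field; lra).
        replace (e1 / 2 ^ S t * (2 * 2 ^ t)) with e1 by (cbn [pow]; field; lra). lra. }
  destruct (INR_unbounded (1 / (cl k / 2))) as [n Hn]. destruct (grow n) as [s Hs].
  destruct (err_bounds j s) as [_ X].
  apply Rmult_lt_compat_r with (r := cl k / 2) in Hn; [|assumption].
  replace (1 / (cl k / 2) * (cl k / 2)) with 1 in Hn by (field; lra). lra.
Qed.

(** If the follower has changed since stage [m], the old one is in the set; the program answers 0 on
    it, so the string has moved to [E_j]. *)
Lemma level_cover j n m t r : (m <= t)%nat -> length r = t -> level j n (firstn m r) = true ->
  (fresh j n (stages t) r = true \/ wrong j (stages t) r = true) /\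
  wrong j (stages n) (firstn n r) = false.
Proof.
  intros Hm Hr H. unfold level in H. rewrite length_firstn in H.
  replace (Nat.min m (length r)) with m in H by lia.
  apply andb_true_iff in H as [H1 H2]. apply Nat.leb_le in H1.
  apply andb_true_iff in H2 as [H2 H3]. apply negb_true_iff in H3. apply Nat.eqb_eq in H2.
  split.
  - destruct (wrong j (stages t) r) eqn:W; [now right | left].
    unfold fresh. rewrite W. cbn [negb]. rewrite andb_true_r. apply Nat.eqb_eq.
    destruct (follower_stable j n m t Hm) as [E|I].
    + rewrite E. now apply run_firstn with m.
    + exfalso. apply not_true_iff_false in W. apply W. apply existsb_exists.
      eexists. split; [exact I|]. now apply Nat.eqb_eq, run_firstn with m.
  - apply not_true_iff_false. intro W. apply (wrong_mono j n m n m r H1 H1) in W. congruence.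
Qed.

(** At a stage [t] serving [(j, n)] after the last trigger, the fresh part is at most [2^j * cl n]
    up to rounding, and the rest lies in the growth of [E_j] since stage [n]. The rounding
    [3 * 2^j / 2^t] is absorbed by [eps]. *)
Lemma smart_test_measure j D e :
  (forall s t, (s <= t)%nat -> INR (err j t) / 2 ^ t - INR (err j s) / 2 ^ s <= D * cl s) ->
  (forall n s, halts0 e (cpair n (scode s)) <-> smart_test j (n, s) = true) ->
  forall n, measure_le e n ((2 ^ j + D) * cl n).
Proof.
  intros HD He n l Hl. apply limit_le. intros eps Heps.
  destruct (finite_triggers j n) as [N1 H1].
  destruct (pow2_small (eps / (3 * 2 ^ j))) as [N2 H2].
  { pose proof (pow2_pos j). apply Rdiv_lt_0_compat; lra. }
  set (b := Nat.max (fold_right (fun s m => Nat.max (length s) m) 0%nat l)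
    (Nat.max n (Nat.max N1 N2))).
  set (t := cpair (cpair j n) b).
  assert (Hb : (b <= t)%nat) by (unfold t; pose proof (cpair_le_add (cpair j n) b); lia).
  assert (Ej : stage_fst t = j) by (unfold stage_fst, t; rewrite unpair_cpair; cbn [fst]; now rewrite unpair_cpair).
  assert (Ek : stage_snd t = n) by (unfold stage_snd, t; rewrite unpair_cpair; cbn [fst]; now rewrite unpair_cpair).
  assert (HL : forall s, In s l -> (length s <= t)%nat) by (apply max_length_le; lia).
  rewrite (lmeasure_eq l t HL).
  specialize (H1 t ltac:(lia) Ej Ek). unfold trigger in H1. rewrite Ej, Ek in H1.
  apply Nat.ltb_ge, le_INR in H1. rewrite mult_INR, pow2_INR in H1.
  destruct (Hu n t) as (_ & _ & U). pose proof (cost_le_limit c cl Hcost Hcl n (S t)) as CL.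
  set (wn := fun r => wrong j (stages n) (firstn n r)).
  (* Counted without subtraction: the strings wrong at stage [n] are disjoint from the covered ones,
     and both kinds are fresh or wrong at stage [t]. *)
  assert (X : (cnt (covers l) t + cnt wn t <= cnt (fresh j n (stages t)) t + err j t)%nat).
  { etransitivity; [|apply (cnt_union (fun r => covers l r || wn r))].
    - rewrite Nat.add_comm. apply cnt_disjoint.
      + intros r _ W. rewrite W. apply orb_true_r.
      + intros r Hr Hc. rewrite Hc. split; [reflexivity|].
        apply covers_spec in Hc as (s & Hs & _ & Hf). apply Hl, He in Hs.
        unfold smart_test in Hs. cbn [fst snd] in Hs. rewrite forallb_forall in Hs.
        specialize (Hs n ltac:(apply in_seq; lia)). apply existsb_exists in Hs as (m & Hm & Lv).
        apply in_seq in Hm. rewrite <- Hf, length_firstn, firstn_firstn in *.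
        apply (level_cover j n _ t r) in Lv; [apply Lv | lia | assumption].
    - intros r Hr Hc. apply orb_true_iff in Hc as [Hc|W].
      + apply covers_spec in Hc as (s & Hs & _ & Hf). apply Hl, He in Hs.
        unfold smart_test in Hs. cbn [fst snd] in Hs. rewrite forallb_forall in Hs.
        specialize (Hs n ltac:(apply in_seq; lia)). apply existsb_exists in Hs as (m & Hm & Lv).
        apply in_seq in Hm. rewrite <- Hf, length_firstn, firstn_firstn in *.
        apply (level_cover j n _ t r) in Lv; [apply Lv | lia | assumption].
      + right. apply (wrong_extend j n t n r); [lia | exact W]. }
  assert (Ewn : cnt wn t = (err j n * 2 ^ (t - n))%nat) by (unfold wn; rewrite cnt_firstn_le by lia; reflexivity).
  rewrite Ewn in X. apply le_INR in X. rewrite !plus_INR, mult_INR, pow2_INR in X.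
  specialize (HD n t ltac:(lia)). specialize (H2 t ltac:(lia)).
  pose proof (pow2_pos t). pose proof (pow2_pos n). pose proof (pow2_pos j). pose proof (pow2_pos (t - n)).
  assert (Et : 2 ^ t = 2 ^ n * 2 ^ (t - n)) by (rewrite <- pow_add; f_equal; lia).
  apply div_le_iff; [assumption|].
  assert (X1 : INR (err j t) - INR (err j n) * 2 ^ (t - n) <= D * cl n * 2 ^ t).
  { apply Rmult_le_compat_r with (r := 2 ^ t) in HD; [|lra].
    replace ((INR (err j t) / 2 ^ t - INR (err j n) / 2 ^ n) * 2 ^ t)
      with (INR (err j t) - INR (err j n) * 2 ^ (t - n)) in HD; [exact HD|].
    rewrite Et. field. lra. }
  assert (X2 : 3 * 2 ^ j <= eps * 2 ^ t).
  { apply Rmult_le_compat_r with (r := 2 ^ t * (3 * 2 ^ j)) in H2; [|nra].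
    replace (/ 2 ^ t * (2 ^ t * (3 * 2 ^ j))) with (3 * 2 ^ j) in H2 by (field; lra).
    replace (eps / (3 * 2 ^ j) * (2 ^ t * (3 * 2 ^ j))) with (eps * 2 ^ t) in H2 by (field; lra).
    exact H2. }
  assert (X3 : 2 ^ j * INR (u n t) <= 2 ^ j * (cl n * 2 ^ t + 3)).
  { apply Rmult_le_compat_l; [lra|]. nra. }
  nra.
Qed.

(** [Y] never enters [E_j], since its program answers 1 on the elements of [A]. On the final
    follower, which stays outside [A], it answers 0. *)
Lemma smart_test_captures A Y e0 e :
  (forall x, A x = true <-> exists t, enum t = S x) ->
  (forall x, eval Y e0 x (if A x then 1%nat else 0%nat)) ->
  (forall n s, halts0 e (cpair n (scode s)) <-> smart_test (gcode e0) (n, s) = true) ->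
  captures e Y.
Proof.
  intros HA HY He n. set (j := gcode e0) in *.
  assert (nw : forall s, wrong j (stages s) (restr Y s) = false).
  { intro s. apply not_true_iff_false. intro W. apply existsb_exists in W as (x & Hx & E).
    apply Nat.eqb_eq, (run_sound Y) in E; [|apply restr_prefix].
    apply in_stages in Hx as (t & _ & Ht).
    assert (Ax : A x = true) by (apply HA; eauto).
    pose proof (eval_fun _ _ _ _ (HY x) _ E) as X. rewrite Ax in X. discriminate. }
  assert (lv : forall i, exists N, forall s, (N <= s)%nat -> level j i (restr Y s) = true).
  { intro i. destruct (finite_triggers j i) as [N1 H1].
    assert (st : forall s, (N1 <= s)%nat -> follower j i (stages s) = follower j i (stages N1)).
    { intros s Hs. induction Hs as [|s Hs IH]; [reflexivity|]. rewrite <- IH, stages_S.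
      destruct (trigger s (stages s)) eqn:Tr; [|reflexivity].
      unfold follower at 1. cbn [filter]. unfold follower at 1. rewrite unpair_cpair. cbn [fst].
      destruct (Nat.eqb_spec (cpair (stage_fst s) (stage_snd s)) (cpair j i)) as [Ec|]; [|reflexivity].
      apply cpair_inj in Ec as [Ej Ei]. rewrite H1 in Tr by assumption. discriminate. }
    set (x := follower j i (stages N1)) in *.
    assert (Ax : A x = false).
    { apply not_true_iff_false. intro Ax. apply HA in Ax as [t Ht].
      apply (follower_notin j i (Nat.max N1 (S t))). rewrite st by lia.
      apply in_stages. exists t. split; [lia | assumption]. }
    pose proof (HY x) as Ex. rewrite Ax in Ex.
    destruct (run_complete _ _ _ _ Ex) as [N2 H2].
    exists (Nat.max i (Nat.max N1 N2)). intros s Hs. unfold level. rewrite restr_length.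
    apply andb_true_iff. split; [apply Nat.leb_le; lia|].
    unfold fresh. rewrite nw, st by lia. rewrite H2; [reflexivity | rewrite restr_length; lia |].
    apply restr_prefix. }
  destruct (eventually_list _ (fun i s => level j i (restr Y s) = true) (seq 0 (S n))) as [N HN].
  { intros i _. apply lv. }
  exists (restr Y N). split; [|apply restr_prefix]. apply He. unfold smart_test. cbn [fst snd].
  apply forallb_forall. intros i Hi. apply existsb_exists. exists N.
  rewrite restr_length, restr_firstn by lia. split; [apply in_seq; lia|]. now apply HN.
Qed.
End SmartSet.

Open Scope R_scope.

(** For the sequence [1 - 2^-s] the Kucera-Slaman bound makes [Om - q x] at least a positive
    multiple of [2^-(x + 1)]. *)
Lemma omega_gap_pos Z Om (q : nat -> R) Qf :
  ML_random Z -> binary_value Z Om -> (forall s, q s <= Om) ->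
  (forall s k, INR (Qf s k) <= q s * 2 ^ k < INR (Qf s k) + 1) ->
  Computable (fun p => Qf (fst p) (snd p)) -> forall x, 0 < Om - q x.
Proof.
  intros HZ HOm Hq HQf CQ x.
  destruct (kucera_slaman Z Om q Qf (fun s => 2 ^ s - 1)%nat 1 HZ HOm Hq HQf CQ) as (D & HD & H).
  - comp.
  - intro s. cbn [Nat.pow]. lia.
  - intro s. rewrite Rmult_1_l, <- pow2_INR. apply le_INR. lia.
  - specialize (H x (S x) ltac:(lia)).
    rewrite !minus_INR, !pow2_INR in H by (pose proof (Nat.pow_nonzero 2 x); pose proof (Nat.pow_nonzero 2 (S x)); lia).
    pose proof (pow2_pos x).
    assert (E : (2 ^ S x - INR 1) / 2 ^ S x - (2 ^ x - INR 1) / 2 ^ x = / (2 * 2 ^ x))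
      by (cbn [pow INR]; field; lra).
    rewrite E in H. assert (0 < / (2 * 2 ^ x)) by (apply Rinv_0_lt_compat; lra). nra.
Qed.

Theorem theorem3p3 (Z : nat -> bool) (Omega : R) (q : nat -> R) (c : nat -> nat -> R) :
  ML_random Z -> binary_value Z Omega ->
  computable_Q_seq q -> (forall s, q s <= q (S s)) -> Un_cv q Omega ->
  cost_function c -> cost_implies c (cOmega q) ->
  exists A : nat -> bool, ce_set A /\ smart q c A.
Proof.
  intros HZ HOm Cq qmono qlim Hc CI.
  destruct (rational_floor q Cq) as (Qf & CQ & HQf).
  pose proof Hc as (Hcomp & c0 & _ & _ & Hlim & _).
  set (cl := fun x => proj1_sig (constructive_indefinite_description _ (Hlim x))).
  assert (Hcl : forall x, climit c x (cl x)) by (intro x; unfold cl; apply proj2_sig).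
  destruct (cost_implies_dominates Z Omega q Qf c cl HZ HOm qmono qlim HQf CQ Hc Hcl CI)
    as (C & HC & Hdom).
  assert (Om0 : 0 <= Omega) by exact (binary_value_ge0 Z Omega HOm).
  assert (qpOm : forall s, Rmax (q s) 0 <= Omega) by (intro; now apply qp_le_Om).
  assert (clpos : forall x, 0 < cl x).
  { intro x. pose proof (omega_gap_pos Z Omega (fun s => Rmax (q s) 0) Qf HZ HOm qpOm HQf CQ x) as P.
    cbn beta in P. specialize (Hdom x). apply Rnot_le_lt. intro L. nra. }
  destruct (cost_upper c Hcomp c0) as (u & Cu & Hu).
  set (A := fun x => if excluded_middle_informative (exists t, enum u t = S x) then true else false).
  assert (HA : forall x, A x = true <-> exists t, enum u t = S x).
  { intro x. unfold A. destruct (excluded_middle_informative _) as [E|E]; split; auto; discriminate. }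
  pose proof (comp_enum u Cu) as Cen.
  assert (Hap : comp_approx A (fun s x => existsb (Nat.eqb x) (stages u s))).
  { split.
    - assert (Ca : Computable (fun p => existsb (Nat.eqb (snd p)) (stages u (fst p)))).
      { apply comp_existsb; [comp | apply comp_stages; comp]. }
      destruct Ca as [e He]. exists e. intros s x. exact (He _ I (s, x)).
    - intro x. destruct (A x) eqn:E.
      + apply HA in E as [t Ht]. exists (S t). intros s Hs. apply existsb_exists.
        exists x. rewrite Nat.eqb_refl. split; [|reflexivity]. apply in_stages.
        exists t. split; [lia | assumption].
      + exists 0%nat. intros s _. apply not_true_iff_false. intro X. apply existsb_exists in X as (y & Hy & X).
        apply Nat.eqb_eq in X. subst y. apply in_stages in Hy as (t & _ & Ht).
        assert (A x = true) by (apply HA; eauto). congruence. }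
  assert (Hob : obeys A c).
  { exists (fun s x => existsb (Nat.eqb x) (stages u s)). split; [exact Hap|].
    exists (enum_cost u c), 2. split; [apply enum_stage_cost | now apply enum_cost_sum]. }
  exists A. split.
  { destruct (ce_of_comp (fun p => enum u (snd p) =? S (fst p))%nat) as [e He]; [comp|].
    exists e. intro x. rewrite HA, He. cbn [fst snd].
    split; intros [t Ht]; exists t; now apply Nat.eqb_eq. }
  (* K-triviality is the hypothesis on [c] applied to [A], which has a computable approximation and
     obeys [c]. *)
  split; [apply CI; [eexists; exact Hap | exact Hob]|]. split; [exact Hob|].
  intros Y HY. split.
  - intros (e & [_ [C' HC']] & Hcap).
    apply (captured_computes c u cl 2 C' (enum u) A Y e); auto.
    + intro Q. now apply comp_any.
    + intro Q. now apply comp_any.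
    + intro N. now apply (enum_cost_sum u c).
  - intros [e0 He0].
    destruct (ce_open_of_comp (smart_test u (gcode e0)) (comp_smart_test u _ Cu)) as [e He].
    exists e. split; [|now apply (smart_test_captures u c cl Hcl clpos Hu A Y e0)].
    split.
    + intros n X (s & Hs & P). exists s. split; [|exact P]. apply He. apply He in Hs.
      unfold smart_test in *. cbn [fst snd] in *. rewrite forallb_forall in *.
      intros i Hi. apply Hs. rewrite in_seq in *. lia.
    (* The measures of [E_j] increase and are at most 1, so their growth after stage [n] is at most
       [D] times the gap of [Omega] at [n], hence at most [D * C * cl n]. *)
    + destruct (kucera_slaman Z Omega (fun s => Rmax (q s) 0) Qf (err u (gcode e0)) 1
        HZ HOm qpOm HQf CQ) as (D & HD & HKS).
      * unfold err. apply comp_cnt; [|comp].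
        apply comp_wrong; [comp | apply comp_stages; comp | comp].
      * apply err_S.
      * intro s. rewrite Rmult_1_l, <- pow2_INR. apply le_INR, cnt_le.
      * exists (2 ^ gcode e0 + D * C). intros n l Hl.
        rewrite (UL_sequence _ _ _ Hl (Hcl n)).
        apply (smart_test_measure u c cl Hc Hcl clpos Hu (gcode e0) (D * C) e); [|exact He].
        intros s t Hst. eapply Rle_trans; [now apply HKS|]. rewrite Rmult_assoc.
        apply Rmult_le_compat_l; [lra | apply Hdom].
Qed.
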